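(* The Riemann xi function has the infinite series representation $$\Xi(t)=\sum_{n=0}^\infty(-1)^nd_{2n}g_{2n}\left(\frac t2\right),$$ which converges uniformly on compacts for all $t\in\mathbb{C}$. More precisely, for any compact set $K\subset\mathbb{C}$ there exist constants $C_1,C_2>0$ depending on $K$ such that $$\left|\Xi(t)-\sum_{n=0}^N(-1)^nd_{2n}g_{2n}\left(\frac t2\right)\right|\le C_1e^{-C_2N^{2/3}}$$ holds for all $N\ge0$ and $t\in K$.
   Context: The Riemann xi function is $\xi(s)=\frac12 s(s-1)\pi^{-s/2}\Gamma(s/2)\zeta(s)$ (extended to an entire function), and $\Xi(t)=\xi\left(\frac12+it\right)$ for $t\in\mathbb{C}$. For $x>0$ let $\omega(x)=\sum_{m=1}^\infty(2\pi^2m^4x^2-3\pi m^2x)e^{-\pi m^2x}$. For $n\ge0$ define $$d_n=\frac{(3/2)_n}{2^{n-3/2}\,n!}\int_0^\infty\frac{\omega(x)}{(x+1)^{3/2}}\left(\frac{x-1}{x+1}\right)^n{}_2F_1\left(\frac n2+\frac34,\frac n2+\frac54;n+2;\left(\frac{x-1}{x+1}\right)^2\right)dx$$ (an absolutely convergent integral). The polynomials $g_n$ (continuous Hahn polynomials $p_n(x;\frac34,\frac34,\frac34,\frac34)$) are $$g_n(x)=i^n(n+1)\,{}_3F_2\left(-n,n+2,\tfrac34+ix;\tfrac32,\tfrac32;1\right).$$ Here $(a)_n=a(a+1)\cdots(a+n-1)$ is the Pochhammer symbol and ${}_2F_1,{}_3F_2$ are the (generalized) hypergeometric functions. *)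

(* Defs.v *)
From Stdlib Require Import Reals Factorial List.
From Coquelicot Require Import Coquelicot.

Open Scope R_scope.

Definition Cexp (z : C) : C :=
  (exp (Re z) * cos (Im z), exp (Re z) * sin (Im z)).

(* [x ^ s] for a positive real base [x] and a complex exponent [s]. *)
Definition Rcpow (x : R) (s : C) : C := Cexp (s * RtoC (ln x))%C.

(* [Rpower 0 y] is [1] (because [ln 0 = 0]); here [0 ^ y] is [0], as it should
   be for [0 < y]. *)
Definition rpow (x y : R) : R :=
  if Req_EM_T x 0 then 0 else Rpower x y.

(* Sum of a complex series. Like [Series], it is meaningful only when the series
   converges. *)
Definition CSeries (a : nat -> C) : C :=
  (Series (fun n => Re (a n)), Series (fun n => Im (a n))).

Fixpoint poch (a : R) (n : nat) : R :=
  match n with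
  | O => 1
  | S m => poch a m * (a + INR m)
  end.

Fixpoint Cpoch (a : C) (n : nat) : C :=
  match n with
  | O => RtoC 1
  | S m => (Cpoch a m * (a + RtoC (INR m)))%C
  end.

Definition hyp2F1 (a b c z : R) : R :=
  Series (fun k =>
    poch a k * poch b k / (poch c k * INR (fact k)) * z ^ k).

Definition hyp3F2 (a1 a2 a3 b1 b2 z : C) : C :=
  CSeries (fun k =>
    (Cpoch a1 k * Cpoch a2 k * Cpoch a3 k
       / (Cpoch b1 k * Cpoch b2 k * RtoC (INR (fact k))) * z ^ k)%C).

(* Euler's integral, for [0 < Re s]. *)
Definition Gamma (s : C) : C :=
  RInt_gen (V := C_R_CompleteNormedModule)
    (fun x : R => (Rcpow x (s - RtoC 1) * RtoC (exp (- x)))%C)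
    (at_right 0) (Rbar_locally p_infty).

(* The Dirichlet series, for [1 < Re s]. *)
Definition zeta (s : C) : C :=
  CSeries (fun n => Rcpow (INR (S n)) (- s)%C).

Definition entire (f : C -> C) : Prop :=
  forall z : C, @ex_derive C_AbsRing C_NormedModule f z.

(* The entire function extending [s (s - 1) pi^(-s/2) Gamma (s/2) zeta s / 2]
   from the half-plane [1 < Re s], on which the series and the integral
   converge. By the identity theorem there is at most one such function. *)
Definition is_riemann_xi (xi : C -> C) : Prop :=
  entire xi /\
  forall s : C, 1 < Re s ->
    xi s = (RtoC (1 / 2) * s * (s - RtoC 1) * Rcpow PI (- s / RtoC 2)
              * Gamma (s / RtoC 2) * zeta s)%C.

Definition Xi_of (xi : C -> C) (t : C) : C := xi (RtoC (1 / 2) + Ci * t)%C.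

Definition omega (x : R) : R :=
  Series (fun k =>
    let m := INR (S k) in
    (2 * PI ^ 2 * m ^ 4 * x ^ 2 - 3 * PI * m ^ 2 * x)
      * exp (- (PI * m ^ 2 * x))).

Definition d (n : nat) : R :=
  poch (3 / 2) n / (Rpower 2 (INR n - 3 / 2) * INR (fact n)) *
  RInt_gen (V := R_CompleteNormedModule)
    (fun x : R =>
       omega x / Rpower (x + 1) (3 / 2) * ((x - 1) / (x + 1)) ^ n
       * hyp2F1 (INR n / 2 + 3 / 4) (INR n / 2 + 5 / 4) (INR n + 2)
           (((x - 1) / (x + 1)) ^ 2))
    (at_right 0) (Rbar_locally p_infty).

Definition g (n : nat) (x : C) : C :=
  (Ci ^ n * RtoC (INR n + 1)
     * hyp3F2 (RtoC (- INR n)) (RtoC (INR n + 2)) (RtoC (3 / 4) + Ci * x)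
         (RtoC (3 / 2)) (RtoC (3 / 2)) (RtoC 1))%C.

Definition Ccompact (K : C -> Prop) : Prop :=
  forall (I : Type) (U : I -> C -> Prop),
    (forall i, open (U i)) ->
    (forall z, K z -> exists i, U i z) ->
    exists l : list I, forall z, K z -> exists i, In i l /\ U i z.

Definition xi_term (t : C) (n : nat) : C :=
  (RtoC ((-1) ^ n) * RtoC (d (2 * n)) * g (2 * n) (t / RtoC 2))%C.

(* Main.v *)
Require Import Defs.
From Stdlib Require Import Reals Lra Lia Psatz ZArith List.
From Coquelicot Require Import Coquelicot.

Open Scope R_scope.

(** Write [s = 1/2 + i t], [a = 3/4 + i t/2] and [u = (x-1)/(x+1)]. The function
    xi is the Mellin integral of [omega x * x^(s/2-1)] over the half-line. Termwise
    integration gives [s (s-1) pi^(-s/2) Gamma (s/2) zeta s / 2] when [1 < Re s]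
    ([xi_fun_mellin]). The integral is entire because [omega] decays like
    [exp (- (x + 1/x) / 4)]: at infinity this is visible on the series, and at zero
    it follows from [omega (1/x) = sqrt x * omega x] ([omega_inv]), which comes
    from differentiating the functional equation of theta twice.

    That equation ([Theta_inv]) is proved by a discrete Poisson summation due to
    Polya. The law at time [m] of a lazy random walk on the cycle of length [l] can
    be written by wrapping binomial weights around the cycle or by diagonalising
    the transition operator with cosines. When [m] grows like [l^2], binomial
    weights and powers of cosines both tend to Gaussians, and the two sides tend to
    theta at [x] and at [1/x]. The one unknown constant is found by taking [x = 1].

    The expansion rests on the power series
    [2^(-3/2) (x+1)^(3/2) x^(a-3/2) = sum_m (3/2)_m / m! * mu_m * u^m]
    ([xi_kernel_series]). Its coefficient [mu_m] is the value at [y^m] of the linear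
    functional [L] on polynomials in [y = 2 t - 1] with [L (t^k) = (a)_k / (3/2)_k].
    The values of [L] at the Chebyshev polynomials of the second kind are, up to
    sign, the [3F2] sums in the continuous Hahn polynomials ([g_even_hahn]).
    Expanding [y^m] in Chebyshev polynomials has ballot numbers as coefficients
    ([moment_expansion]), and the same ballot numbers are the coefficients of the
    [2F1] in [d n] ([poch_ratio_hyp2F1]). So with [c_m] the integral of [omega] against
    the [m]-th term of the power series, xi is [sum_m c_m mu_m], [d n] is
    [sum_m ballot m n * c_m] ([d_is_series]), and xi is the sum of the [d n] times
    Hahn values by exchanging two sums. The [c_m] of odd index vanish by the
    symmetry under [x -> 1/x], hence so do the [d n] of odd index.

    The rate comes from two competing effects. Since [|u| <= exp (- 1 / (x + 1/x))],
    the moments satisfy [c_m = O(m exp (- sqrt m / 2))]; a random walk of [m] steps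
    needs [n^2] to be comparable with [m] to reach [n], so [ballot m n] is at most
    [exp (2 m lam^2 - lam n)] for every [lam] in the unit interval. With
    [lam = n^(-1/3)] the product is at most [exp (- sqrt m / 4 - n^(2/3) / 32)]
    ([ballot_joint_decay]), while the Hahn values grow polynomially in [n],
    uniformly on compact sets ([hahn_growth]). *)

(** * Real series and limits *)

Lemma exp_monotone (x y : R) : x <= y -> exp x <= exp y.
Proof. intros [H|H]; [left; now apply exp_increasing | right; now rewrite H]. Qed.

Lemma Rpower_pos (x y : R) : 0 < Rpower x y.
Proof. apply exp_pos. Qed.

Lemma ball_R (x y e : R) : ball x e y -> x - e < y < x + e.
Proof. intros H. change (Rabs (y - x) < e) in H. apply Rabs_def2 in H. lra. Qed.

Lemma pow_exp_bound (k : nat) (c : R) : 0 < c ->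
  exists A : R, 0 < A /\ forall y, 0 <= y -> y ^ k * exp (- (c * y)) <= A.
Proof.
  revert c; induction k as [|k IH]; intros c Hc.
  - exists 1; split; [lra|]. intros y Hy. rewrite pow_O, Rmult_1_l, <- exp_0.
    destruct (Req_dec (c * y) 0) as [E|E].
    + rewrite E, Ropp_0; lra.
    + apply Rlt_le, exp_increasing. nra.
  - destruct (IH (c / 2) ltac:(lra)) as [A [HA H]].
    exists (A * (2 / c)); split.
    { apply Rmult_lt_0_compat; [lra|]. apply Rdiv_lt_0_compat; lra. }
    intros y Hy.
    replace (y ^ S k * exp (- (c * y)))
      with ((y ^ k * exp (- (c / 2 * y))) * (y * exp (- (c / 2 * y)))).
    2:{ replace (- (c * y)) with (- (c / 2 * y) + - (c / 2 * y)) by field.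
        rewrite exp_plus; simpl; ring. }
    apply Rmult_le_compat; auto.
    + apply Rmult_le_pos; [apply pow_le; auto | left; apply exp_pos].
    + apply Rmult_le_pos; [auto | left; apply exp_pos].
    + rewrite exp_Ropp.
      assert (H1 := exp_ineq1_le (c / 2 * y)).
      apply Rmult_le_reg_r with (exp (c / 2 * y)); [apply exp_pos|].
      rewrite Rmult_assoc, Rinv_l by (apply Rgt_not_eq, exp_pos).
      apply Rle_trans with (2 / c * (c / 2 * y)); [right; field; lra|].
      apply Rmult_le_compat_l; [left; apply Rdiv_lt_0_compat; lra | lra].
Qed.

(** [sum_n] over the reals has the type [AbelianMonoid.sort R_AbelianMonoid], which
    hides equations between reals from [ring]. *)
Ltac Rring := match goal with |- @eq _ ?a ?b => change (@eq R a b); first [ring | lra] end.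

Lemma sum_n_Rext (a b : nat -> R) (N : nat) :
  (forall n, a n = b n) -> sum_n a N = sum_n b N.
Proof. exact (sum_n_ext a b N). Qed.

Lemma sum_n_RS (a : nat -> R) (N : nat) : sum_n a (S N) = sum_n a N + a (S N).
Proof. exact (sum_Sn a N). Qed.

Lemma sum_n_Rplus (a b : nat -> R) (N : nat) :
  sum_n (fun i => a i + b i) N = sum_n a N + sum_n b N.
Proof. exact (sum_n_plus (G := R_AbelianMonoid) a b N). Qed.

Lemma sum_n_Rmult (c : R) (a : nat -> R) (N : nat) :
  sum_n (fun i => c * a i) N = c * sum_n a N.
Proof. exact (sum_n_mult_l (K := R_Ring) c a N). Qed.

Lemma ex_series_telescope (a b : nat -> R) :
  (forall n, 0 <= a n) -> (forall n, a n <= b n - b (S n)) ->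
  (forall n, 0 <= b n) -> ex_series a.
Proof.
  intros Ha Hab Hb.
  assert (Hs : forall n, sum_n a n <= b 0%nat - b (S n)).
  { induction n as [|n IH]; [rewrite sum_O; apply Hab|].
    rewrite sum_n_RS. specialize (Hab (S n)). lra. }
  destruct (ex_finite_lim_seq_incr (sum_n a) (b 0%nat)) as [l Hl].
  - intros n. rewrite sum_n_RS. specialize (Ha (S n)). lra.
  - intros n. specialize (Hs n); specialize (Hb (S n)); lra.
  - exists l. exact Hl.
Qed.

(** Telescoping: by the mean value theorem the terms are at most the increments of
    [- x^(1-p) / (p-1)]. *)
Lemma ex_series_Rpower (p : R) : 1 < p ->
  ex_series (fun n => Rpower (INR (S n)) (- p)).
Proof.
  intros Hp. apply (ex_series_incr_1 (fun n => Rpower (INR (S n)) (- p))).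
  apply ex_series_telescope with
    (b := fun n => Rpower (INR (S n)) (- (p - 1)) / (p - 1)).
  - intros n; left; apply exp_pos.
  - intros n.
    assert (H0 : 0 < INR (S n)) by (apply lt_0_INR; lia).
    assert (HS : INR (S (S n)) = INR (S n) + 1) by (rewrite (S_INR (S n)); ring).
    destruct (MVT_gen (fun x => Rpower x (- (p - 1))) (INR (S n)) (INR (S (S n)))
      (fun x => - (p - 1) * Rpower x (- p))) as [c [Hc E]].
    + rewrite HS, Rmin_left, Rmax_right by lra. intros x Hx.
      unfold Rpower. auto_derive; [lra|].
      replace (- p * ln x) with (- (p - 1) * ln x + - ln x) by ring.
      rewrite exp_plus, exp_Ropp, exp_ln by lra. field; lra.
    + rewrite HS, Rmin_left, Rmax_right by lra. intros x Hx.
      apply derivable_continuous_pt. exists (- (p - 1) * Rpower x (- p)).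
      apply is_derive_Reals.
      unfold Rpower. auto_derive; [lra|].
      replace (- p * ln x) with (- (p - 1) * ln x + - ln x) by ring.
      rewrite exp_plus, exp_Ropp, exp_ln by lra. field; lra.
    + rewrite HS in Hc; rewrite Rmin_left, Rmax_right in Hc by lra.
      assert (Hle : Rpower (INR (S (S n))) (- p) <= Rpower c (- p)).
      { unfold Rpower. apply exp_monotone.
        assert (ln c <= ln (INR (S (S n)))) by (apply ln_le; lra). nra. }
      rewrite HS in *.
      apply Rmult_le_reg_l with (p - 1); [lra|].
      replace ((p - 1) * (Rpower (INR (S n)) (- (p - 1)) / (p - 1) -
        Rpower (INR (S n) + 1) (- (p - 1)) / (p - 1))) with
        (Rpower (INR (S n)) (- (p - 1)) - Rpower (INR (S n) + 1) (- (p - 1)))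
        by (field; lra).
      replace (INR (S n) + 1 - INR (S n)) with 1 in E by ring.
      apply Rle_trans with ((p - 1) * Rpower c (- p)).
      * apply Rmult_le_compat_l; lra.
      * lra.
  - intros n. apply Rlt_le, Rdiv_lt_0_compat; [apply exp_pos | lra].
Qed.

Lemma ex_series_inv_sq : ex_series (fun n => / (INR (S n)) ^ 2).
Proof.
  apply (ex_series_ext (fun n => Rpower (INR (S n)) (Ropp 2))).
  - intros n. rewrite Rpower_Ropp. f_equal.
    rewrite <- Rpower_pow by (apply lt_0_INR; lia). f_equal; simpl; ring.
  - apply ex_series_Rpower; lra.
Qed.

Lemma ex_series_Rle (a b : nat -> R) :
  (forall n, Rabs (a n) <= b n) -> ex_series b -> ex_series a.
Proof.
  intros H Hb.
  exact (ex_series_le (K := R_AbsRing) (V := R_CompleteNormedModule) a b H Hb).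
Qed.

Lemma ex_series_Rscal (c : R) (a : nat -> R) :
  ex_series a -> ex_series (fun n => c * a n).
Proof. exact (fun H => ex_series_scal_l (V := R_NormedModule) c a H). Qed.

Lemma ex_series_Rminus (a b : nat -> R) :
  ex_series a -> ex_series b -> ex_series (fun n => a n - b n).
Proof. exact (ex_series_minus (V := R_NormedModule) a b). Qed.

Lemma sum_n_le_Series (a : nat -> R) (n : nat) :
  (forall k, 0 <= a k) -> ex_series a -> sum_n a n <= Series a.
Proof.
  intros Ha Hex.
  rewrite (Series_incr_n a (S n)) by (auto; lia). simpl pred.
  rewrite <- sum_n_Reals.
  assert (0 <= Series (fun k => a (S n + k)%nat)); [|lra].
  rewrite <- (Rmult_0_l (Series (fun _ => 0))), <- Series_scal_l.
  apply Series_le; [|now apply (ex_series_incr_n a)].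
  intros k; split; [lra | rewrite Rmult_0_l; auto].
Qed.

Lemma series_tail_lim (M : nat -> R) : ex_series M ->
  is_lim_seq (fun N => Series (fun k => M (S N + k)%nat)) 0.
Proof.
  intros Hex.
  apply is_lim_seq_ext with (fun N => Series M - sum_n M N).
  - intros N. rewrite (Series_incr_n M (S N)) by (auto; lia). simpl pred.
    rewrite <- sum_n_Reals. ring.
  - replace (Finite 0) with (Finite (Series M - Series M)) by (f_equal; ring).
    apply is_lim_seq_minus'; [apply is_lim_seq_const|].
    exact (Series_correct _ Hex).
Qed.

Lemma series_rest_le (a M : nat -> R) (N : nat) :
  (forall n, Rabs (a n) <= M n) -> ex_series M ->
  Rabs (Series a - sum_n a N) <= Series (fun k => M (S N + k)%nat).
Proof.
  intros H Hex.
  assert (Ha : ex_series a) by (eapply ex_series_Rle; eauto).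
  rewrite (Series_incr_n a (S N)) by (auto; lia). simpl pred.
  rewrite <- sum_n_Reals.
  replace (sum_n a N + Series (fun k => a (S N + k)%nat) - sum_n a N) with
    (Series (fun k => a (S N + k)%nat)) by ring.
  assert (HexN : ex_series (fun k => M (S N + k)%nat))
    by (now apply (ex_series_incr_n M)).
  eapply Rle_trans; [apply Series_Rabs|].
  - eapply ex_series_Rle; [|exact HexN]. intros n; rewrite Rabs_Rabsolu; auto.
  - apply Series_le; auto. intros n; split; [apply Rabs_pos | auto].
Qed.

Lemma is_lim_seq_sum_n (a : nat -> nat -> R) (l : nat -> R) (N : nat) :
  (forall n, is_lim_seq (fun m => a m n) (l n)) ->
  is_lim_seq (fun m => sum_n (a m) N) (sum_n l N).
Proof.
  intros H; induction N as [|N IH].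
  - rewrite sum_O. eapply is_lim_seq_ext; [|apply H]. intros m; now rewrite sum_O.
  - rewrite sum_n_RS. eapply is_lim_seq_ext; [intros m; symmetry; apply sum_n_RS|].
    apply is_lim_seq_plus'; auto.
Qed.

(** Dominated convergence for series: the head is a finite sum of limits and the
    tails are small uniformly in [m]. *)
Lemma tannery (a : nat -> nat -> R) (l M : nat -> R) :
  (forall m n, Rabs (a m n) <= M n) -> ex_series M ->
  (forall n, is_lim_seq (fun m => a m n) (l n)) ->
  is_lim_seq (fun m => Series (a m)) (Series l).
Proof.
  intros Hb Hex Hl.
  assert (Hlb : forall n, Rabs (l n) <= M n).
  { intros n.
    apply (is_lim_seq_le (fun m => Rabs (a m n)) (fun _ => M n) (Rabs (l n)) (M n)).
    - intros m; apply Hb.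
    - apply (is_lim_seq_abs _ (l n)), Hl.
    - apply is_lim_seq_const. }
  apply is_lim_seq_spec. intros eps.
  destruct eps as [eps Heps]; simpl.
  assert (He : 0 < eps / 3) by lra.
  assert (HT := series_tail_lim M Hex). apply is_lim_seq_spec in HT.
  destruct (HT (mkposreal _ He)) as [N HN]; simpl in HN.
  specialize (HN N (le_n _)). rewrite Rminus_0_r in HN.
  assert (HS := is_lim_seq_sum_n a l N Hl). apply is_lim_seq_spec in HS.
  destruct (HS (mkposreal _ He)) as [m0 Hm]; simpl in Hm.
  exists m0. intros m Hmm. specialize (Hm m Hmm).
  assert (H1 := series_rest_le (a m) M N (Hb m) Hex).
  assert (H2 := series_rest_le l M N Hlb Hex). simpl in H1, H2.
  apply Rabs_def2 in HN. apply Rabs_def2 in Hm.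
  apply Rabs_le_between in H1. apply Rabs_le_between in H2.
  apply Rabs_def1; lra.
Qed.

Lemma is_lim_seq_pow2 (u : nat -> R) (x : R) :
  is_lim_seq u x -> is_lim_seq (fun m => u m ^ 2) (x ^ 2).
Proof.
  intros H. replace (x ^ 2) with (x * x) by ring.
  apply is_lim_seq_ext with (fun m => u m * u m); [intros; ring|].
  now apply is_lim_seq_mult'.
Qed.

Lemma is_lim_seq_opp' (u : nat -> R) (x : R) :
  is_lim_seq u x -> is_lim_seq (fun m => - u m) (- x).
Proof. exact (proj1 (is_lim_seq_opp u x)). Qed.

(** * A lazy random walk on a cycle *)

(** The steps are -1, 0, 1 with weights 1/4, 1/2, 1/4, so that [walk m j] is the
    binomial coefficient of [2m] over [m+j], divided by [4^m]. *)
Fixpoint walk (m : nat) (j : Z) : R :=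
  match m with
  | O => if Z.eqb j 0 then 1 else 0
  | S m => (walk m (j - 1) + 2 * walk m j + walk m (j + 1)) / 4
  end.

Lemma walk_nonneg m j : 0 <= walk m j.
Proof.
  revert j; induction m as [|m IH]; intros j; simpl.
  - destruct (Z.eqb j 0); lra.
  - assert (H1 := IH (j - 1)%Z); assert (H2 := IH j); assert (H3 := IH (j + 1)%Z).
    lra.
Qed.

Lemma walk0_pos m : 0 < walk m 0.
Proof.
  induction m as [|m IH]; simpl; [lra|].
  assert (H1 := walk_nonneg m (-1)); assert (H3 := walk_nonneg m 1). lra.
Qed.

Lemma walk_sym m j : walk m (- j) = walk m j.
Proof.
  revert j; induction m as [|m IH]; intros j; simpl.
  - destruct (Z.eqb_spec (- j) 0), (Z.eqb_spec j 0); auto; lia.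
  - replace (- j - 1)%Z with (- (j + 1))%Z by lia.
    replace (- j + 1)%Z with (- (j - 1))%Z by lia.
    rewrite !IH. field.
Qed.

Lemma walk_support m j : (Z.of_nat m < Z.abs j)%Z -> walk m j = 0.
Proof.
  revert j; induction m as [|m IH]; intros j Hj; simpl.
  - destruct (Z.eqb_spec j 0); auto; lia.
  - rewrite !IH by lia. field.
Qed.

(** The ratio of consecutive binomial coefficients, free of denominators so that it
    holds for every integer [j]. *)
Lemma walk_ratio m j :
  (INR m + IZR j + 1) * walk m (j + 1) = (INR m - IZR j) * walk m j.
Proof.
  revert j; induction m as [|m IH]; intros j.
  - simpl. destruct (Z.eqb_spec (j + 1) 0), (Z.eqb_spec j 0); try lia.
    + replace j with (-1)%Z by lia. lra.
    + subst j. lra.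
    + lra.
  - rewrite S_INR. simpl walk.
    assert (H1 := IH j). assert (H2 := IH (j - 1)%Z). assert (H3 := IH (j + 1)%Z).
    replace (j - 1 + 1)%Z with j in H2 by lia.
    replace (j + 1 - 1)%Z with j by lia.
    rewrite minus_IZR in H2. rewrite plus_IZR in H3. simpl in H2, H3.
    nra.
Qed.

(** Each ratio of consecutive weights is [1 - (2i+1)/(m+i+1)], and the odd numbers
    below [2i] add up to [i^2]. Replacing the denominators by the constant [m+J]
    keeps the bound summable in closed form. *)
Lemma walk_upper m J i : (0 < m)%nat -> (i <= J)%nat ->
  walk m (Z.of_nat i) <= walk m 0 * exp (- (INR i ^ 2 / (INR m + INR J))).
Proof.
  intros Hm. assert (HM : 0 < INR m) by (now apply lt_0_INR).
  assert (HJ := pos_INR J).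
  induction i as [|i IH]; intros Hi.
  - simpl. replace (- _) with 0 by (field; lra). rewrite exp_0; lra.
  - specialize (IH ltac:(lia)). rewrite Nat2Z.inj_succ. unfold Z.succ.
    assert (H := walk_ratio m (Z.of_nat i)). rewrite <- INR_IZR_INZ in H.
    assert (Hi0 := pos_INR i).
    assert (Hp := walk_nonneg m (Z.of_nat i)).
    assert (E : walk m (Z.of_nat i + 1) =
      (1 + - ((2 * INR i + 1) / (INR m + INR i + 1))) * walk m (Z.of_nat i)).
    { apply Rmult_eq_reg_l with (INR m + INR i + 1); [|lra]. rewrite H. field; lra. }
    rewrite E, S_INR.
    replace (- ((INR i + 1) ^ 2 / (INR m + INR J))) with
      (- (INR i ^ 2 / (INR m + INR J)) + - ((2 * INR i + 1) / (INR m + INR J)))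
      by (field; lra).
    rewrite exp_plus.
    assert (H1 := exp_ineq1_le (- ((2 * INR i + 1) / (INR m + INR i + 1)))).
    assert (H2 : exp (- ((2 * INR i + 1) / (INR m + INR i + 1)))
      <= exp (- ((2 * INR i + 1) / (INR m + INR J)))).
    { apply exp_monotone, Ropp_le_contravar.
      apply Rmult_le_compat_l; [lra|]. apply Rinv_le_contravar; [lra|].
      apply le_INR in Hi. rewrite S_INR in Hi. lra. }
    apply Rle_trans with
      (exp (- ((2 * INR i + 1) / (INR m + INR J))) * walk m (Z.of_nat i)).
    + apply Rmult_le_compat_r; lra.
    + assert (He := exp_pos (- ((2 * INR i + 1) / (INR m + INR J)))). nra.
Qed.

(** The reciprocal of the ratio is [1 + (2i+1)/(m-i)], again at most an exponential. *)
Lemma walk_lower m J i : (J < m)%nat -> (i <= J)%nat ->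
  walk m 0 * exp (- (INR i ^ 2 / (INR m - INR J))) <= walk m (Z.of_nat i).
Proof.
  intros Hm. assert (HM : INR J < INR m) by (now apply lt_INR).
  assert (HJ := pos_INR J).
  induction i as [|i IH]; intros Hi.
  - simpl. replace (- _) with 0 by (field; lra). rewrite exp_0; lra.
  - specialize (IH ltac:(lia)). rewrite Nat2Z.inj_succ. unfold Z.succ.
    assert (H := walk_ratio m (Z.of_nat i)). rewrite <- INR_IZR_INZ in H.
    assert (Hi0 := pos_INR i).
    assert (Hp := walk_nonneg m (Z.of_nat i)).
    apply le_INR in Hi. rewrite S_INR in Hi |- *.
    assert (E : walk m (Z.of_nat i + 1) =
      / (1 + ((2 * INR i + 1) / (INR m - INR i))) * walk m (Z.of_nat i)).
    { apply Rmult_eq_reg_l with (INR m + INR i + 1); [|lra]. rewrite H. field; lra. }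
    rewrite E.
    replace (- ((INR i + 1) ^ 2 / (INR m - INR J))) with
      (- (INR i ^ 2 / (INR m - INR J)) + - ((2 * INR i + 1) / (INR m - INR J)))
      by (field; lra).
    rewrite exp_plus.
    assert (H1 := exp_ineq1_le ((2 * INR i + 1) / (INR m - INR i))).
    assert (H0 : 0 <= (2 * INR i + 1) / (INR m - INR i))
      by (apply Rlt_le, Rdiv_lt_0_compat; lra).
    assert (H2 : exp (- ((2 * INR i + 1) / (INR m - INR J)))
      <= / (1 + (2 * INR i + 1) / (INR m - INR i))).
    { rewrite exp_Ropp. apply Rinv_le_contravar; [lra|].
      eapply Rle_trans; [exact H1|]. apply exp_monotone.
      apply Rmult_le_compat_l; [lra|]. apply Rinv_le_contravar; lra. }
    apply Rle_trans with
      (exp (- ((2 * INR i + 1) / (INR m - INR J))) * walk m (Z.of_nat i)).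
    + assert (He := exp_pos (- ((2 * INR i + 1) / (INR m - INR J)))). nra.
    + apply Rmult_le_compat_r; lra.
Qed.

Lemma sum_n_indicator (a : Z) (N : nat) : (0 <= a)%Z ->
  sum_n (fun i => if Z.eqb (Z.of_nat i) a then 1 else 0) N
  = if Z.leb a (Z.of_nat N) then 1 else 0.
Proof.
  intros Ha; induction N as [|N IH].
  - rewrite sum_O. destruct (Z.eqb_spec (Z.of_nat 0) a), (Z.leb_spec a (Z.of_nat 0)); auto; lia.
  - rewrite sum_n_RS, IH.
    destruct (Z.leb_spec a (Z.of_nat N)), (Z.leb_spec a (Z.of_nat (S N))),
      (Z.eqb_spec (Z.of_nat (S N)) a); try lia; lra.
Qed.

Lemma cos_2PI_mult (r : Z) (y : R) : cos (y + 2 * IZR r * PI) = cos y.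
Proof.
  destruct (Z.abs_eq_or_opp r) as [E|E].
  - replace (IZR r) with (INR (Z.to_nat r)) by (rewrite INR_IZR_INZ; f_equal; lia).
    apply cos_period.
  - rewrite <- (cos_period (y + 2 * IZR r * PI) (Z.to_nat (- r))).
    f_equal. rewrite INR_IZR_INZ, Z2Nat.id, opp_IZR by lia. ring.
Qed.

(** Dirichlet kernel: multiplying by [2 sin th] turns each cosine into a difference
    of consecutive sines. *)
Lemma cos_sum_telescope (th : R) (n : nat) :
  2 * sin th * sum_n (fun v => cos (2 * INR v * th)) n
  = sin ((2 * INR n + 1) * th) + sin th.
Proof.
  induction n as [|n IH].
  - rewrite sum_O. simpl.
    replace (2 * 0 * th) with 0 by ring. replace ((2 * 0 + 1) * th) with th by ring.
    rewrite cos_0; ring.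
  - rewrite sum_n_RS. rewrite Rmult_plus_distr_l, IH, S_INR.
    replace ((2 * INR n + 1) * th) with (2 * (INR n + 1) * th - th) by ring.
    replace ((2 * (INR n + 1) + 1) * th) with (2 * (INR n + 1) * th + th) by ring.
    rewrite sin_minus, sin_plus. ring.
Qed.

(** The law of the walk on the cycle of length [l], diagonalised: the cosine of
    frequency [v] is an eigenvector with eigenvalue [cos (pi v / l) ^ 2]. *)
Definition fourier_side (l m : nat) (r : Z) : R :=
  sum_n (fun v => cos (PI * INR v / INR l) ^ (2 * m)
                  * cos (2 * PI * INR v * IZR r / INR l)) (pred l) / INR l.

(** The law of the walk on the cycle of length [l] as a sum over the preimages in the
    line; only the [2K+1] central ones are kept. *)
Definition periodized (l K m : nat) (r : Z) : R :=
  sum_n (fun i => walk m (r + (Z.of_nat i - Z.of_nat K) * Z.of_nat l)) (2 * K).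

Lemma fourier_side_0 (l : nat) (r : Z) : (0 < l)%nat ->
  fourier_side l 0 r = if Z.eqb (r mod Z.of_nat l) 0 then 1 else 0.
Proof.
  intros Hl. assert (HL : 0 < INR l) by (now apply lt_0_INR).
  unfold fourier_side. destruct (Z.eqb_spec (r mod Z.of_nat l) 0) as [E|E].
  - apply Z.mod_divide in E; [|lia]. destruct E as [q ->].
    rewrite (sum_n_Rext _ (fun _ => 1)).
    + rewrite sum_n_const. replace (S (pred l)) with l by lia. field; lra.
    + intros v. rewrite mult_IZR, <- INR_IZR_INZ. simpl (_ ^ _).
      replace (2 * PI * INR v * (IZR q * INR l) / INR l)
        with (0 + 2 * IZR (Z.of_nat v * q) * PI)
        by (rewrite mult_IZR, <- INR_IZR_INZ; field; lra).
      rewrite cos_2PI_mult, cos_0; ring.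
  - set (th := PI * IZR r / INR l).
    rewrite (sum_n_Rext _ (fun v => cos (2 * INR v * th))).
    2:{ intros v. simpl (_ ^ _). rewrite Rmult_1_l. f_equal. unfold th; field; lra. }
    assert (H := cos_sum_telescope th (pred l)).
    replace ((2 * INR (pred l) + 1) * th) with (- th + 2 * IZR r * PI) in H.
    2:{ replace (INR (pred l)) with (INR l - 1)
          by (replace l with (S (pred l)) at 1 by lia; rewrite S_INR; ring).
        unfold th; field; lra. }
    assert (Hs : sin (- th + 2 * IZR r * PI) = - sin th).
    { rewrite <- (cos_shift (- th + 2 * IZR r * PI)).
      replace (PI / 2 - (- th + 2 * IZR r * PI)) with
        ((PI / 2 + th) + 2 * IZR (- r) * PI) by (rewrite opp_IZR; ring).
      rewrite cos_2PI_mult. rewrite sin_cos. ring. }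
    rewrite Hs in H.
    assert (Hn : sin th <> 0).
    { intros H0. apply sin_eq_0_0 in H0. destruct H0 as [k Hk].
      apply E, Z.mod_divide; [lia|]. exists k. apply eq_IZR.
      rewrite mult_IZR, <- INR_IZR_INZ. unfold th in Hk.
      assert (HP := PI_RGT_0).
      apply Rmult_eq_reg_l with PI; [|lra].
      apply Rmult_eq_reg_r with (/ INR l); [|apply Rinv_neq_0_compat; lra].
      transitivity (IZR k * PI); [exact Hk | field; lra]. }
    assert (H0 : sum_n (fun v => cos (2 * INR v * th)) (pred l) = 0).
    { apply Rmult_eq_reg_l with (2 * sin th); [|nra]. lra. }
    rewrite H0. field; lra.
Qed.

Lemma fourier_side_S (l m : nat) (r : Z) : (0 < l)%nat ->
  fourier_side l (S m) r =
  (fourier_side l m (r - 1) + 2 * fourier_side l m r + fourier_side l m (r + 1)) / 4.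
Proof.
  intros Hl. assert (HL : 0 < INR l) by (now apply lt_0_INR).
  unfold fourier_side.
  match goal with |- ?a / _ = (?b / _ + 2 * (?c / _) + ?d / _) / 4 =>
    cut (a = / 4 * (b + (2 * c + d))) end.
  { intros ->. field; lra. }
  rewrite <- sum_n_Rmult, <- sum_n_Rplus, <- sum_n_Rplus, <- sum_n_Rmult.
  apply sum_n_Rext. intros v.
  replace (2 * S m)%nat with (S (S (2 * m))) by lia.
  rewrite plus_IZR, minus_IZR, <- !tech_pow_Rmult.
  set (x := PI * INR v / INR l).
  replace (2 * PI * INR v * (IZR r - 1) / INR l) with
    (2 * PI * INR v * IZR r / INR l - 2 * x) by (unfold x; field; lra).
  replace (2 * PI * INR v * (IZR r + 1) / INR l) with
    (2 * PI * INR v * IZR r / INR l + 2 * x) by (unfold x; field; lra).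
  rewrite cos_minus, cos_plus, (cos_2a_cos x). field.
Qed.

Lemma periodized_S (l K m : nat) (r : Z) :
  periodized l K (S m) r =
  (periodized l K m (r - 1) + 2 * periodized l K m r + periodized l K m (r + 1)) / 4.
Proof.
  unfold periodized.
  match goal with |- ?a = (?b + 2 * ?c + ?d) / 4 =>
    cut (a = / 4 * (b + (2 * c + d))) end.
  { intros ->. field. }
  rewrite <- sum_n_Rmult, <- sum_n_Rplus, <- sum_n_Rplus, <- sum_n_Rmult.
  apply sum_n_Rext. intros i. simpl walk.
  set (s := ((Z.of_nat i - Z.of_nat K) * Z.of_nat l)%Z).
  replace (r + s - 1)%Z with (r - 1 + s)%Z by lia.
  replace (r + s + 1)%Z with (r + 1 + s)%Z by lia. field.
Qed.

(** Both sides satisfy the same recurrence in [m] and both start at the indicator of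
    the multiples of [l]. The hypothesis keeps the walk inside the window of
    preimages that the truncated sum sees. *)
Lemma periodized_fourier (l K m : nat) : (0 < l)%nat -> forall r : Z,
  (Z.abs r + Z.of_nat m <= Z.of_nat K * Z.of_nat l)%Z ->
  periodized l K m r = fourier_side l m r.
Proof.
  intros Hl; induction m as [|m IH]; intros r Hr.
  - rewrite fourier_side_0 by auto. unfold periodized.
    destruct (Z.eqb_spec (r mod Z.of_nat l) 0) as [E|E].
    + apply Z.mod_divide in E; [|lia]. destruct E as [q ->].
      assert (Hq : (Z.abs q <= Z.of_nat K)%Z) by nia.
      rewrite (sum_n_Rext _
        (fun i => if Z.eqb (Z.of_nat i) (Z.of_nat K - q) then 1 else 0)).
      * rewrite sum_n_indicator by lia.
        destruct (Z.leb_spec (Z.of_nat K - q) (Z.of_nat (2 * K))); auto; lia.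
      * intros i. simpl walk.
        destruct (Z.eqb_spec (q * Z.of_nat l + (Z.of_nat i - Z.of_nat K) * Z.of_nat l) 0),
          (Z.eqb_spec (Z.of_nat i) (Z.of_nat K - q)); auto; nia.
    + rewrite (sum_n_Rext _ (fun _ => 0)).
      * rewrite sum_n_const. ring.
      * intros i. simpl walk.
        destruct (Z.eqb_spec (r + (Z.of_nat i - Z.of_nat K) * Z.of_nat l) 0) as [E0|E0]; auto.
        exfalso; apply E, Z.mod_divide; [lia|].
        exists (Z.of_nat K - Z.of_nat i)%Z. lia.
  - rewrite periodized_S, fourier_side_S, !IH by (auto; lia). reflexivity.
Qed.

(** * The functional equation of theta *)

Lemma sum_n_Rfirst (a : nat -> R) (N : nat) :
  sum_n a (S N) = a 0%nat + sum_n (fun i => a (S i)) N.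
Proof.
  induction N as [|N IH]; rewrite sum_n_RS.
  - rewrite !sum_O. reflexivity.
  - rewrite IH, (sum_n_RS (fun i => a (S i))). Rring.
Qed.

Lemma sum_n_even (f : Z -> R) (K : nat) : (forall j, f (- j)%Z = f j) ->
  sum_n (fun i => f (Z.of_nat i - Z.of_nat K)%Z) (2 * K)
  = 2 * sum_n (fun k => f (Z.of_nat k)) K - f 0%Z.
Proof.
  intros Hf; induction K as [|K IH].
  - simpl (2 * 0)%nat. rewrite !sum_O. change (f 0%Z = 2 * f 0%Z - f 0%Z). ring.
  - replace (2 * S K)%nat with (S (S (2 * K))) by lia.
    rewrite sum_n_RS, sum_n_Rfirst, sum_n_RS.
    rewrite (sum_n_Rext (fun i => f (Z.of_nat (S i) - Z.of_nat (S K))%Z)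
      (fun i => f (Z.of_nat i - Z.of_nat K)%Z)), IH by (intros i; f_equal; lia).
    replace (Z.of_nat 0 - Z.of_nat (S K))%Z with (- Z.of_nat (S K))%Z by lia.
    rewrite Hf.
    replace (Z.of_nat (S (S (2 * K))) - Z.of_nat (S K))%Z with (Z.of_nat (S K)) by lia.
    Rring.
Qed.

Lemma sum_n_reflect (g : nat -> R) (q : nat) :
  (forall j, (j <= q)%nat -> g (q + 1 + j)%nat = g (q - j)%nat) ->
  sum_n g (2 * q) = 2 * sum_n g q - g 0%nat.
Proof.
  intros Hg.
  assert (H : forall j, (j <= q)%nat ->
    sum_n g (q + j) = 2 * sum_n g q - sum_n g (q - j)).
  { induction j as [|j IH]; intros Hj.
    - rewrite Nat.add_0_r, Nat.sub_0_r. Rring.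
    - replace (q + S j)%nat with (S (q + j)) by lia.
      rewrite sum_n_RS, IH by lia.
      replace (S (q + j)) with (q + 1 + j)%nat by lia. rewrite Hg by lia.
      replace (q - j)%nat with (S (q - S j)) by lia. rewrite sum_n_RS. Rring. }
  replace (2 * q)%nat with (q + q)%nat by lia.
  rewrite (H q (le_n _)), Nat.sub_diag, sum_O. reflexivity.
Qed.

(** Comparing the two laws at the origin. The odd length [2q+1] lets both sums be
    folded without a middle term. *)
Lemma discrete_jacobi (q m : nat) :
  2 * sum_n (fun k => walk m (Z.of_nat k * Z.of_nat (2 * q + 1))) m - walk m 0
  = (2 * sum_n (fun v => cos (PI * INR v / INR (2 * q + 1)) ^ (2 * m)) q - 1)
    / INR (2 * q + 1).
Proof.
  set (l := (2 * q + 1)%nat).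
  assert (HL : 0 < INR l) by (apply lt_0_INR; unfold l; lia).
  assert (H := periodized_fourier l m m ltac:(unfold l; lia) 0 ltac:(unfold l; nia)).
  unfold periodized, fourier_side in H. simpl (0 + _)%Z in H.
  rewrite (sum_n_even (fun j => walk m (j * Z.of_nat l))) in H.
  2:{ intros j. replace (- j * Z.of_nat l)%Z with (- (j * Z.of_nat l))%Z by lia.
      apply walk_sym. }
  replace (0 * Z.of_nat l)%Z with 0%Z in H by lia. rewrite H. clear H.
  f_equal.
  rewrite (sum_n_Rext _ (fun v => cos (PI * INR v / INR l) ^ (2 * m))).
  2:{ intros v. replace (2 * PI * INR v * 0 / INR l) with 0 by (field; lra).
      rewrite cos_0. ring. }
  replace (pred l) with (2 * q)%nat by (unfold l; lia).
  rewrite sum_n_reflect.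
  - simpl (INR 0). replace (PI * 0 / INR l) with 0 by (field; lra).
    rewrite cos_0, pow1. reflexivity.
  - intros j Hj.
    replace (PI * INR (q + 1 + j) / INR l) with (PI - PI * INR (q - j) / INR l).
    2:{ assert (E : INR l = INR (q + 1 + j) + INR (q - j))
          by (rewrite <- plus_INR; f_equal; unfold l; lia).
        rewrite E in *. field; lra. }
    rewrite cos_minus, cos_PI, sin_PI.
    replace (-1 * cos (PI * INR (q - j) / INR l) + 0 * sin (PI * INR (q - j) / INR l))
      with (- cos (PI * INR (q - j) / INR l)) by ring.
    rewrite !pow_mult. f_equal. ring.
Qed.

(** Second Taylor polynomial of the cosine, followed by [1 + y <= exp y]. *)
Lemma cos_upper (x : R) : 0 <= x <= PI / 2 ->
  0 <= cos x /\ cos x <= exp (- (x ^ 2 / 2) + x ^ 4 / 24).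
Proof.
  intros Hx. split; [apply cos_ge_0; lra|].
  destruct (cos_bound x 0 ltac:(lra) ltac:(lra)) as [_ H].
  unfold cos_approx, cos_term in H. simpl in H.
  eapply Rle_trans; [exact H|]. eapply Rle_trans; [|apply exp_ineq1_le].
  right; field.
Qed.

(** First Taylor polynomial of the cosine, with [1/(1-y) <= exp (y/(1-y))]. *)
Lemma cos_lower (x : R) : 0 <= x <= 1 ->
  exp (- ((x ^ 2 / 2) / (1 - x ^ 2 / 2))) <= cos x.
Proof.
  intros Hx. assert (HP := PI2_1).
  destruct (cos_bound x 0 ltac:(lra) ltac:(lra)) as [H _].
  unfold cos_approx, cos_term in H. simpl in H.
  assert (Hy : x ^ 2 / 2 <= 1 / 2) by nra.
  set (y := x ^ 2 / 2) in *.
  apply Rle_trans with (1 - y); [|unfold y; eapply Rle_trans; [|exact H]; right; field].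
  apply Rle_trans with (/ (1 + y / (1 - y))); [|right; field; lra].
  rewrite exp_Ropp. apply Rinv_le_contravar; [|apply exp_ineq1_le].
  assert (0 <= y / (1 - y)); [|lra].
  apply Rmult_le_pos; [unfold y; nra | left; apply Rinv_0_lt_compat; lra].
Qed.

Definition Theta (x : R) : R :=
  2 * Series (fun k => exp (- (PI * INR k ^ 2 * x))) - 1.

Lemma exp_pow (x : R) (n : nat) : exp x ^ n = exp (INR n * x).
Proof.
  induction n as [|n IH]; [simpl; now rewrite Rmult_0_l, exp_0|].
  rewrite <- tech_pow_Rmult, IH, <- exp_plus, S_INR. f_equal; ring.
Qed.

Lemma ex_series_gauss (c : R) : 0 < c ->
  ex_series (fun k => exp (- (INR k ^ 2 * c))).
Proof.
  intros Hc. apply (ex_series_Rle _ (fun k => exp (- c) ^ k)).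
  - intros k. rewrite Rabs_right by (left; apply exp_pos). rewrite exp_pow.
    apply exp_monotone.
    assert (INR k <= INR k ^ 2); [|nra].
    destruct k; [simpl; lra|]. rewrite S_INR. assert (H := pos_INR k). nra.
  - apply ex_series_geom. rewrite Rabs_right by (left; apply exp_pos).
    rewrite <- exp_0. apply exp_increasing; lra.
Qed.

Lemma gauss_series_ge_1 (c : R) : 0 < c ->
  1 <= Series (fun k => exp (- (INR k ^ 2 * c))).
Proof.
  intros Hc.
  assert (H := sum_n_le_Series (fun k => exp (- (INR k ^ 2 * c))) 0
    (fun k => Rlt_le _ _ (exp_pos _)) (ex_series_gauss _ Hc)).
  rewrite sum_O in H. replace (- (INR 0 ^ 2 * c)) with 0 in H by (simpl; ring).
  now rewrite exp_0 in H.
Qed.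

Section Limit.

Variable tau : R.
Hypothesis Htau : 0 < tau.

(** The length [2q+1] of the cycle is to be close to [sqrt (m tau)], so that [k] turns
    around the cycle have weight about [exp (- k^2 tau)]. *)
Lemma mesh_ex (m : nat) :
  { q : nat | INR q <= sqrt (INR (S m) * tau) / 2 < INR q + 1 }.
Proof.
  apply nfloor_ex. assert (H := sqrt_pos (INR (S m) * tau)). lra.
Qed.

Let q (m : nat) : nat := proj1_sig (mesh_ex m).
Let l (m : nat) : nat := (2 * q m + 1)%nat.
Let r (m : nat) : R := sqrt (INR (S m)).
Let rho (m : nat) : R := INR (l m) / r m.

Lemma r_pos m : 0 < r m.
Proof. apply sqrt_lt_R0, lt_0_INR; lia. Qed.

Lemma r_sq m : r m * r m = INR (S m).
Proof. apply sqrt_sqrt, pos_INR. Qed.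

Lemma r_ge_1 m : 1 <= r m.
Proof.
  unfold r. rewrite <- sqrt_1. apply sqrt_le_1_alt.
  rewrite S_INR. assert (H := pos_INR m). lra.
Qed.

Lemma l_bounds m : r m * sqrt tau - 1 <= INR (l m) <= r m * sqrt tau + 1.
Proof.
  unfold l, q. destruct (mesh_ex m) as [n Hn]; simpl proj1_sig.
  rewrite sqrt_mult in Hn; [|apply pos_INR|lra]. fold (r m) in Hn.
  rewrite plus_INR, mult_INR. simpl (INR 2); simpl (INR 1). lra.
Qed.

Lemma l_pos m : 1 <= INR (l m).
Proof. change 1 with (INR 1). apply le_INR; unfold l; lia. Qed.

Lemma rinv_lim : is_lim_seq (fun m => / r m) 0.
Proof.
  assert (H : is_lim_seq r p_infty).
  { unfold r. apply (filterlim_comp _ _ _ (fun m => INR (S m)) sqrt _ (Rbar_locally p_infty)).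
    - apply (is_lim_seq_incr_1 INR), is_lim_seq_INR.
    - apply filterlim_sqrt_p. }
  replace (Finite 0) with (Rbar_inv p_infty) by reflexivity.
  apply is_lim_seq_inv; [exact H | discriminate].
Qed.

Lemma rho_lim : is_lim_seq rho (sqrt tau).
Proof.
  apply is_lim_seq_le_le with (fun m => sqrt tau - / r m) (fun m => sqrt tau + / r m).
  - intros m. assert (H := l_bounds m). assert (Hr := r_pos m). unfold rho.
    split; apply Rmult_le_reg_r with (r m); auto;
      [replace ((sqrt tau - / r m) * r m) with (r m * sqrt tau - 1) by (field; lra)
      |replace ((sqrt tau + / r m) * r m) with (r m * sqrt tau + 1) by (field; lra)];
      replace (INR (l m) / r m * r m) with (INR (l m)) by (field; lra); lra.
  - replace (Finite (sqrt tau)) with (Finite (sqrt tau - 0)) by (f_equal; ring).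
    apply is_lim_seq_minus'; [apply is_lim_seq_const | apply rinv_lim].
  - replace (Finite (sqrt tau)) with (Finite (sqrt tau + 0)) by (f_equal; ring).
    apply is_lim_seq_plus'; [apply is_lim_seq_const | apply rinv_lim].
Qed.

Lemma rho_lower m : tau / 4 <= rho m * rho m.
Proof.
  assert (H := l_bounds m). assert (H1 := l_pos m). assert (Hr := r_pos m).
  assert (Hs := sqrt_sqrt tau (Rlt_le _ _ Htau)). assert (Hs0 := sqrt_lt_R0 _ Htau).
  assert (H2 : sqrt tau / 2 <= rho m).
  { unfold rho. apply Rmult_le_reg_r with (r m); auto.
    replace (INR (l m) / r m * r m) with (INR (l m)) by (field; lra).
    nra. }
  nra.
Qed.

Lemma rho_upper m : rho m <= sqrt tau + 1.
Proof.
  assert (H := l_bounds m). assert (Hr := r_pos m). assert (H1 := r_ge_1 m).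
  unfold rho. apply Rmult_le_reg_r with (r m); auto.
  replace (INR (l m) / r m * r m) with (INR (l m)) by (field; lra). nra.
Qed.

Lemma rho_pos m : 0 < rho m.
Proof.
  apply Rdiv_lt_0_compat; [|apply r_pos]. assert (H := l_pos m); lra.
Qed.

Lemma is_lim_seq_exp (u : nat -> R) (x : R) :
  is_lim_seq u x -> is_lim_seq (fun n => exp (u n)) (exp x).
Proof.
  intros H. apply (is_lim_seq_continuous exp); auto.
  apply derivable_continuous_pt, derivable_pt_exp.
Qed.

Lemma is_lim_seq_krho (k : R) :
  is_lim_seq (fun m => k * rho m * / r m) 0.
Proof.
  replace (Finite 0) with (Finite (k * sqrt tau * 0)) by (f_equal; ring).
  apply is_lim_seq_mult'; [|apply rinv_lim].
  apply is_lim_seq_mult'; [apply is_lim_seq_const | apply rho_lim].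
Qed.

(** Squeeze between [walk_lower] and [walk_upper]; both exponents tend to [k^2 tau]
    because [l^2/m] tends to [tau] and [l/m] to zero. *)
Lemma walk_limit (k : nat) :
  is_lim_seq
    (fun m => walk (S m) (Z.of_nat k * Z.of_nat (l m)) / walk (S m) 0)
    (exp (- (INR k ^ 2 * tau))).
Proof.
  assert (Hlim : forall s : R,
    is_lim_seq (fun m => exp (- ((INR k * rho m) ^ 2 / (1 + s * (INR k * rho m * / r m)))))
      (exp (- (INR k ^ 2 * tau)))).
  { intros s. apply is_lim_seq_exp.
    replace (- (INR k ^ 2 * tau)) with (- ((INR k * sqrt tau) ^ 2 / (1 + s * 0))).
    2:{ rewrite <- (sqrt_sqrt tau) at 2 by lra. field. }
    apply is_lim_seq_opp'.
    assert (H1 : is_lim_seq (fun m => INR k * rho m) (INR k * sqrt tau))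
      by (apply is_lim_seq_mult'; [apply is_lim_seq_const | apply rho_lim]).
    apply is_lim_seq_div'.
    - now apply is_lim_seq_pow2.
    - apply is_lim_seq_plus'; [apply is_lim_seq_const|].
      apply is_lim_seq_mult'; [apply is_lim_seq_const | apply is_lim_seq_krho].
    - lra. }
  refine (is_lim_seq_le_le_loc _ _ _ _ _ (Hlim (-1)) (Hlim 1)).
  assert (Hk := is_lim_seq_krho (INR k)). apply is_lim_seq_spec in Hk.
  destruct (Hk (mkposreal 1 Rlt_0_1)) as [m0 Hm0]; simpl in Hm0.
  exists m0. intros m Hm. specialize (Hm0 m Hm). rewrite Rminus_0_r in Hm0.
  apply Rabs_def2 in Hm0. destruct Hm0 as [Hm0 _].
  assert (Hr := r_pos m). assert (Hsq := r_sq m). assert (Hw := walk0_pos (S m)).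
  assert (Ekl : INR k * rho m * / r m = INR (k * l m) / INR (S m))
    by (rewrite mult_INR, <- Hsq; unfold rho; field; lra).
  assert (HM : 0 < INR (S m)) by (apply lt_0_INR; lia).
  assert (Hlt : INR (k * l m) < INR (S m)).
  { rewrite Ekl in Hm0. apply Rmult_lt_reg_r with (/ INR (S m)).
    - now apply Rinv_0_lt_compat.
    - rewrite Rinv_r by lra. exact Hm0. }
  assert (Hpos := pos_INR (k * l m)).
  rewrite <- Nat2Z.inj_mul.
  assert (Hu := walk_upper (S m) (k * l m) (k * l m) ltac:(lia) (le_n _)).
  assert (Hl := walk_lower (S m) (k * l m) (k * l m) (INR_lt _ _ Hlt) (le_n _)).
  assert (Ekr : (INR k * rho m) ^ 2 = INR (k * l m) ^ 2 / INR (S m))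
    by (rewrite mult_INR, <- Hsq; unfold rho; field; lra).
  rewrite Ekl, Ekr.
  split.
  - apply Rmult_le_reg_l with (walk (S m) 0); auto.
    replace (walk (S m) 0 * (walk (S m) (Z.of_nat (k * l m)) / walk (S m) 0))
      with (walk (S m) (Z.of_nat (k * l m))) by (field; lra).
    eapply Rle_trans; [right|exact Hl]. do 3 f_equal. field. lra.
  - apply Rmult_le_reg_l with (walk (S m) 0); auto.
    replace (walk (S m) 0 * (walk (S m) (Z.of_nat (k * l m)) / walk (S m) 0))
      with (walk (S m) (Z.of_nat (k * l m))) by (field; lra).
    eapply Rle_trans; [exact Hu|right]. do 3 f_equal. field. lra.
Qed.

(** On the support of the walk [m + k l] is at most [2m], which leaves a Gaussian in
    [k] whose width does not depend on [m]. *)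
Lemma walk_dominated (m k : nat) :
  Rabs (walk (S m) (Z.of_nat k * Z.of_nat (l m)) / walk (S m) 0)
  <= exp (- (INR k ^ 2 * (tau / 8))).
Proof.
  assert (Hw := walk0_pos (S m)).
  rewrite Rabs_right.
  2:{ apply Rle_ge, Rmult_le_pos; [apply walk_nonneg | left; now apply Rinv_0_lt_compat]. }
  assert (HM : 0 < INR (S m)) by (apply lt_0_INR; lia).
  destruct (le_lt_dec (k * l m) (S m)) as [Hle|Hlt].
  - assert (Hr := r_pos m). assert (Hsq := r_sq m).
    rewrite <- Nat2Z.inj_mul.
    assert (Hu := walk_upper (S m) (S m) (k * l m) ltac:(lia) Hle).
    apply Rmult_le_reg_l with (walk (S m) 0); auto.
    replace (walk (S m) 0 * (walk (S m) (Z.of_nat (k * l m)) / walk (S m) 0))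
      with (walk (S m) (Z.of_nat (k * l m))) by (field; lra).
    eapply Rle_trans; [exact Hu|]. apply Rmult_le_compat_l; [lra|].
    apply exp_monotone, Ropp_le_contravar.
    replace (INR (k * l m) ^ 2 / (INR (S m) + INR (S m)))
      with (INR k ^ 2 * (rho m * rho m / 2))
      by (rewrite mult_INR, <- Hsq; unfold rho; field; lra).
    apply Rmult_le_compat_l; [apply pow2_ge_0|]. assert (H := rho_lower m). lra.
  - rewrite walk_support by lia. unfold Rdiv; rewrite Rmult_0_l. left; apply exp_pos.
Qed.

Lemma walk_series_limit :
  is_lim_seq
    (fun m => Series (fun k => walk (S m) (Z.of_nat k * Z.of_nat (l m)) / walk (S m) 0))
    (Series (fun k => exp (- (INR k ^ 2 * tau)))).
Proof.
  apply tannery with (M := fun k => exp (- (INR k ^ 2 * (tau / 8)))).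
  - apply walk_dominated.
  - apply ex_series_gauss; lra.
  - apply walk_limit.
Qed.

Definition cosine_term (m v : nat) : R :=
  if le_dec v (q m) then cos (PI * INR v / INR (l m)) ^ (2 * S m) else 0.

Lemma cosine_arg (m v : nat) :
  INR (S m) * (PI * INR v / INR (l m)) ^ 2 = (PI * INR v / rho m) ^ 2.
Proof.
  assert (Hr := r_pos m). assert (H := l_pos m). rewrite <- r_sq.
  unfold rho. field. lra.
Qed.

Lemma cosine_range (m v : nat) : (v <= q m)%nat ->
  0 <= PI * INR v / INR (l m) <= PI / 2.
Proof.
  intros Hv. assert (HP := PI_RGT_0). assert (H := l_pos m). assert (Hv0 := pos_INR v).
  apply le_INR in Hv.
  assert (E : INR (l m) = 2 * INR (q m) + 1)
    by (unfold l; rewrite plus_INR, mult_INR; reflexivity).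
  split.
  - apply Rmult_le_pos; [nra | left; apply Rinv_0_lt_compat; lra].
  - apply Rmult_le_reg_r with (INR (l m)); [lra|].
    replace (PI * INR v / INR (l m) * INR (l m)) with (PI * INR v) by (field; lra).
    rewrite E. nra.
Qed.

(** Up to [pi/2] the quartic term of the Taylor bound costs at most a third of the
    quadratic one. *)
Lemma cosine_dominated (m v : nat) :
  Rabs (cosine_term m v) <= exp (- (INR v ^ 2 * / (sqrt tau + 1) ^ 2)).
Proof.
  unfold cosine_term. destruct (le_dec v (q m)) as [Hv|Hv].
  2:{ rewrite Rabs_R0; left; apply exp_pos. }
  assert (Hx := cosine_range m v Hv).
  destruct (cos_upper _ Hx) as [H0 H1].
  rewrite Rabs_right by (apply Rle_ge, pow_le; auto).
  eapply Rle_trans; [apply pow_incr; split; [exact H0|exact H1]|].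
  rewrite exp_pow. apply exp_monotone.
  set (x := PI * INR v / INR (l m)) in *.
  assert (HP4 := PI_4). assert (HP := PI2_1).
  rewrite mult_INR. simpl (INR 2).
  assert (HM : 0 < INR (S m)) by (apply lt_0_INR; lia).
  assert (HX := cosine_arg m v). fold x in HX.
  apply Rle_trans with (- (INR (S m) * x ^ 2 / 3)).
  { assert (x ^ 2 <= 4) by nra.
    assert (0 <= x ^ 2) by nra.
    replace (2 * INR (S m) * (- (x ^ 2 / 2) + x ^ 4 / 24)) with
      (- (INR (S m) * x ^ 2 * (1 - x ^ 2 / 12))) by field.
    assert (0 <= INR (S m) * x ^ 2) by nra. nra. }
  rewrite HX.
  apply Ropp_le_contravar.
  assert (Hru := rho_upper m). assert (Hrp := rho_pos m).
  assert (Hinv : / (sqrt tau + 1) <= / rho m) by (apply Rinv_le_contravar; lra).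
  assert (Hip : 0 < / (sqrt tau + 1)) by (apply Rinv_0_lt_compat; lra).
  replace (INR v ^ 2 * / (sqrt tau + 1) ^ 2) with (INR v ^ 2 * (/ (sqrt tau + 1)) ^ 2)
    by (field; lra).
  replace ((PI * INR v / rho m) ^ 2 / 3) with (INR v ^ 2 * (/ rho m) ^ 2 * (PI ^ 2 / 3))
    by (field; lra).
  assert (Hsq : (/ (sqrt tau + 1)) ^ 2 <= (/ rho m) ^ 2) by (apply pow_incr; lra).
  assert (1 <= PI ^ 2 / 3) by nra.
  assert (Hv2 := pow2_ge_0 (INR v)).
  apply Rle_trans with (INR v ^ 2 * (/ rho m) ^ 2); [nra|].
  assert (0 <= INR v ^ 2 * (/ rho m) ^ 2) by (apply Rmult_le_pos; auto; apply pow2_ge_0).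
  nra.
Qed.

Lemma cosine_limit (v : nat) :
  is_lim_seq (fun m => cosine_term m v) (exp (- (INR v ^ 2 * (PI ^ 2 / tau)))).
Proof.
  assert (Hs := sqrt_lt_R0 _ Htau). assert (HP := PI_RGT_0).
  assert (Hy : is_lim_seq (fun m => (PI * INR v / rho m) ^ 2) (INR v ^ 2 * (PI ^ 2 / tau))).
  { replace (INR v ^ 2 * (PI ^ 2 / tau)) with ((PI * INR v / sqrt tau) ^ 2).
    2:{ rewrite <- (sqrt_sqrt tau) at 2 by lra. field; lra. }
    assert (H1 : is_lim_seq (fun m => PI * INR v / rho m) (PI * INR v / sqrt tau)).
    { apply is_lim_seq_div'; [apply is_lim_seq_const | apply rho_lim | lra]. }
    now apply is_lim_seq_pow2. }
  assert (Hx : is_lim_seq (fun m => PI * INR v / INR (l m)) 0).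
  { apply is_lim_seq_ext with (fun m => PI * INR v / rho m * / r m).
    - intros m. assert (Hr := r_pos m). assert (Hl := l_pos m). unfold rho. field; lra.
    - replace (Finite 0) with (Finite (PI * INR v / sqrt tau * 0)) by (f_equal; ring).
      apply is_lim_seq_mult'; [|apply rinv_lim].
      apply is_lim_seq_div'; [apply is_lim_seq_const | apply rho_lim | lra]. }
  assert (Hx2 : is_lim_seq (fun m => (PI * INR v / INR (l m)) ^ 2) 0).
  { replace (Finite 0) with (Finite (0 ^ 2)) by (f_equal; ring).
    now apply is_lim_seq_pow2. }
  apply is_lim_seq_le_le_loc with
    (u := fun m => exp (- ((PI * INR v / rho m) ^ 2 / (1 - (PI * INR v / INR (l m)) ^ 2 / 2))))
    (w := fun m => exp (- ((PI * INR v / rho m) ^ 2 * (1 - (PI * INR v / INR (l m)) ^ 2 / 12)))).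
  - apply is_lim_seq_spec in Hx.
    assert (H1 : 0 < 1 / 2) by lra.
    destruct (Hx (mkposreal _ H1)) as [m0 Hm0]; simpl in Hm0.
    exists m0. intros m Hm. specialize (Hm0 m Hm). rewrite Rminus_0_r in Hm0.
    apply Rabs_def2 in Hm0.
    unfold cosine_term. destruct (le_dec v (q m)) as [Hv|Hv].
    + assert (Hr := cosine_range m v Hv). rewrite <- cosine_arg.
      set (x := PI * INR v / INR (l m)) in *.
      destruct (cos_upper x Hr) as [C0 C1].
      assert (C2 := cos_lower x ltac:(lra)).
      assert (Hx1 : x ^ 2 <= 1 / 4) by nra.
      split.
      * eapply Rle_trans; [|apply pow_incr; split; [left; apply exp_pos|exact C2]].
        rewrite exp_pow, mult_INR. simpl (INR 2). right; f_equal. field; lra.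
      * eapply Rle_trans; [apply pow_incr; split; [exact C0|exact C1]|].
        rewrite exp_pow, mult_INR. simpl (INR 2). right; f_equal. field; lra.
    + exfalso. assert (Hl := l_pos m).
      assert (E : INR (l m) = 2 * INR (q m) + 1)
        by (unfold l; rewrite plus_INR, mult_INR; reflexivity).
      assert (Hqv : INR (q m) + 1 <= INR v)
        by (rewrite <- S_INR; apply le_INR; lia).
      assert (HPI := PI2_1).
      assert (Hlt : PI * INR v < 1 / 2 * INR (l m)).
      { replace (PI * INR v) with (PI * INR v / INR (l m) * INR (l m)) by (field; lra).
        apply Rmult_lt_compat_r; lra. }
      nra.
  - apply is_lim_seq_exp.
    replace (- (INR v ^ 2 * (PI ^ 2 / tau))) with (- (INR v ^ 2 * (PI ^ 2 / tau) / (1 - 0 / 2)))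
      by (field; lra).
    apply is_lim_seq_opp'. apply is_lim_seq_div'; [exact Hy | | lra].
    apply is_lim_seq_minus'; [apply is_lim_seq_const|].
    apply is_lim_seq_div'; [exact Hx2 | apply is_lim_seq_const | lra].
  - apply is_lim_seq_exp.
    replace (- (INR v ^ 2 * (PI ^ 2 / tau))) with (- (INR v ^ 2 * (PI ^ 2 / tau) * (1 - 0 / 12)))
      by (field; lra).
    apply is_lim_seq_opp'. apply is_lim_seq_mult'; [exact Hy |].
    apply is_lim_seq_minus'; [apply is_lim_seq_const|].
    apply is_lim_seq_div'; [exact Hx2 | apply is_lim_seq_const | lra].
Qed.

Lemma cosine_series_limit :
  is_lim_seq (fun m => Series (cosine_term m))
    (Series (fun v => exp (- (INR v ^ 2 * (PI ^ 2 / tau))))).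
Proof.
  assert (Hs := sqrt_lt_R0 _ Htau).
  apply tannery with (M := fun v => exp (- (INR v ^ 2 * / (sqrt tau + 1) ^ 2))).
  - apply cosine_dominated.
  - apply ex_series_gauss. apply Rinv_0_lt_compat, pow_lt; lra.
  - apply cosine_limit.
Qed.

Lemma Series_finite (a : nat -> R) (N : nat) :
  (forall k, (N < k)%nat -> a k = 0) -> Series a = sum_n a N.
Proof.
  intros Ha. apply is_series_unique.
  assert (H : is_lim_seq (sum_n a) (Finite (sum_n a N))); [|exact H].
  apply (is_lim_seq_ext_loc (fun _ => sum_n a N)); [|apply is_lim_seq_const].
  exists N. intros n Hn. induction Hn as [|n Hn IH]; auto.
  rewrite sum_n_RS, <- IH, Ha by lia. Rring.
Qed.

Lemma sum_n_Rext_loc (a b : nat -> R) (N : nat) :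
  (forall n, (n <= N)%nat -> a n = b n) -> sum_n a N = sum_n b N.
Proof. exact (sum_n_ext_loc a b N). Qed.

(** The identity of the two laws divided by the weight at the origin; the left side
    is the return probability, whose asymptotics are thereby a by-product. *)
Lemma jacobi_limit :
  is_lim_seq (fun m => sqrt (INR (S m)) * walk (S m) 0)
    (Theta (PI / tau) / (sqrt tau * Theta (tau / PI))).
Proof.
  assert (HP := PI_RGT_0). assert (Hst := sqrt_lt_R0 _ Htau).
  assert (E1 : Theta (PI / tau) = 2 * Series (fun v => exp (- (INR v ^ 2 * (PI ^ 2 / tau)))) - 1).
  { unfold Theta. do 2 f_equal. apply Series_ext; intros v. do 2 f_equal. field; lra. }
  assert (E2 : Theta (tau / PI) = 2 * Series (fun k => exp (- (INR k ^ 2 * tau))) - 1).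
  { unfold Theta. do 2 f_equal. apply Series_ext; intros v. do 2 f_equal. field; lra. }
  assert (HT : 1 <= Theta (tau / PI)).
  { rewrite E2. assert (H := gauss_series_ge_1 tau Htau). lra. }
  assert (HW : forall m, 2 * Series (fun k => walk (S m) (Z.of_nat k * Z.of_nat (l m)) / walk (S m) 0) - 1
    = (2 * Series (cosine_term m) - 1) / (INR (l m) * walk (S m) 0)).
  { intros m. assert (H := discrete_jacobi (q m) (S m)). fold (l m) in H.
    assert (Hw := walk0_pos (S m)). assert (Hl := l_pos m).
    rewrite (Series_finite _ (S m)).
    2:{ intros k Hk. rewrite walk_support; [unfold Rdiv; ring|].
        assert (0 < l m)%nat by (unfold l; lia). nia. }
    rewrite (Series_finite (cosine_term m) (q m)).
    2:{ intros k Hk. unfold cosine_term. destruct (le_dec k (q m)); auto; lia. }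
    rewrite (sum_n_Rext_loc (cosine_term m)
      (fun v => cos (PI * INR v / INR (l m)) ^ (2 * S m))).
    2:{ intros k Hk. unfold cosine_term. destruct (le_dec k (q m)); auto; lia. }
    rewrite (sum_n_Rext _ (fun k => / walk (S m) 0 * walk (S m) (Z.of_nat k * Z.of_nat (l m))))
      by (intros; unfold Rdiv; ring).
    rewrite sum_n_Rmult.
    apply Rmult_eq_reg_r with (walk (S m) 0); [|lra].
    transitivity (2 * sum_n (fun k => walk (S m) (Z.of_nat k * Z.of_nat (l m))) (S m)
      - walk (S m) 0); [field; lra|].
    rewrite H. field; lra. }
  apply is_lim_seq_ext_loc with
    (fun m => (2 * Series (cosine_term m) - 1) / (rho m *
      (2 * Series (fun k => walk (S m) (Z.of_nat k * Z.of_nat (l m)) / walk (S m) 0) - 1))).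
  - assert (Hlim := walk_series_limit). apply is_lim_seq_spec in Hlim.
    assert (Hh : 0 < 1 / 4) by lra.
    destruct (Hlim (mkposreal _ Hh)) as [m0 Hm0]; cbn [pos] in Hm0.
    exists m0; intros m Hm. specialize (Hm0 m Hm). apply Rabs_def2 in Hm0.
    assert (Hge := gauss_series_ge_1 tau Htau).
    assert (Hne : 0 < 2 * Series (fun k => walk (S m) (Z.of_nat k * Z.of_nat (l m)) / walk (S m) 0) - 1)
      by lra.
    specialize (HW m). assert (Hw := walk0_pos (S m)). assert (Hl := l_pos m).
    assert (Hrho := rho_pos m). assert (Hr := r_pos m).
    fold (r m).
    set (S1 := 2 * Series (fun k => walk (S m) (Z.of_nat k * Z.of_nat (l m)) / walk (S m) 0) - 1) in *.
    assert (HC : 2 * Series (cosine_term m) - 1 = S1 * (INR (l m) * walk (S m) 0))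
      by (rewrite HW; field; lra).
    rewrite HC. unfold rho. field. lra.
  - rewrite E1, E2. apply is_lim_seq_div'.
    + apply is_lim_seq_minus'; [|apply is_lim_seq_const].
      apply is_lim_seq_mult'; [apply is_lim_seq_const | apply cosine_series_limit].
    + apply is_lim_seq_mult'; [apply rho_lim|].
      apply is_lim_seq_minus'; [|apply is_lim_seq_const].
      apply is_lim_seq_mult'; [apply is_lim_seq_const | apply walk_series_limit].
    + rewrite <- E2. nra.
Qed.

End Limit.

Lemma Theta_ge_1 (x : R) : 0 < x -> 1 <= Theta x.
Proof.
  intros Hx. unfold Theta. assert (HP := PI_RGT_0).
  rewrite (Series_ext _ (fun k => exp (- (INR k ^ 2 * (PI * x))))).
  2:{ intros k. do 2 f_equal. ring. }
  assert (H := gauss_series_ge_1 (PI * x) ltac:(nra)). lra.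
Qed.

(** The limit of [sqrt m * walk m 0] does not depend on [tau]; comparing the values of
    [jacobi_limit] for [tau = pi x] and [tau = pi] eliminates it. *)
Theorem Theta_inv (x : R) : 0 < x -> Theta (/ x) = sqrt x * Theta x.
Proof.
  intros Hx. assert (HP := PI_RGT_0).
  assert (Hs := sqrt_lt_R0 _ Hx). assert (HsP := sqrt_lt_R0 _ HP).
  assert (HT := Theta_ge_1 x Hx). assert (HT1 := Theta_ge_1 1 Rlt_0_1).
  assert (H1 := jacobi_limit PI HP).
  assert (H2 := jacobi_limit (PI * x) ltac:(nra)).
  apply is_lim_seq_unique in H1. apply is_lim_seq_unique in H2. rewrite H1 in H2.
  injection H2 as H2.
  replace (PI / PI) with 1 in H2 by (field; lra).
  replace (PI / (PI * x)) with (/ x) in H2 by (field; lra).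
  replace (PI * x / PI) with x in H2 by (field; lra).
  rewrite sqrt_mult in H2 by lra.
  apply Rmult_eq_reg_r with (/ (sqrt PI * sqrt x * Theta x)).
  2:{ apply Rinv_neq_0_compat. apply Rgt_not_eq. apply Rmult_lt_0_compat; nra. }
  transitivity (Theta 1 / (sqrt PI * Theta 1)); [symmetry; exact H2|].
  field. lra.
Qed.

(** * The function omega *)

Lemma exp_taylor1 (w : R) : Rabs (exp w - 1 - w) <= w ^ 2 * exp (Rabs w).
Proof.
  assert (H1 := exp_ineq1_le w). assert (H2 := exp_ineq1_le (- w)).
  assert (H3 : exp w * exp (- w) = 1) by (rewrite <- exp_plus, Rplus_opp_r; apply exp_0).
  assert (Hp := exp_pos w).
  rewrite Rabs_right by lra.
  assert (H4 : exp w - 1 <= w * exp w) by nra.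
  destruct (Rle_lt_dec 0 w) as [Hw|Hw].
  - rewrite (Rabs_right w) by lra. nra.
  - rewrite (Rabs_left w) by lra.
    assert (1 <= exp (- w)) by lra.
    assert (0 <= w ^ 2) by nra. nra.
Qed.

(** A quadratic remainder is the form in which termwise differentiation delivers the
    derivative. *)
Lemma is_derive_quadratic (f : R -> R) (x l M delta : R) : 0 < delta ->
  (forall h, Rabs h <= delta -> Rabs (f (x + h) - f x - h * l) <= M * h ^ 2) ->
  is_derive f x l.
Proof.
  intros Hd H. apply is_derive_Reals. intros eps Heps.
  assert (HM : 0 <= M).
  { assert (H0 := H delta ltac:(rewrite Rabs_right; lra)).
    assert (H1 := Rabs_pos (f (x + delta) - f x - delta * l)).
    assert (0 < delta ^ 2) by nra. nra. }
  assert (Hd' : 0 < Rmin delta (eps / (M + 1))).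
  { apply Rmin_glb_lt; auto. apply Rdiv_lt_0_compat; lra. }
  exists (mkposreal _ Hd'). intros h Hh Hlt; simpl in Hlt.
  assert (Hh1 : Rabs h <= delta)
    by (eapply Rle_trans; [left; exact Hlt | apply Rmin_l]).
  assert (Hh2 : Rabs h < eps / (M + 1))
    by (eapply Rlt_le_trans; [exact Hlt | apply Rmin_r]).
  specialize (H h Hh1).
  assert (Ha : 0 < Rabs h) by (now apply Rabs_pos_lt).
  replace ((f (x + h) - f x) / h - l) with ((f (x + h) - f x - h * l) / h)
    by (field; auto).
  unfold Rdiv. rewrite Rabs_mult, Rabs_inv.
  apply Rmult_lt_reg_r with (Rabs h); auto.
  rewrite Rmult_assoc, Rinv_l, Rmult_1_r by lra.
  rewrite <- (pow2_abs h) in H.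
  assert (Hk : (M + 1) * Rabs h < eps).
  { apply Rmult_lt_reg_r with (/ (M + 1)); [apply Rinv_0_lt_compat; lra|].
    replace ((M + 1) * Rabs h * / (M + 1)) with (Rabs h) by (field; lra). exact Hh2. }
  nra.
Qed.

(** Up to sign the [j]-th derivative of half of theta; the term [k = 0] contributes
    one when [j = 0] and nothing otherwise. *)
Definition theta_sum (j : nat) (x : R) : R :=
  Series (fun k => (PI * INR k ^ 2) ^ j * exp (- (PI * INR k ^ 2 * x))).

Lemma PI_sq_nonneg k : 0 <= PI * INR k ^ 2.
Proof. apply Rmult_le_pos; [left; apply PI_RGT_0 | apply pow2_ge_0]. Qed.

Lemma ex_theta_sum (j : nat) (x : R) : 0 < x ->
  ex_series (fun k => (PI * INR k ^ 2) ^ j * exp (- (PI * INR k ^ 2 * x))).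
Proof.
  intros Hx. assert (HP := PI_RGT_0).
  destruct (pow_exp_bound j (x / 2) ltac:(lra)) as [A [HA H]].
  apply (ex_series_Rle _ (fun k => A * exp (- (INR k ^ 2 * (PI * (x / 2)))))).
  - intros k. assert (Hl := PI_sq_nonneg k).
    rewrite Rabs_right.
    2:{ apply Rle_ge, Rmult_le_pos; [now apply pow_le | left; apply exp_pos]. }
    specialize (H _ Hl).
    replace (- (PI * INR k ^ 2 * x)) with
      (- (x / 2 * (PI * INR k ^ 2)) + - (INR k ^ 2 * (PI * (x / 2)))) by field.
    rewrite exp_plus, <- Rmult_assoc.
    apply Rmult_le_compat_r; [left; apply exp_pos | exact H].
  - apply ex_series_Rscal. apply ex_series_gauss. nra.
Qed.

(** Taylor's formula in each term, for increments at most [x/2]: the remainders are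
    [h^2] times the terms of the second derivative at [x/2]. *)
Lemma is_derive_theta_sum (j : nat) (x : R) : 0 < x ->
  is_derive (theta_sum j) x (- theta_sum (S j) x).
Proof.
  intros Hx.
  apply is_derive_quadratic with (theta_sum (S (S j)) (x / 2)) (x / 2); [lra|].
  intros h Hh. apply Rabs_le_between in Hh.
  assert (E0 := ex_theta_sum j x Hx). assert (E1 := ex_theta_sum (S j) x Hx).
  assert (Eh := ex_theta_sum j (x + h) ltac:(lra)).
  assert (E2 := ex_theta_sum (S (S j)) (x / 2) ltac:(lra)).
  unfold theta_sum.
  rewrite Ropp_mult_distr_r_reverse. unfold Rminus. rewrite Ropp_involutive.
  fold (Rminus (Series (fun k : nat => (PI * INR k ^ 2) ^ j * exp (- (PI * INR k ^ 2 * (x + h)))))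
    (Series (fun k : nat => (PI * INR k ^ 2) ^ j * exp (- (PI * INR k ^ 2 * x))))).
  rewrite <- Series_minus, <- Series_scal_l, <- Series_plus; auto.
  2:{ now apply ex_series_Rminus. }
  2:{ now apply ex_series_Rscal. }
  rewrite (Rmult_comm (Series _)), <- Series_scal_l.
  assert (Hb : forall k,
    Rabs ((PI * INR k ^ 2) ^ j * exp (- (PI * INR k ^ 2 * (x + h))) -
       (PI * INR k ^ 2) ^ j * exp (- (PI * INR k ^ 2 * x)) +
       h * ((PI * INR k ^ 2) ^ S j * exp (- (PI * INR k ^ 2 * x))))
    <= h ^ 2 * ((PI * INR k ^ 2) ^ S (S j) * exp (- (PI * INR k ^ 2 * (x / 2))))).
  { intros k. assert (Hl := PI_sq_nonneg k). set (lam := PI * INR k ^ 2) in *.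
    replace (lam ^ j * exp (- (lam * (x + h))) - lam ^ j * exp (- (lam * x)) +
      h * (lam ^ S j * exp (- (lam * x)))) with
      (lam ^ j * exp (- (lam * x)) * (exp (- (lam * h)) - 1 - (- (lam * h)))).
    2:{ replace (- (lam * (x + h))) with (- (lam * x) + - (lam * h)) by ring.
        rewrite exp_plus. simpl. ring. }
    assert (Hj := pow_le lam j Hl).
    rewrite Rabs_mult, (Rabs_right (lam ^ j * _)).
    2:{ apply Rle_ge, Rmult_le_pos; auto. left; apply exp_pos. }
    eapply Rle_trans.
    { apply Rmult_le_compat_l; [|apply exp_taylor1].
      apply Rmult_le_pos; auto. left; apply exp_pos. }
    replace (lam ^ j * exp (- (lam * x)) * ((- (lam * h)) ^ 2 * exp (Rabs (- (lam * h)))))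
      with (h ^ 2 * (lam ^ S (S j) * (exp (- (lam * x)) * exp (Rabs (- (lam * h))))))
      by (simpl; ring).
    apply Rmult_le_compat_l; [apply pow2_ge_0|].
    apply Rmult_le_compat_l; [now apply pow_le|].
    rewrite <- exp_plus. apply exp_monotone.
    rewrite Rabs_Ropp, Rabs_mult, (Rabs_right lam) by lra.
    assert (Rabs h <= x / 2) by (apply Rabs_le_between; lra). nra. }
  assert (Hex : ex_series (fun k =>
    h ^ 2 * ((PI * INR k ^ 2) ^ S (S j) * exp (- (PI * INR k ^ 2 * (x / 2))))))
    by (now apply ex_series_Rscal).
  eapply Rle_trans; [apply Series_Rabs|].
  - eapply ex_series_Rle; [|exact Hex]. intros k. rewrite Rabs_Rabsolu. apply Hb.
  - apply Series_le; auto. intros k; split; [apply Rabs_pos | apply Hb].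
Qed.

Lemma Theta_theta_sum x : Theta x = 2 * theta_sum 0 x - 1.
Proof.
  unfold Theta, theta_sum. do 2 f_equal. apply Series_ext; intros k.
  now rewrite pow_O, Rmult_1_l.
Qed.

Lemma omega_theta_sum (x : R) : 0 < x ->
  omega x = 2 * x ^ 2 * theta_sum 2 x - 3 * x * theta_sum 1 x.
Proof.
  intros Hx. unfold omega, theta_sum.
  assert (E1 := ex_theta_sum 1 x Hx). assert (E2 := ex_theta_sum 2 x Hx).
  rewrite (Series_incr_1 _ E1), (Series_incr_1 _ E2).
  replace (PI * INR 0 ^ 2) with 0 by (simpl; ring).
  rewrite !pow_i, !Rmult_0_l, !Rplus_0_l by lia.
  rewrite <- !Series_scal_l, <- Series_minus.
  - apply Series_ext; intros k. ring.
  - apply ex_series_Rscal. now apply ex_series_incr_1 in E2.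
  - apply ex_series_Rscal. now apply ex_series_incr_1 in E1.
Qed.

Lemma is_derive_eq_on_pos (f g : R -> R) (x lf lg : R) : 0 < x ->
  (forall y, 0 < y -> f y = g y) -> is_derive f x lf -> is_derive g x lg -> lf = lg.
Proof.
  intros Hx Hfg Hf Hg.
  rewrite <- (is_derive_unique _ _ _ Hf), <- (is_derive_unique _ _ _ Hg).
  apply Derive_ext_loc. exists (mkposreal x Hx). intros y Hy. apply Hfg.
  apply ball_R in Hy; simpl in Hy. lra.
Qed.

(** First derivative of the functional equation of theta. *)
Lemma theta_sum1_inv (x : R) : 0 < x ->
  2 * (theta_sum 1 (/ x) / x ^ 2)
  = (2 * theta_sum 0 x - 1) / (2 * sqrt x) - 2 * sqrt x * theta_sum 1 x.
Proof.
  intros Hx. assert (Hs := sqrt_lt_R0 _ Hx).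
  apply (is_derive_eq_on_pos (fun x => 2 * theta_sum 0 (/ x) - 1)
    (fun x => sqrt x * (2 * theta_sum 0 x - 1)) x); auto.
  - intros y Hy. rewrite <- !Theta_theta_sum. now apply Theta_inv.
  - assert (H := is_derive_theta_sum 0 (/ x) (Rinv_0_lt_compat _ Hx)).
    auto_derive; [split; [eexists; exact H|split; [lra|auto]]|].
    rewrite (is_derive_unique (fun x0 : R => theta_sum 0 x0) _ _ H). field. lra.
  - assert (H := is_derive_theta_sum 0 x Hx).
    auto_derive; [split; [lra|split; [eexists; exact H|auto]]|].
    rewrite (is_derive_unique (fun x0 : R => theta_sum 0 x0) _ _ H). field. lra.
Qed.

(** Second derivative of the functional equation of theta. *)
Lemma theta_sum2_inv (x : R) : 0 < x ->
  2 * (theta_sum 2 (/ x) / x ^ 4 - 2 * theta_sum 1 (/ x) / x ^ 3)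
  = - 2 * theta_sum 1 x / sqrt x - (2 * theta_sum 0 x - 1) / (4 * x * sqrt x)
    + 2 * sqrt x * theta_sum 2 x.
Proof.
  intros Hx. assert (Hs := sqrt_lt_R0 _ Hx).
  apply (is_derive_eq_on_pos (fun x => 2 * (theta_sum 1 (/ x) / x ^ 2))
    (fun x => (2 * theta_sum 0 x - 1) / (2 * sqrt x) - 2 * sqrt x * theta_sum 1 x) x); auto.
  - intros y Hy. now apply theta_sum1_inv.
  - assert (H := is_derive_theta_sum 1 (/ x) (Rinv_0_lt_compat _ Hx)).
    auto_derive; [repeat split; try (eexists; exact H); nra|].
    rewrite (is_derive_unique (fun x0 : R => theta_sum 1 x0) _ _ H). field. lra.
  - assert (H0 := is_derive_theta_sum 0 x Hx). assert (H1 := is_derive_theta_sum 1 x Hx).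
    auto_derive.
    { repeat split; try lra; try (eexists; eassumption). }
    rewrite (is_derive_unique (fun x0 : R => theta_sum 0 x0) _ _ H0).
    rewrite (is_derive_unique (fun x0 : R => theta_sum 1 x0) _ _ H1).
    assert (Hq := sqrt_sqrt x ltac:(lra)). clear H0 H1.
    generalize (theta_sum 0 x) (theta_sum 1 x) (theta_sum 2 x). intros g0 g1 g2.
    remember (sqrt x) as s eqn:E. clear E. subst x. field. nra.
Qed.

(** In terms of theta, [omega] is [x^2 theta'' + 3/2 x theta']. With [D] the operator
    [x d/dx] this is [D (D + 1/2) theta], and on [theta = x^(-1/4) h] it acts on [h] as
    [D^2 - 1/16], which preserves the symmetry [h (1/x) = h x]. *)
Theorem omega_inv (x : R) : 0 < x -> omega (/ x) = sqrt x * omega x.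
Proof.
  intros Hx. assert (Hs := sqrt_lt_R0 _ Hx). assert (Hq := sqrt_sqrt x ltac:(lra)).
  rewrite !omega_theta_sum by (auto; now apply Rinv_0_lt_compat).
  assert (H1 := theta_sum1_inv x Hx). assert (H2 := theta_sum2_inv x Hx).
  assert (E1 : theta_sum 1 (/ x) = x ^ 2 / 2 * ((2 * theta_sum 0 x - 1) / (2 * sqrt x) - 2 * sqrt x * theta_sum 1 x))
    by (rewrite <- H1; field; lra).
  assert (E2 : theta_sum 2 (/ x) = x ^ 4 / 2 * (- 2 * theta_sum 1 x / sqrt x - (2 * theta_sum 0 x - 1) / (4 * x * sqrt x)
    + 2 * sqrt x * theta_sum 2 x) + 2 * x * theta_sum 1 (/ x)) by (rewrite <- H2; field; lra).
  rewrite E2, E1. clear H1 H2 E1 E2.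
  generalize (theta_sum 0 x) (theta_sum 1 x) (theta_sum 2 x). intros g0 g1 g2.
  remember (sqrt x) as s eqn:E. clear E. subst x. field. nra.
Qed.

Lemma continuous_omega (x : R) : 0 < x -> continuous omega x.
Proof.
  intros Hx.
  apply continuous_ext_loc with (fun x => 2 * x ^ 2 * theta_sum 2 x - 3 * x * theta_sum 1 x).
  - exists (mkposreal x Hx). intros y Hy. symmetry. apply omega_theta_sum.
    apply ball_R in Hy; simpl in Hy. lra.
  - apply (ex_derive_continuous (K := R_AbsRing) (V := R_NormedModule)).
    auto_derive. repeat split; eexists; now apply is_derive_theta_sum.
Qed.

Lemma omega_large : exists A, 0 < A /\ forall x, 1 <= x -> Rabs (omega x) <= A * exp (- x).
Proof.
  destruct (pow_exp_bound 2 (1 / 2) ltac:(lra)) as [A2 [HA2 H2]].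
  destruct (pow_exp_bound 1 (1 / 2) ltac:(lra)) as [A1 [HA1 H1]].
  assert (HP := PI2_3_2).
  set (T := Series (fun k => exp (- (INR k ^ 2 * (1 / 2))))).
  assert (HT : ex_series (fun k => exp (- (INR k ^ 2 * (1 / 2))))) by (apply ex_series_gauss; lra).
  assert (HT' : ex_series (fun k => exp (- (INR (S k) ^ 2 * (1 / 2)))))
    by (now apply (ex_series_incr_1 (fun k => exp (- (INR k ^ 2 * (1 / 2)))))).
  set (T' := Series (fun k => exp (- (INR (S k) ^ 2 * (1 / 2))))).
  assert (HT0 : 0 <= T').
  { eapply Rle_trans; [|apply (sum_n_le_Series _ 0 (fun k => Rlt_le _ _ (exp_pos _)) HT')].
    rewrite sum_O. left; apply exp_pos. }
  exists ((2 * A2 + 3 * A1) * (T' + 1)). split; [apply Rmult_lt_0_compat; lra|].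
  intros x Hx.
  assert (Hb : forall k, Rabs ((2 * PI ^ 2 * INR (S k) ^ 4 * x ^ 2 - 3 * PI * INR (S k) ^ 2 * x)
      * exp (- (PI * INR (S k) ^ 2 * x)))
    <= (2 * A2 + 3 * A1) * exp (- x) * exp (- (INR (S k) ^ 2 * (1 / 2)))).
  { intros k. set (n := INR (S k)).
    assert (Hn : 1 <= n) by (change 1 with (INR 1); apply le_INR; lia).
    set (y := PI * n ^ 2 * x).
    assert (Hn2 : 1 <= n ^ 2) by nra.
    assert (Hnx : 1 <= n ^ 2 * x) by nra.
    assert (Hy : 3 * (n ^ 2 * x) <= y) by (unfold y; rewrite Rmult_assoc; nra).
    replace (2 * PI ^ 2 * n ^ 4 * x ^ 2 - 3 * PI * n ^ 2 * x) with (2 * y ^ 2 - 3 * y)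
      by (unfold y; ring).
    replace (exp (- y)) with (exp (- (1 / 2 * y)) * exp (- (1 / 2 * y)))
      by (rewrite <- exp_plus; f_equal; field).
    specialize (H2 y ltac:(lra)). specialize (H1 y ltac:(lra)).
    assert (He := exp_pos (- (1 / 2 * y))).
    rewrite <- Rmult_assoc, Rabs_mult, (Rabs_right (exp _)) by lra.
    rewrite Rmult_assoc, <- exp_plus.
    apply Rmult_le_compat; [apply Rabs_pos | lra | | apply exp_monotone; nra].
    apply Rabs_le_between.
    assert (0 <= y ^ 2) by nra.
    assert (0 <= y ^ 2 * exp (- (1 / 2 * y))) by (apply Rmult_le_pos; lra).
    assert (0 <= y ^ 1 * exp (- (1 / 2 * y))) by (apply Rmult_le_pos; [simpl; lra|lra]).
    simpl (y ^ 1) in *. rewrite Rmult_1_r in *. nra. }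
  unfold omega.
  eapply Rle_trans; [apply Series_Rabs|].
  { eapply ex_series_Rle; [intros k; rewrite Rabs_Rabsolu; apply Hb|].
    now apply ex_series_Rscal. }
  eapply Rle_trans; [apply Series_le; [intros k; split; [apply Rabs_pos | apply Hb]|]|].
  { now apply ex_series_Rscal. }
  rewrite Series_scal_l. fold T'. assert (He := exp_pos (- x)).
  assert (0 < (2 * A2 + 3 * A1) * exp (- x)) by (apply Rmult_lt_0_compat; lra).
  nra.
Qed.

(** For [x >= 1] the series gives [exp (- x)]; the functional equation transports the
    bound to [x < 1], where the factor [x^(-1/2)] costs half of the exponent. *)
Theorem omega_bound : exists A, 0 < A /\
  forall x, 0 < x -> Rabs (omega x) <= A * exp (- ((x + / x) / 4)).
Proof.
  destruct omega_large as [A [HA H]].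
  destruct (pow_exp_bound 1 (1 / 2) ltac:(lra)) as [A1 [HA1 H1]].
  exists (A * (A1 + 1)). split; [apply Rmult_lt_0_compat; lra|].
  intros x Hx. assert (Hix := Rinv_0_lt_compat _ Hx).
  assert (Hxx : x * / x = 1) by (apply Rinv_r; lra).
  destruct (Rle_lt_dec 1 x) as [Hle|Hlt].
  - eapply Rle_trans; [now apply H|].
    assert (/ x <= 1) by nra.
    assert (exp (- x) <= exp (- ((x + / x) / 4))) by (apply exp_monotone; lra).
    assert (He := exp_pos (- ((x + / x) / 4))).
    rewrite Rmult_assoc. apply Rmult_le_compat_l; nra.
  - assert (Hix1 : 1 <= / x) by nra.
    assert (E : omega x = sqrt (/ x) * omega (/ x))
      by (rewrite <- omega_inv, Rinv_inv by auto; reflexivity).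
    rewrite E, Rabs_mult. specialize (H _ Hix1). specialize (H1 (/ x) ltac:(lra)).
    rewrite pow_1 in H1.
    assert (Hs : 0 <= sqrt (/ x) <= / x).
    { split; [apply sqrt_pos|]. rewrite <- (sqrt_square (/ x)) at 2 by lra.
      apply sqrt_le_1_alt. nra. }
    rewrite (Rabs_right (sqrt _)) by lra.
    replace (exp (- / x)) with (exp (- (1 / 2 * / x)) * exp (- (1 / 2 * / x))) in H
      by (rewrite <- exp_plus; f_equal; field; lra).
    assert (Hm : exp (- (1 / 2 * / x)) <= exp (- ((x + / x) / 4)))
      by (apply exp_monotone; lra).
    assert (He := exp_pos (- (1 / 2 * / x))).
    assert (He2 := exp_pos (- ((x + / x) / 4))).
    assert (Hab := Rabs_pos (omega (/ x))).
    apply Rle_trans with (/ x * (A * (exp (- (1 / 2 * / x)) * exp (- (1 / 2 * / x))))).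
    + apply Rmult_le_compat; lra.
    + replace (/ x * (A * (exp (- (1 / 2 * / x)) * exp (- (1 / 2 * / x))))) with
        (A * ((/ x * exp (- (1 / 2 * / x))) * exp (- (1 / 2 * / x)))) by ring.
      rewrite (Rmult_assoc A). apply Rmult_le_compat_l; [lra|].
      apply Rmult_le_compat; [|lra| |lra]; [apply Rmult_le_pos|]; lra.
Qed.

(** * Improper integrals over the half-line *)

Notation at0 := (at_right 0).
Notation atoo := (Rbar_locally p_infty).

Lemma ends_eventually (d B : R) : 0 < d ->
  filter_prod at0 atoo (fun ab => 0 < fst ab < d /\ B < snd ab).
Proof.
  intros Hd. apply (Filter_prod _ _ _ (fun x => 0 < x < d) (fun x => B < x)).
  - exists (mkposreal d Hd). intros y Hy Hy0. split; auto.
    apply ball_R in Hy; simpl in Hy. lra.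
  - exists B. auto.
  - simpl; auto.
Qed.

Lemma ends_ordered : filter_prod at0 atoo (fun ab => 0 < fst ab < snd ab).
Proof.
  apply (filter_imp (fun ab => 0 < fst ab < 1 /\ 1 < snd ab)).
  - intros ab H; lra.
  - apply ends_eventually; lra.
Qed.

#[local] Instance ends_proper : ProperFilter (filter_prod at0 atoo).
Proof. apply filter_prod_proper. Qed.

Definition continuous_pos {V : UniformSpace} (f : R -> V) : Prop :=
  forall x, 0 < x -> continuous f x.

Lemma plus_minus_cancel {G : AbelianGroup} (x y : G) : minus (plus x y) x = y.
Proof.
  unfold minus. rewrite (plus_comm x), <- plus_assoc.
  exact (eq_trans (f_equal (plus y) (plus_opp_r x)) (plus_zero_r y)).
Qed.

Lemma minus_plus_cancel {G : AbelianGroup} (x y : G) : plus (minus x y) y = x.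
Proof.
  unfold minus. rewrite <- plus_assoc.
  exact (eq_trans (f_equal (plus x) (plus_opp_l y)) (plus_zero_r x)).
Qed.

Lemma minus_plus_middle {G : AbelianGroup} (p x r : G) :
  minus (plus (plus p x) r) x = plus p r.
Proof.
  rewrite (plus_comm p x), <- plus_assoc. apply plus_minus_cancel.
Qed.

Section Improper.

Context {V : CompleteNormedModule R_AbsRing}.
Implicit Types f : R -> V.

Lemma ex_RInt_pos f a b : continuous_pos f -> 0 < a -> 0 < b -> ex_RInt f a b.
Proof.
  intros Hf Ha Hb. apply ex_RInt_continuous. intros x Hx. apply Hf.
  assert (0 < Rmin a b) by (now apply Rmin_glb_lt). lra.
Qed.

(** A continuous integrand reduces the improper integral to the limit of a function
    of the two end points. *)
Lemma is_RInt_gen_of_limit f (l : V) : continuous_pos f ->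
  filterlim (fun ab => RInt f (fst ab) (snd ab)) (filter_prod at0 atoo) (locally l) ->
  is_RInt_gen f at0 atoo l.
Proof.
  intros Hf Hl P HP. specialize (Hl P HP). unfold filtermap in Hl. unfold filtermapi.
  apply (filter_imp (fun ab => P (RInt f (fst ab) (snd ab)) /\ 0 < fst ab < snd ab)).
  - intros [a b] [H1 H2]; simpl in *. exists (RInt f a b). split; auto.
    apply (@RInt_correct V). apply ex_RInt_pos; auto; lra.
  - apply filter_and; [exact Hl | apply ends_ordered].
Qed.

Lemma is_RInt_gen_FTC (P p : R -> V) (la lb : V) : continuous_pos p ->
  (forall x, 0 < x -> is_derive P x (p x)) ->
  filterlim P at0 (locally la) -> filterlim P atoo (locally lb) ->
  is_RInt_gen p at0 atoo (minus lb la).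
Proof.
  intros Hc Hd Ha Hb. apply is_RInt_gen_of_limit; auto.
  apply (filterlim_ext_loc (fun ab => minus (P (snd ab)) (P (fst ab)))).
  - apply (filter_imp (fun ab => 0 < fst ab < snd ab)); [|apply ends_ordered].
    intros [a b] H; simpl in *. symmetry. apply (@is_RInt_unique V).
    assert (Hm : Rmin a b = a) by (apply Rmin_left; lra).
    apply (@is_RInt_derive V); rewrite Hm; intros x Hx; [apply Hd|apply Hc]; lra.
  - apply (filterlim_comp_2 (F := filter_prod at0 atoo)
      (fun ab => P (snd ab)) (fun ab => P (fst ab)) minus (G := locally lb) (H := locally la)).
    + apply (filterlim_comp _ _ _ snd P _ atoo); auto. apply filterlim_snd.
    + apply (filterlim_comp _ _ _ fst P _ at0); auto. apply filterlim_fst.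
    + unfold minus. apply (filterlim_comp_2 (F := filter_prod (locally lb) (locally la))
        (fun z => fst z) (fun z => opp (snd z)) plus (G := locally lb) (H := locally (opp la))).
      * apply filterlim_fst.
      * apply (filterlim_comp _ _ _ snd opp _ (locally la)); [apply filterlim_snd|].
        apply (@filterlim_opp R_AbsRing V).
      * apply (@filterlim_plus R_AbsRing V).
Qed.

End Improper.

(** A family of integrable majorants with an elementary primitive: of order [x^(q-1)]
    at zero and [x^(-q-1)] at infinity, with integral one. *)
Definition majorant (q x : R) : R := q * Rpower x (q - 1) / (1 + Rpower x q) ^ 2.
Definition majorant_primitive (q x : R) : R := - / (1 + Rpower x q).

Lemma is_derive_majorant_primitive q x : 0 < x -> is_derive (majorant_primitive q) x (majorant q x).
Proof.
  intros Hx. unfold majorant_primitive, majorant, Rpower.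
  assert (H := exp_pos (q * ln x)).
  auto_derive; [lra|].
  replace ((q - 1) * ln x) with (q * ln x + - ln x) by ring.
  rewrite exp_plus, exp_Ropp, exp_ln by lra. field. lra.
Qed.

Lemma continuous_majorant q : continuous_pos (majorant q).
Proof.
  intros x Hx. apply (ex_derive_continuous (K := R_AbsRing) (V := R_NormedModule)).
  unfold majorant, Rpower. assert (H := exp_pos (q * ln x)).
  auto_derive. split; auto. split; auto. simpl. nra.
Qed.

Lemma majorant_pos q x : 0 < q -> 0 < majorant q x.
Proof.
  intros Hq0. unfold majorant.
  assert (H1 := Rpower_pos x (q - 1)). assert (H2 := Rpower_pos x q).
  apply Rdiv_lt_0_compat; [nra|]. apply pow_lt; lra.
Qed.

Lemma Rpower_inv_exp q e : 0 < q -> 0 < e -> Rpower (Rpower e (/ q)) q = e.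
Proof.
  intros Hq0 He. rewrite Rpower_mult, Rinv_l by lra. now apply Rpower_1.
Qed.

Lemma majorant_primitive_0 q : 0 < q -> filterlim (majorant_primitive q) at0 (locally (-1)).
Proof.
  intros Hq0. apply filterlim_locally. intros [e He]. simpl.
  assert (Hp := Rpower_pos e (/ q)).
  exists (mkposreal _ Hp). intros x Hx Hx0.
  apply ball_R in Hx; simpl in Hx.
  assert (H : Rpower x q < e).
  { rewrite <- (Rpower_inv_exp q e) by auto. apply Rlt_Rpower_l; lra. }
  assert (H0 := Rpower_pos x q).
  change (Rabs (majorant_primitive q x - -1) < e).
  unfold majorant_primitive. replace (- / (1 + Rpower x q) - -1) with (Rpower x q * / (1 + Rpower x q))
    by (field; lra).
  assert (Hi : 0 < / (1 + Rpower x q) < 1).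
  { split; [apply Rinv_0_lt_compat; lra|]. rewrite <- Rinv_1. apply Rinv_lt_contravar; lra. }
  rewrite Rabs_right; nra.
Qed.

Lemma majorant_primitive_oo q : 0 < q -> filterlim (majorant_primitive q) atoo (locally 0).
Proof.
  intros Hq0. apply filterlim_locally. intros [e He]. simpl.
  assert (Hp := Rpower_pos (/ e) (/ q)).
  exists (Rpower (/ e) (/ q)). intros x Hx.
  assert (Hie := Rinv_0_lt_compat _ He).
  assert (H : / e < Rpower x q).
  { rewrite <- (Rpower_inv_exp q (/ e)) by auto. apply Rlt_Rpower_l; lra. }
  change (Rabs (majorant_primitive q x - 0) < e).
  unfold majorant_primitive. replace (- / (1 + Rpower x q) - 0) with (- / (1 + Rpower x q)) by ring.
  rewrite Rabs_Ropp, Rabs_right by (left; apply Rinv_0_lt_compat; lra).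
  rewrite <- (Rinv_inv e). apply Rinv_lt_contravar; nra.
Qed.

Lemma is_RInt_gen_majorant q : 0 < q -> is_RInt_gen (majorant q) at0 atoo 1.
Proof.
  intros Hq0. replace 1 with (minus 0 (-1)) by (unfold minus, plus, opp; simpl; ring).
  apply (@is_RInt_gen_FTC R_CompleteNormedModule (majorant_primitive q)).
  - apply continuous_majorant.
  - intros x Hx. now apply is_derive_majorant_primitive.
  - now apply majorant_primitive_0.
  - now apply majorant_primitive_oo.
Qed.

Section Dominated.

Context {V : CompleteNormedModule R_AbsRing}.
Implicit Types f : R -> V.

Lemma norm_RInt_majorant f q M a b : continuous_pos f -> 0 < q -> 0 < a -> 0 < b ->
  (forall x, 0 < x -> norm (f x) <= M * majorant q x) ->
  norm (RInt f a b) <= M * Rabs (majorant_primitive q b - majorant_primitive q a).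
Proof.
  intros Hf Hq0 Ha Hb HM.
  assert (Hle : forall a b, 0 < a -> a <= b -> norm (RInt f a b) <= M * Rabs (majorant_primitive q b - majorant_primitive q a)).
  { clear a b Ha Hb. intros a b Ha Hab.
    assert (HI : is_RInt (fun x => M * majorant q x) a b (M * (majorant_primitive q b - majorant_primitive q a))).
    { apply (is_RInt_scal (V := R_NormedModule) (majorant q) a b M).
      apply (@is_RInt_derive R_CompleteNormedModule); rewrite Rmin_left by lra; intros x Hx.
      - apply is_derive_majorant_primitive; lra.
      - apply continuous_majorant; lra. }
    assert (HR : is_RInt f a b (RInt f a b))
      by (apply (@RInt_correct V), ex_RInt_pos; auto; lra).
    assert (H := norm_RInt_le f _ a b _ _ Hab (fun x Hx => HM x ltac:(lra)) HR HI).
    assert (HM0 : 0 <= M).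
    { assert (H1 := HM a Ha). assert (H2 := norm_ge_0 (f a)). assert (H3 := majorant_pos q a Hq0). nra. }
    eapply Rle_trans; [exact H|]. apply Rmult_le_compat_l; auto. apply Rle_abs. }
  destruct (Rle_lt_dec a b) as [H|H]; [now apply Hle|].
  assert (E : RInt f a b = opp (RInt f b a))
    by (symmetry; apply (@opp_RInt_swap V), ex_RInt_pos; auto).
  rewrite E, (@norm_opp R_AbsRing V), Rabs_minus_sym. apply Hle; lra.
Qed.

(** Cauchy's criterion: moving an end point changes the integral by at most [M] times
    the variation of the primitive of the majorant, which converges at both ends. *)
Lemma ex_RInt_gen_dominated f q M : continuous_pos f -> 0 < q ->
  (forall x, 0 < x -> norm (f x) <= M * majorant q x) -> ex_RInt_gen f at0 atoo.
Proof.
  intros Hf Hq0 HM.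
  assert (HM0 : 0 <= M).
  { assert (H1 := HM 1 Rlt_0_1). assert (H2 := norm_ge_0 (f 1)).
    assert (H3 := majorant_pos q 1 Hq0). nra. }
  destruct (proj1 (filterlim_locally_cauchy (U := V) (F := filter_prod at0 atoo)
    (fun ab => RInt f (fst ab) (snd ab)))) as [l Hl].
  2:{ exists l. now apply is_RInt_gen_of_limit. }
  intros [e He]. simpl.
  set (d := e / (4 * (M + 1))).
  assert (Hd : 0 < d) by (apply Rdiv_lt_0_compat; lra).
  assert (Ea := proj1 (filterlim_locally _ _) (majorant_primitive_0 q Hq0) (mkposreal d Hd)).
  assert (Eb := proj1 (filterlim_locally _ _) (majorant_primitive_oo q Hq0) (mkposreal d Hd)).
  exists (fun ab => (0 < fst ab < snd ab) /\
    (Rabs (majorant_primitive q (fst ab) - -1) < d /\ Rabs (majorant_primitive q (snd ab) - 0) < d)).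
  split.
  { apply filter_and; [apply ends_ordered|].
    apply (Filter_prod _ _ _ _ _ Ea Eb). intros a b H1 H2. now split. }
  intros [a b] [a' b'] [H1 [H2 H3]] [H1' [H2' H3']]; simpl in *.
  apply (@norm_compat1 R_AbsRing V).
  assert (E : minus (RInt f a' b') (RInt f a b) = plus (RInt f a' a) (RInt f b b')).
  { assert (Ex : forall u v, 0 < u -> 0 < v -> ex_RInt f u v)
      by (intros; now apply ex_RInt_pos).
    assert (E' : RInt f a' b' = plus (plus (RInt f a' a) (RInt f a b)) (RInt f b b'))
      by (rewrite !(@RInt_Chasles V) by (apply Ex; lra); reflexivity).
    rewrite E'. exact (@minus_plus_middle (CompleteNormedModule.AbelianGroup R_AbsRing V) _ _ _). }
  apply Rle_lt_trans with (norm (plus (RInt f a' a) (RInt f b b')));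
    [right; exact (f_equal norm E)|].
  eapply Rle_lt_trans; [apply (@norm_triangle R_AbsRing V)|].
  assert (N1 := norm_RInt_majorant f q M a' a Hf Hq0 ltac:(lra) ltac:(lra) HM).
  assert (N2 := norm_RInt_majorant f q M b b' Hf Hq0 ltac:(lra) ltac:(lra) HM).
  assert (D1 : Rabs (majorant_primitive q a - majorant_primitive q a') <= 2 * d).
  { apply Rabs_def2 in H2. apply Rabs_def2 in H2'. apply Rabs_le_between. lra. }
  assert (D2 : Rabs (majorant_primitive q b' - majorant_primitive q b) <= 2 * d).
  { apply Rabs_def2 in H3. apply Rabs_def2 in H3'. apply Rabs_le_between. lra. }
  assert (Ed : (M + 1) * d * 4 = e) by (unfold d; field; lra).
  nra.
Qed.

Lemma norm_RInt_gen_dominated f q M : continuous_pos f -> 0 < q ->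
  (forall x, 0 < x -> norm (f x) <= M * majorant q x) ->
  norm (RInt_gen f at0 atoo) <= M.
Proof.
  intros Hf Hq0 HM.
  assert (Hex := ex_RInt_gen_dominated f q M Hf Hq0 HM).
  apply (@RInt_gen_norm V at0 atoo _ _ f (fun x => M * majorant q x)).
  - apply (filter_imp (fun ab => 0 < fst ab < snd ab)); [intros ab H; lra | apply ends_ordered].
  - apply (filter_imp (fun ab => 0 < fst ab < snd ab)); [intros ab H x Hx | apply ends_ordered].
    apply HM; lra.
  - apply (@RInt_gen_correct V); auto; apply Proper_StrongProper; auto with typeclass_instances.
  - assert (H := is_RInt_gen_scal (V := R_NormedModule) (majorant q) M 1 (is_RInt_gen_majorant q Hq0)).
    exact (eq_ind (M * 1) (fun l => is_RInt_gen (fun x => M * majorant q x) at0 atoo l)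
      H M (Rmult_1_r M)).
Qed.

Lemma is_RInt_gen_dominated f q M : continuous_pos f -> 0 < q ->
  (forall x, 0 < x -> norm (f x) <= M * majorant q x) ->
  is_RInt_gen f at0 atoo (RInt_gen f at0 atoo).
Proof.
  intros Hf Hq0 HM. apply (@RInt_gen_correct V).
  3: now apply (ex_RInt_gen_dominated f q M).
  all: apply Proper_StrongProper; auto with typeclass_instances.
Qed.

Lemma RInt_gen_pos_unique f (l : V) :
  is_RInt_gen f at0 atoo l -> RInt_gen f at0 atoo = l.
Proof.
  intros H. apply (@is_RInt_gen_unique V); auto;
    apply Proper_StrongProper; auto with typeclass_instances.
Qed.

Lemma is_RInt_gen_ext_pos f g (l : V) : (forall x, 0 < x -> f x = g x) ->
  is_RInt_gen f at0 atoo l -> is_RInt_gen g at0 atoo l.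
Proof.
  intros H. apply is_RInt_gen_ext.
  apply (filter_imp (fun ab => 0 < fst ab < snd ab)); [|apply ends_ordered].
  intros [a b] Hab x Hx; simpl in *. apply H. rewrite Rmin_left in Hx; lra.
Qed.

(** The bound makes the convergence uniform relative to the fixed majorant, so that the
    remainders integrate to something small. *)
Lemma series_RInt_gen (f : nat -> R -> V) (F : R -> V) (m : nat -> R) (q : R) :
  0 < q -> ex_series m -> continuous_pos F -> (forall k, continuous_pos (f k)) ->
  (forall k x, 0 < x -> norm (f k x) <= m k * majorant q x) ->
  (forall x, 0 < x -> is_series (fun k => f k x) (F x)) ->
  is_RInt_gen F at0 atoo (RInt_gen F at0 atoo) /\
  is_series (fun k => RInt_gen (f k) at0 atoo) (RInt_gen F at0 atoo).
Proof.
  intros Hq0 Hm HF Hf Hb Hs.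
  assert (Hm0 : forall k, 0 <= m k).
  { intros k. assert (H1 := Hb k 1 Rlt_0_1). assert (H2 := norm_ge_0 (f k 1)).
    assert (H3 := majorant_pos q 1 Hq0). nra. }
  set (T N := Series (fun k => m (S N + k)%nat)).
  (* Tails of the integrand, by letting the upper end of a finite block go to infinity. *)
  assert (Htail : forall N x, 0 < x ->
    norm (minus (F x) (sum_n (fun k => f k x) N)) <= T N * majorant q x).
  { intros N x Hx. assert (Hh := majorant_pos q x Hq0).
    assert (Hl : is_lim_seq (fun K => norm (minus (sum_n (fun k => f k x) (S N + K))
                               (sum_n (fun k => f k x) N)))
      (norm (minus (F x) (sum_n (fun k => f k x) N)))).
    { apply (filterlim_comp _ _ _ (fun K => minus (sum_n (fun k => f k x) (S N + K))
         (sum_n (fun k => f k x) N)) norm eventually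
         (locally (minus (F x) (sum_n (fun k => f k x) N)))); [|apply (@filterlim_norm R_AbsRing V)].
      unfold minus. apply (filterlim_comp_2 (F := eventually)
        (fun K => sum_n (fun k => f k x) (S N + K)) (fun _ => opp (sum_n (fun k => f k x) N))
        plus (G := locally (F x)) (H := locally (opp (sum_n (fun k => f k x) N)))).
      - apply (filterlim_comp _ _ _ (fun K => (S N + K)%nat) (sum_n (fun k => f k x))
          eventually eventually); [|apply Hs; auto].
        intros P [n0 HP]. exists n0. intros K HK. apply HP. lia.
      - apply filterlim_const.
      - apply (@filterlim_plus R_AbsRing V). }
    refine (is_lim_seq_le _ (fun _ => T N * majorant q x) _ (Finite (T N * majorant q x)) _ Hl
      (is_lim_seq_const _)).
    intros K.
    assert (E : minus (sum_n (fun k => f k x) (S N + K)) (sum_n (fun k => f k x) N)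
      = sum_n_m (fun k => f k x) (S N) (S N + K)).
    { unfold sum_n. rewrite (sum_n_m_Chasles _ 0 N (S N + K)) by lia.
      exact (@plus_minus_cancel (CompleteNormedModule.AbelianGroup R_AbsRing V) _ _). }
    eapply Rle_trans; [right; exact (f_equal norm E)|].
    eapply Rle_trans; [apply (@norm_sum_n_m R_AbsRing V)|].
    eapply Rle_trans; [apply sum_n_m_le; intros k; apply Hb; auto|].
    rewrite (sum_n_m_ext _ (fun k => mult (m k) (majorant q x))) by reflexivity.
    rewrite (sum_n_m_mult_r (K := R_Ring)).
    apply Rmult_le_compat_r; [lra|].
    apply Rle_trans with (sum_n (fun k => m (S N + k)%nat) K).
    - right. unfold sum_n. clear. induction K as [|K IH].
      + rewrite Nat.add_0_r, !sum_n_n, Nat.add_0_r. reflexivity.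
      + rewrite Nat.add_succ_r, !sum_n_Sm by lia.
        rewrite Nat.add_succ_r. exact (f_equal (fun z => plus z _) IH).
    - apply sum_n_le_Series; auto. now apply (ex_series_incr_n m). }
  assert (Hcs : forall N, continuous_pos (fun x => sum_n (fun k => f k x) N)).
  { intros N x Hx. induction N as [|N IH].
    - apply (continuous_ext (f 0%nat)); [intros y; now rewrite sum_O | now apply Hf].
    - apply (continuous_ext (fun y => plus (sum_n (fun k => f k y) N) (f (S N) y)));
        [intros y; now rewrite sum_Sn|].
      apply (@continuous_plus R_UniformSpace R_AbsRing V); auto. now apply Hf. }
  assert (Hct : forall N, continuous_pos (fun x => minus (F x) (sum_n (fun k => f k x) N))).
  { intros N x Hx. apply (@continuous_minus R_UniformSpace R_AbsRing V);
      [now apply HF | now apply Hcs]. }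
  assert (HFn : forall x, 0 < x -> norm (F x) <= (T 0%nat + m 0%nat) * majorant q x).
  { intros x Hx. specialize (Htail 0%nat x Hx). specialize (Hb 0%nat x Hx).
    rewrite sum_O in Htail.
    eapply Rle_trans; [right; exact (f_equal norm (eq_sym
      (@minus_plus_cancel (CompleteNormedModule.AbelianGroup R_AbsRing V) (F x) (f 0%nat x))))|].
    eapply Rle_trans; [apply (@norm_triangle R_AbsRing V)|].
    eapply Rle_trans; [exact (Rplus_le_compat _ _ _ _ Htail Hb)|]. right; ring. }
  assert (HIF := is_RInt_gen_dominated F q _ HF Hq0 HFn).
  split; auto.
  assert (HIf : forall k, is_RInt_gen (f k) at0 atoo (RInt_gen (f k) at0 atoo))
    by (intros k; apply (is_RInt_gen_dominated (f k) q (m k)); auto).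
  assert (HIS : forall N, is_RInt_gen (fun x => sum_n (fun k => f k x) N) at0 atoo
    (sum_n (fun k => RInt_gen (f k) at0 atoo) N)).
  { induction N as [|N IH].
    - rewrite sum_O. apply (is_RInt_gen_ext_pos (f 0%nat)); auto.
      intros x _. now rewrite sum_O.
    - rewrite sum_Sn.
      apply (is_RInt_gen_ext_pos (fun x => plus (sum_n (fun k => f k x) N) (f (S N) x))).
      + intros x _. now rewrite sum_Sn.
      + apply (@is_RInt_gen_plus V); auto with typeclass_instances. }
  apply filterlim_locally. intros [e He].
  assert (HT : is_lim_seq T 0) by (now apply series_tail_lim).
  apply is_lim_seq_spec in HT. destruct (HT (mkposreal e He)) as [N0 HN]; simpl in HN.
  exists N0. intros N HN0. specialize (HN N HN0). rewrite Rminus_0_r in HN.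
  apply Rabs_def2 in HN. simpl. apply ball_sym, (@norm_compat1 R_AbsRing V).
  assert (HD := is_RInt_gen_minus _ _ _ _ HIF (HIS N)).
  eapply Rle_lt_trans; [right; exact (f_equal norm (eq_sym (RInt_gen_pos_unique _ _ HD)))|].
  eapply Rle_lt_trans; [apply (norm_RInt_gen_dominated _ q (T N)); auto|]. lra.
Qed.

Lemma is_RInt_gen_subst f (phi dphi : R -> R) (Fa Fb : (R -> Prop) -> Prop) (l : V) :
  Filter Fa -> Filter Fb ->
  continuous_pos f ->
  (forall x, 0 < x -> 0 < phi x /\ is_derive phi x (dphi x) /\ continuous dphi x) ->
  filterlim phi at0 Fa -> filterlim phi atoo Fb ->
  is_RInt_gen f Fa Fb l ->
  is_RInt_gen (fun x => scal (dphi x) (f (phi x))) at0 atoo l.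
Proof.
  intros FFa FFb Hf Hphi Ha Hb Hl P HP. specialize (Hl P HP). unfold filtermapi in *.
  assert (Hab : filterlim (fun ab => (phi (fst ab), phi (snd ab)))
    (filter_prod at0 atoo) (filter_prod Fa Fb)).
  { apply filterlim_pair.
    - apply (filterlim_comp _ _ _ fst phi _ at0); auto. apply filterlim_fst.
    - apply (filterlim_comp _ _ _ snd phi _ atoo); auto. apply filterlim_snd. }
  specialize (Hab _ Hl). unfold filtermap in Hab.
  refine (filter_imp _ _ _ (filter_and _ _ Hab ends_ordered)).
  intros [a b] [[y [Hy HPy]] H]; simpl in *.
  exists y; split; auto.
  rewrite <- (@is_RInt_unique V _ _ _ _ Hy).
  assert (Hm : Rmin a b = a) by (apply Rmin_left; lra).
  apply (@is_RInt_comp V f phi dphi a b); rewrite Hm; intros x Hx.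
  - apply Hf, Hphi; lra.
  - apply Hphi; lra.
Qed.

Lemma is_RInt_gen_scale f (c : R) (l : V) : 0 < c -> continuous_pos f ->
  is_RInt_gen f at0 atoo l ->
  is_RInt_gen (fun x => scal c (f (c * x))) at0 atoo l.
Proof.
  intros Hc Hf Hl.
  apply (is_RInt_gen_subst f (fun x => c * x) (fun _ => c) at0 atoo); auto with typeclass_instances.
  - intros x Hx. split; [nra|]. split; [auto_derive; auto; ring | apply continuous_const].
  - intros P [[d Hd] H]. simpl in H.
    assert (Hdc : 0 < d / c) by (apply Rdiv_lt_0_compat; lra).
    exists (mkposreal _ Hdc). intros x Hx Hx0.
    apply ball_R in Hx; simpl in Hx.
    assert (Hcx : c * x < c * (d / c)) by (apply Rmult_lt_compat_l; lra).
    replace (c * (d / c)) with d in Hcx by (field; lra).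
    assert (Hcx0 : 0 < c * x) by nra.
    apply H; [|exact Hcx0].
    change (Rabs (c * x - 0) < d). apply Rabs_def1; lra.
  - intros P [M HM]. exists (M / c). intros x Hx. apply HM.
    apply (Rmult_lt_compat_l c) in Hx; auto.
    replace (c * (M / c)) with M in Hx by (field; lra). lra.
Qed.

Lemma is_RInt_gen_inversion f (l : V) : continuous_pos f ->
  is_RInt_gen f at0 atoo l ->
  is_RInt_gen (fun x => scal (/ x ^ 2) (f (/ x))) at0 atoo l.
Proof.
  intros Hf Hl.
  assert (H : is_RInt_gen (fun x => scal (- / x ^ 2) (f (/ x))) at0 atoo (opp l)).
  { apply (is_RInt_gen_subst f Rinv (fun x => - / x ^ 2) atoo at0); auto with typeclass_instances.
    - intros x Hx. split; [now apply Rinv_0_lt_compat|].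
      split; [auto_derive; [lra|field; lra]|].
      apply (ex_derive_continuous (K := R_AbsRing) (V := R_NormedModule)).
      auto_derive. nra.
    - intros P [M HM].
      assert (HM1 : 0 < / (Rabs M + 1)) by (apply Rinv_0_lt_compat; assert (H := Rabs_pos M); lra).
      exists (mkposreal _ HM1). intros x Hx Hx0.
      apply ball_R in Hx; simpl in Hx.
      apply HM. assert (H1 := Rle_abs M).
      apply Rlt_trans with (Rabs M + 1); [lra|].
      rewrite <- (Rinv_inv (Rabs M + 1)). apply Rinv_lt_contravar; [|lra].
      apply Rmult_lt_0_compat; lra.
    - intros P [[d Hd] H]. simpl in H. exists (/ d). intros x Hx.
      assert (Hid := Rinv_0_lt_compat _ Hd).
      assert (Hix : 0 < / x) by (apply Rinv_0_lt_compat; lra).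
      apply H; [|lra].
      change (Rabs (/ x - 0) < d). apply Rabs_def1; [|lra]. rewrite Rminus_0_r.
      rewrite <- (Rinv_inv d). apply Rinv_lt_contravar; nra.
    - apply (@is_RInt_gen_swap V); auto with typeclass_instances. }
  apply (@is_RInt_gen_opp V) in H; auto with typeclass_instances.
  rewrite (@opp_opp (CompleteNormedModule.AbelianGroup R_AbsRing V)) in H.
  revert H. apply is_RInt_gen_ext_pos. intros x Hx.
  etransitivity; [symmetry; apply (@scal_opp_l R_Ring V)|].
  apply (f_equal (fun c => scal c (f (/ x)))). unfold opp; simpl. ring.
Qed.

End Dominated.

(** * Complex exponentials and complex-valued integrals *)

Lemma C_ext (z w : C) : Re z = Re w -> Im z = Im w -> z = w.
Proof. destruct z, w; simpl; intros -> ->; reflexivity. Qed.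

(** Over the reals the complex numbers are normed as a product, with the same value. *)
Lemma norm_C_R (z : C) : @norm R_AbsRing C_R_NormedModule z = Cmod z.
Proof.
  destruct z as [a b]. unfold Cmod, norm; simpl. unfold prod_norm; simpl.
  f_equal. unfold norm; simpl. unfold abs; simpl.
  rewrite !Rmult_1_r. f_equal; symmetry; apply Rsqr_abs.
Qed.

Lemma Im_le_Cmod (z : C) : Rabs (Im z) <= Cmod z.
Proof. eapply Rle_trans; [apply Rmax_r | apply Rmax_Cmod]. Qed.

Lemma Cmod_le_parts (z : C) : Cmod z <= Rabs (Re z) + Rabs (Im z).
Proof.
  destruct z as [a b]. simpl.
  replace (a, b) with (RtoC a + Ci * RtoC b)%C by (apply C_ext; simpl; ring).
  eapply Rle_trans; [apply Cmod_triangle|].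
  rewrite Cmod_mult, Cmod_Ci, !Cmod_R. lra.
Qed.

Lemma Cexp_plus (z w : C) : Cexp (z + w)%C = (Cexp z * Cexp w)%C.
Proof.
  unfold Cexp. destruct z as [a b], w as [c d]. apply C_ext; simpl;
  rewrite exp_plus, ?cos_plus, ?sin_plus; ring.
Qed.

Lemma Cmod_Cexp (z : C) : Cmod (Cexp z) = exp (Re z).
Proof.
  unfold Cexp, Cmod; simpl.
  replace (exp (Re z) * cos (Im z) * (exp (Re z) * cos (Im z) * 1) +
    exp (Re z) * sin (Im z) * (exp (Re z) * sin (Im z) * 1))
    with (exp (Re z) * exp (Re z) * (Rsqr (sin (Im z)) + Rsqr (cos (Im z))))
    by (unfold Rsqr; ring).
  rewrite sin2_cos2, Rmult_1_r. apply sqrt_square. left; apply exp_pos.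
Qed.

Lemma Rabs_sin_le (x : R) : Rabs (sin x) <= Rabs x.
Proof.
  assert (H : forall y, 0 <= y -> Rabs (sin y) <= y).
  { intros y [Hy|<-]; [|rewrite sin_0, Rabs_R0; lra].
    assert (Hlt := sin_lt_x y Hy).
    destruct (Rle_lt_dec y 1) as [Hy1|Hy1].
    - assert (HP := PI2_1). assert (0 <= sin y) by (apply sin_ge_0; lra).
      rewrite Rabs_right; lra.
    - assert (Hb := SIN_bound y). apply Rabs_le_between. lra. }
  destruct (Rle_lt_dec 0 x) as [Hx|Hx].
  - rewrite (Rabs_right x) by lra. now apply H.
  - rewrite (Rabs_left x) by lra. rewrite <- (Rabs_Ropp (sin x)), <- sin_neg. apply H; lra.
Qed.

Lemma cos_quadratic (x : R) : Rabs (cos x - 1) <= x ^ 2.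
Proof.
  assert (E : cos x - 1 = - 2 * (sin (x / 2) * sin (x / 2))).
  { replace x with (2 * (x / 2)) at 1 by field. rewrite cos_2a_sin. ring. }
  rewrite E, !Rabs_mult, Rabs_left by lra.
  assert (H := Rabs_sin_le (x / 2)). assert (H0 := Rabs_pos (sin (x / 2))).
  assert (Hx : Rabs (x / 2) * Rabs (x / 2) = x ^ 2 / 4).
  { rewrite <- Rabs_mult, Rabs_right; [field|]. nra. }
  nra.
Qed.

Lemma sin_quadratic (x : R) : Rabs (sin x - x) <= x ^ 2.
Proof.
  destruct (Rle_lt_dec (Rabs x) 1) as [Hx|Hx].
  - assert (H : forall y, 0 <= y <= 1 -> Rabs (sin y - y) <= y ^ 2).
    { intros y Hy. assert (HP := PI_4). assert (HP1 := PI2_1).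
      destruct (sin_bound y 0 ltac:(lra) ltac:(lra)) as [H1 _].
      unfold sin_approx, sin_term in H1. simpl in H1.
      assert (H2 : y - y ^ 3 / 6 <= sin y)
        by (eapply Rle_trans; [right|exact H1]; field).
      assert (H3 : sin y <= y).
      { destruct (Req_dec y 0) as [->|]; [rewrite sin_0; lra|].
        left; apply sin_lt_x; lra. }
      assert (0 <= y ^ 2) by nra. assert (y ^ 3 <= y ^ 2) by nra.
      apply Rabs_le_between. lra. }
    apply Rabs_le_between in Hx.
    destruct (Rle_lt_dec 0 x) as [H0|H0]; [apply H; lra|].
    specialize (H (- x) ltac:(lra)). rewrite sin_neg in H.
    replace (- sin x - - x) with (- (sin x - x)) in H by ring.
    rewrite Rabs_Ropp in H. replace ((- x) ^ 2) with (x ^ 2) in H by ring. exact H.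
  - assert (Hb := SIN_bound x). rewrite <- (pow2_abs x).
    assert (H1 : 1 <= Rabs x) by lra.
    destruct (Rle_lt_dec 0 x) as [H0|H0].
    + rewrite (Rabs_right x) in * by lra.
      destruct (Rle_lt_dec x 2).
      * assert (Hlt := sin_lt_x x ltac:(lra)).
        assert (0 <= sin x) by (apply sin_ge_0; assert (HP := PI2_1); lra).
        apply Rabs_le_between. nra.
      * apply Rabs_le_between. nra.
    + rewrite (Rabs_left x) in * by lra.
      destruct (Rle_lt_dec (- x) 2).
      * assert (Hlt := sin_lt_x (- x) ltac:(lra)).
        assert (0 <= sin (- x)) by (apply sin_ge_0; assert (HP := PI2_1); lra).
        rewrite sin_neg in *. apply Rabs_le_between. nra.
      * apply Rabs_le_between. nra.
Qed.

(** The real part of the remainder is [(e^a - 1 - a) + e^a (cos b - 1)] and the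
    imaginary part [(e^a - 1 - a) sin b + a sin b + (sin b - b)]; every product is
    quadratic. *)
Lemma Cexp_taylor1 (w : C) :
  Cmod (Cexp w - 1 - w)%C <= 4 * Cmod w ^ 2 * exp (Cmod w).
Proof.
  set (a := Re w). set (b := Im w). set (r := Cmod w).
  assert (Ha : Rabs a <= r) by apply re_le_Cmod.
  assert (Hb : Rabs b <= r) by apply Im_le_Cmod.
  assert (Hr : 0 <= r) by apply Cmod_ge_0.
  assert (Hr2 : r ^ 2 = a ^ 2 + b ^ 2) by apply Cmod2_alt.
  assert (Her : exp (Rabs a) <= exp r) by now apply exp_monotone.
  assert (Hea : exp a <= exp r)
    by (apply exp_monotone; eapply Rle_trans; [apply Rle_abs | exact Ha]).
  assert (Hep := exp_pos a).
  assert (He1 : 1 <= exp r) by (assert (H := exp_ineq1_le r); lra).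
  eapply Rle_trans; [apply Cmod_le_parts|].
  assert (ER : Re (Cexp w - 1 - w)%C = (exp a - 1 - a) + exp a * (cos b - 1))
    by (unfold a, b; destruct w; simpl; ring).
  assert (EI : Im (Cexp w - 1 - w)%C = (exp a - 1 - a) * sin b + a * sin b + (sin b - b))
    by (unfold a, b; destruct w; simpl; ring).
  rewrite ER, EI.
  assert (T := exp_taylor1 a). assert (Tc := cos_quadratic b). assert (Ts := sin_quadratic b).
  assert (Tb := Rabs_sin_le b).
  assert (Tb1 : Rabs (sin b) <= 1) by (apply Rabs_le_between; assert (H := SIN_bound b); lra).
  assert (H1 : Rabs ((exp a - 1 - a) + exp a * (cos b - 1)) <= r ^ 2 * exp r).
  { eapply Rle_trans; [apply Rabs_triang|]. rewrite Rabs_mult, (Rabs_right (exp a)) by lra.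
    assert (a ^ 2 * exp (Rabs a) <= a ^ 2 * exp r) by (apply Rmult_le_compat_l; nra).
    assert (exp a * Rabs (cos b - 1) <= exp r * b ^ 2)
      by (apply Rmult_le_compat; auto; [lra | apply Rabs_pos]).
    rewrite Hr2. nra. }
  assert (H2 : Rabs ((exp a - 1 - a) * sin b + a * sin b + (sin b - b)) <= 3 * (r ^ 2 * exp r)).
  { eapply Rle_trans; [apply Rabs_triang|].
    eapply Rle_trans; [apply Rplus_le_compat_r, Rabs_triang|].
    rewrite !Rabs_mult.
    assert (Q1 : Rabs (exp a - 1 - a) * Rabs (sin b) <= r ^ 2 * exp r).
    { apply Rle_trans with (a ^ 2 * exp (Rabs a) * 1).
      - apply Rmult_le_compat; auto using Rabs_pos.
      - rewrite Rmult_1_r. apply Rmult_le_compat; auto; [nra | left; apply exp_pos | nra]. }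
    assert (Q2 : Rabs a * Rabs (sin b) <= r ^ 2).
    { replace (r ^ 2) with (r * r) by ring. apply Rmult_le_compat; auto using Rabs_pos; lra. }
    assert (Q3 : r ^ 2 <= r ^ 2 * exp r) by nra.
    nra. }
  lra.
Qed.

Lemma Cmod_Rcpow (x : R) (s : C) : Cmod (Rcpow x s) = Rpower x (Re s).
Proof.
  unfold Rcpow, Rpower. rewrite Cmod_Cexp. f_equal. destruct s; simpl; ring.
Qed.

Lemma Rcpow_plus (x : R) (s t : C) : Rcpow x (s + t)%C = (Rcpow x s * Rcpow x t)%C.
Proof.
  unfold Rcpow. rewrite <- Cexp_plus. f_equal. ring.
Qed.

Lemma Rcpow_mult_base (x y : R) (s : C) : 0 < x -> 0 < y ->
  Rcpow (x * y) s = (Rcpow x s * Rcpow y s)%C.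
Proof.
  intros Hx Hy. unfold Rcpow. rewrite ln_mult by auto. rewrite <- Cexp_plus. f_equal.
  rewrite RtoC_plus. ring.
Qed.

Lemma Rcpow_R (x y : R) : Rcpow x (RtoC y) = RtoC (Rpower x y).
Proof.
  unfold Rcpow, Cexp, Rpower. simpl.
  replace (y * 0 + 0 * ln x) with 0 by ring. rewrite cos_0, sin_0.
  replace (y * ln x - 0 * 0) with (y * ln x) by ring. apply C_ext; simpl; ring.
Qed.

Lemma Rcpow_exponent_1 (x : R) : 0 < x -> Rcpow x 1 = RtoC x.
Proof. intros Hx. rewrite Rcpow_R. now rewrite Rpower_1. Qed.

Lemma continuous_C (f : R -> C) (x : R) :
  continuous (fun y => Re (f y)) x -> continuous (fun y => Im (f y)) x ->
  continuous (U := C_R_NormedModule) f x.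
Proof.
  intros H1 H2.
  apply (continuous_ext (U := C_UniformSpace) (fun y => (Re (f y), Im (f y)))).
  { intros y; destruct (f y); reflexivity. }
  intros P [e He].
  destruct (proj1 (filterlim_locally _ _) H1 e) as [d1 Hd1].
  destruct (proj1 (filterlim_locally _ _) H2 e) as [d2 Hd2].
  assert (Hd : 0 < Rmin d1 d2) by (apply Rmin_glb_lt; [apply d1 | apply d2]).
  exists (mkposreal _ Hd). intros y Hy. apply He. split; simpl.
  - apply Hd1. apply ball_le with (2 := Hy). apply Rmin_l.
  - apply Hd2. apply ball_le with (2 := Hy). apply Rmin_r.
Qed.

Lemma continuous_Re (f : R -> C) (x : R) :
  continuous (U := C_R_NormedModule) f x -> continuous (fun y => Re (f y)) x.
Proof.
  intros H. apply (continuous_comp (U := R_UniformSpace) (V := C_UniformSpace) f fst).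
  - exact H.
  - apply continuous_fst.
Qed.

Lemma continuous_Im (f : R -> C) (x : R) :
  continuous (U := C_R_NormedModule) f x -> continuous (fun y => Im (f y)) x.
Proof.
  intros H. apply (continuous_comp (U := R_UniformSpace) (V := C_UniformSpace) f snd).
  - exact H.
  - apply continuous_snd.
Qed.

Lemma continuous_Rscal (f g : R -> R) (x : R) :
  continuous f x -> continuous g x -> continuous (fun y => f y * g y) x.
Proof. exact (continuous_mult (K := R_AbsRing) f g x). Qed.

Lemma continuous_Rplus (f g : R -> R) (x : R) :
  continuous f x -> continuous g x -> continuous (fun y => f y + g y) x.
Proof. exact (continuous_plus (V := R_NormedModule) f g x). Qed.

Lemma continuous_Rminus (f g : R -> R) (x : R) :
  continuous f x -> continuous g x -> continuous (fun y => f y - g y) x.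
Proof. exact (continuous_minus (V := R_NormedModule) f g x). Qed.

Lemma continuous_Cmult (f g : R -> C) (x : R) :
  continuous (U := C_R_NormedModule) f x -> continuous (U := C_R_NormedModule) g x ->
  continuous (U := C_R_NormedModule) (fun y => f y * g y)%C x.
Proof.
  intros Hf Hg.
  assert (F1 := continuous_Re _ _ Hf). assert (F2 := continuous_Im _ _ Hf).
  assert (G1 := continuous_Re _ _ Hg). assert (G2 := continuous_Im _ _ Hg).
  apply continuous_C; simpl.
  - apply continuous_Rminus; now apply continuous_Rscal.
  - apply continuous_Rplus; now apply continuous_Rscal.
Qed.

Lemma continuous_Cplus (f g : R -> C) (x : R) :
  continuous (U := C_R_NormedModule) f x -> continuous (U := C_R_NormedModule) g x ->
  continuous (U := C_R_NormedModule) (fun y => f y + g y)%C x.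
Proof. exact (continuous_plus (V := C_R_NormedModule) f g x). Qed.

Lemma continuous_Cconst (c : C) (x : R) :
  continuous (U := C_R_NormedModule) (fun _ => c) x.
Proof. exact (continuous_const (c : C_R_NormedModule) x). Qed.

Lemma continuous_RtoC (f : R -> R) (x : R) :
  continuous f x -> continuous (U := C_R_NormedModule) (fun y => RtoC (f y)) x.
Proof.
  intros H. apply continuous_C; simpl; auto. apply continuous_const.
Qed.

Lemma continuous_of_derivable (f : R -> R) (x : R) : ex_derive f x -> continuous f x.
Proof. apply (ex_derive_continuous (K := R_AbsRing) (V := R_NormedModule)). Qed.

Lemma continuous_Rcpow (s : C) (x : R) : 0 < x ->
  continuous (U := C_R_NormedModule) (fun y => Rcpow y s) x.
Proof.
  intros Hx. apply continuous_C; unfold Rcpow, Cexp; simpl;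
    apply continuous_of_derivable; auto_derive; auto.
Qed.

Notation C_RInt f := (RInt_gen (V := C_R_CompleteNormedModule) f at0 atoo).
Notation is_C_RInt f := (is_RInt_gen (V := C_R_NormedModule) f at0 atoo).

(** Integrals in a product are componentwise on compact intervals; the filter
    of the end points carries this over to improper integrals. *)
Lemma is_C_RInt_parts (f : R -> C) (l : C) :
  is_RInt_gen (fun x => Re (f x)) at0 atoo (Re l) ->
  is_RInt_gen (fun x => Im (f x)) at0 atoo (Im l) -> is_C_RInt f l.
Proof.
  intros H1 H2 P HP. unfold filtermapi.
  destruct l as [l1 l2]; simpl in H1, H2. destruct HP as [e He].
  assert (B1 : locally l1 (fun y => ball l1 e y)) by (exists e; auto).
  assert (B2 : locally l2 (fun y => ball l2 e y)) by (exists e; auto).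
  specialize (H1 _ B1). specialize (H2 _ B2). unfold filtermapi in *.
  refine (filter_imp _ _ _ (filter_and _ _ H1 H2)).
  intros [a b] [[y1 [I1 J1]] [y2 [I2 J2]]]. simpl in *.
  exists (y1, y2). split; [|apply He; split; auto].
  now apply (is_RInt_fct_extend_pair (U := R_NormedModule) (V := R_NormedModule) f).
Qed.

Lemma is_C_RInt_Re (f : R -> C) (l : C) :
  is_C_RInt f l -> is_RInt_gen (fun x => Re (f x)) at0 atoo (Re l).
Proof.
  intros H P [e He].
  assert (B : locally (T := C_UniformSpace) l (fun z => P (Re z))).
  { exists e. intros z [Hz _]. apply He, Hz. }
  specialize (H _ B). unfold filtermapi in *.
  refine (filter_imp _ _ _ H). intros [a b] [y [I J]]. exists (Re y); split; auto.
  apply (is_RInt_fct_extend_fst (U := R_NormedModule) (V := R_NormedModule) f); auto.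
Qed.

Lemma is_C_RInt_Im (f : R -> C) (l : C) :
  is_C_RInt f l -> is_RInt_gen (fun x => Im (f x)) at0 atoo (Im l).
Proof.
  intros H P [e He].
  assert (B : locally (T := C_UniformSpace) l (fun z => P (Im z))).
  { exists e. intros z [_ Hz]. apply He, Hz. }
  specialize (H _ B). unfold filtermapi in *.
  refine (filter_imp _ _ _ H). intros [a b] [y [I J]]. exists (Im y); split; auto.
  apply (is_RInt_fct_extend_snd (U := R_NormedModule) (V := R_NormedModule) f); auto.
Qed.

Lemma is_C_RInt_plus (f g : R -> C) (l m : C) :
  is_C_RInt f l -> is_C_RInt g m -> is_C_RInt (fun x => f x + g x)%C (l + m)%C.
Proof.
  exact (is_RInt_gen_plus (V := C_R_NormedModule) f g l m).
Qed.

Lemma is_C_RInt_mult (c : C) (f : R -> C) (l : C) :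
  is_C_RInt f l -> is_C_RInt (fun x => c * f x)%C (c * l)%C.
Proof.
  intros H. assert (H1 := is_C_RInt_Re _ _ H). assert (H2 := is_C_RInt_Im _ _ H).
  assert (S : forall (k : R) (h : R -> R) (v : R), is_RInt_gen h at0 atoo v ->
    is_RInt_gen (fun x => k * h x) at0 atoo (k * v))
    by (intros k h v; exact (is_RInt_gen_scal (V := R_NormedModule) h k v)).
  apply is_C_RInt_parts; simpl.
  - exact (is_RInt_gen_minus (V := R_NormedModule) _ _ _ _ (S (fst c) _ _ H1) (S (snd c) _ _ H2)).
  - exact (is_RInt_gen_plus (V := R_NormedModule) _ _ _ _ (S (fst c) _ _ H2) (S (snd c) _ _ H1)).
Qed.

Lemma is_C_RInt_RtoC (f : R -> R) (l : R) :
  is_RInt_gen f at0 atoo l -> is_C_RInt (fun x => RtoC (f x)) (RtoC l).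
Proof.
  intros H. apply is_C_RInt_parts; simpl; auto.
  assert (Hs := is_RInt_gen_scal (V := R_NormedModule) f 0 l H).
  apply (is_RInt_gen_ext_pos (V := R_CompleteNormedModule) (fun y => 0 * f y)); [intros x _; apply Rmult_0_l|].
  exact (eq_ind (0 * l) (fun l => is_RInt_gen (fun y => 0 * f y) at0 atoo l) Hs 0 (Rmult_0_l l)).
Qed.

(** * The Mellin integral of omega is entire *)

(** Sums and integrals in [C_R_NormedModule] hide equations between complex numbers
    from [ring] and [field]. *)
Ltac Ceq := match goal with |- @eq _ ?a ?b => change (@eq C a b) end.

Lemma C2_neq_0 : RtoC 2 <> RtoC 0.
Proof. intros H. apply (f_equal Re) in H. simpl in H. lra. Qed.

Lemma xinv_bounds (x : R) : 0 < x -> 2 <= x + / x /\ x <= x + / x /\ / x <= x + / x.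
Proof.
  intros Hx. assert (Hi := Rinv_0_lt_compat _ Hx).
  assert (E : x * / x = 1) by (apply Rinv_r; lra).
  split; [|lra]. assert (0 <= (x - / x) ^ 2) by apply pow2_ge_0. nra.
Qed.

Lemma ln_le_xinv (x : R) : 0 < x -> Rabs (ln x) <= ln (x + / x).
Proof.
  intros Hx. destruct (xinv_bounds x Hx) as [H2 [H3 H4]].
  assert (Hi := Rinv_0_lt_compat _ Hx).
  assert (L1 : ln x <= ln (x + / x)) by (apply ln_le; lra).
  assert (L2 : ln (/ x) <= ln (x + / x)) by (apply ln_le; lra).
  rewrite ln_Rinv in L2 by auto. apply Rabs_le_between; lra.
Qed.

Lemma exp_ln_pow (y : R) (K : nat) : 0 < y -> exp (INR K * ln y) = y ^ K.
Proof. intros Hy. now rewrite <- exp_pow, exp_ln. Qed.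

(** Every power of [x], of positive or negative exponent, is dominated by a power of
    [x + 1/x], the quantity in which the decay of [omega] is expressed. *)
Lemma Rpower_le_xinv (x r : R) (K : nat) : 0 < x -> Rabs r <= INR K ->
  Rpower x r <= (x + / x) ^ K.
Proof.
  intros Hx Hr. destruct (xinv_bounds x Hx) as [H2 _].
  rewrite <- exp_ln_pow by lra. unfold Rpower. apply exp_monotone.
  eapply Rle_trans; [apply Rle_abs|]. rewrite Rabs_mult.
  apply Rmult_le_compat; auto using Rabs_pos, ln_le_xinv.
Qed.

Lemma ln_abs_le_xinv (x : R) : 0 < x -> Rabs (ln x) <= x + / x.
Proof.
  intros Hx. eapply Rle_trans; [now apply ln_le_xinv|].
  destruct (xinv_bounds x Hx) as [H2 _].
  assert (H := exp_ineq1_le (ln (x + / x))). rewrite exp_ln in H by lra. lra.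
Qed.

Lemma majorant_1 (x : R) : 0 < x -> majorant 1 x = / (1 + x) ^ 2.
Proof.
  intros Hx. unfold majorant. replace (1 - 1) with 0 by ring.
  rewrite Rpower_O, Rpower_1 by auto. field. lra.
Qed.

(** Half of the exponent in the decay of [omega] absorbs the polynomial weight and
    the majorant; the other half is kept for the moments, where it competes with
    the powers of [(x-1)/(x+1)]. *)
Lemma omega_weighted (K : nat) : exists A, 0 < A /\ forall x, 0 < x ->
  Rabs (omega x) * (x + / x) ^ K <= A * exp (- ((x + / x) / 8)) * majorant 1 x.
Proof.
  destruct omega_bound as [A0 [HA0 H0]].
  destruct (pow_exp_bound (K + 2) (1 / 8) ltac:(lra)) as [B [HB H1]].
  exists (A0 * (4 * B)). split; [nra|]. intros x Hx.
  destruct (xinv_bounds x Hx) as [H2 [H3 H4]]. set (X := x + / x) in *.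
  specialize (H0 x Hx). fold X in H0. specialize (H1 X ltac:(lra)).
  rewrite majorant_1 by auto.
  assert (He : exp (- (X / 4)) = exp (- (X / 8)) * exp (- (1 / 8 * X)))
    by (rewrite <- exp_plus; f_equal; field).
  assert (HX : 0 < X ^ K) by (apply pow_lt; lra).
  assert (Hp := exp_pos (- (X / 8))). assert (Hp' := exp_pos (- (1 / 8 * X))).
  assert (HB' : X ^ K * exp (- (1 / 8 * X)) <= 4 * B * / (1 + x) ^ 2).
  { apply Rmult_le_reg_r with ((1 + x) ^ 2); [apply pow_lt; lra|].
    replace (4 * B * / (1 + x) ^ 2 * (1 + x) ^ 2) with (4 * B) by (field; lra).
    rewrite pow_add in H1.
    assert (Hsq : (1 + x) ^ 2 <= 4 * X ^ 2) by nra.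
    apply Rle_trans with (X ^ K * exp (- (1 / 8 * X)) * (4 * X ^ 2)).
    - apply Rmult_le_compat_l; [nra | exact Hsq].
    - lra. }
  apply Rle_trans with (A0 * exp (- (X / 4)) * X ^ K).
  - apply Rmult_le_compat_r; lra.
  - rewrite He.
    replace (A0 * (exp (- (X / 8)) * exp (- (1 / 8 * X))) * X ^ K)
      with (A0 * exp (- (X / 8)) * (X ^ K * exp (- (1 / 8 * X)))) by ring.
    replace (A0 * (4 * B) * exp (- (X / 8)) * / (1 + x) ^ 2)
      with (A0 * exp (- (X / 8)) * (4 * B * / (1 + x) ^ 2)) by ring.
    apply Rmult_le_compat_l; [nra | exact HB'].
Qed.

(** A uniform bound on the integral of [omega] against any kernel of polynomial growth
    in [x + 1/x]; it is what differentiation under the integral sign consumes. *)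
Lemma omega_C_RInt (K : nat) : exists A, 0 < A /\ forall (G : R -> C) (c : R),
  (forall x, 0 < x -> continuous (U := C_R_NormedModule) G x) ->
  (forall x, 0 < x -> Cmod (G x) <= c * (x + / x) ^ K) ->
  is_C_RInt (fun x => RtoC (omega x) * G x)%C (C_RInt (fun x => RtoC (omega x) * G x)%C) /\
  Cmod (C_RInt (fun x => RtoC (omega x) * G x)%C) <= A * c.
Proof.
  destruct (omega_weighted K) as [A [HA H]]. exists A; split; auto.
  intros G c HG Hb.
  assert (Hc : 0 <= c).
  { specialize (Hb 1 Rlt_0_1). destruct (xinv_bounds 1 Rlt_0_1) as [H2 _].
    assert (0 < (1 + / 1) ^ K) by (apply pow_lt; lra).
    assert (Hm := Cmod_ge_0 (G 1)). nra. }
  assert (Hcont : continuous_pos (V := C_R_NormedModule) (fun x => RtoC (omega x) * G x)%C).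
  { intros x Hx. apply continuous_Cmult; auto. apply continuous_RtoC. now apply continuous_omega. }
  assert (Hn : forall x, 0 < x ->
    @norm R_AbsRing C_R_NormedModule (RtoC (omega x) * G x)%C <= (A * c) * majorant 1 x).
  { intros x Hx. rewrite norm_C_R, Cmod_mult, Cmod_R.
    specialize (H x Hx). specialize (Hb x Hx).
    destruct (xinv_bounds x Hx) as [H2 _]. assert (Hh := majorant_pos 1 x Rlt_0_1).
    assert (He : exp (- ((x + / x) / 8)) <= 1).
    { rewrite <- exp_0. apply exp_monotone. lra. }
    assert (Hw := Rabs_pos (omega x)).
    apply Rle_trans with (Rabs (omega x) * (c * (x + / x) ^ K)).
    - apply Rmult_le_compat_l; auto.
    - replace (Rabs (omega x) * (c * (x + / x) ^ K))
        with (c * (Rabs (omega x) * (x + / x) ^ K)) by ring.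
      replace (A * c * majorant 1 x) with (c * (A * 1 * majorant 1 x)) by ring.
      apply Rmult_le_compat_l; auto. eapply Rle_trans; [exact H|].
      apply Rmult_le_compat_r; [lra|]. apply Rmult_le_compat_l; lra. }
  split.
  - exact (is_RInt_gen_dominated (V := C_R_CompleteNormedModule) _ 1 _ Hcont Rlt_0_1 Hn).
  - rewrite <- norm_C_R.
    exact (norm_RInt_gen_dominated (V := C_R_CompleteNormedModule) _ 1 _ Hcont Rlt_0_1 Hn).
Qed.

Definition xi_kernel (s : C) (x : R) : C := Rcpow x (s / RtoC 2 - RtoC 1)%C.

Definition xi_fun (s : C) : C := C_RInt (fun x => RtoC (omega x) * xi_kernel s x)%C.

Lemma nat_above (r : R) : exists K : nat, r <= INR K.
Proof.
  destruct (nfloor_ex (Rabs r) (Rabs_pos r)) as [n Hn]. exists (S n).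
  rewrite S_INR. assert (H := Rle_abs r). lra.
Qed.

Lemma C_half_minus_one_Re (s : C) : Re (s / RtoC 2 - RtoC 1)%C = Re s / 2 - 1.
Proof. destruct s as [a b]; simpl. field. Qed.

Lemma xi_kernel_bound (s : C) : exists K : nat, forall x, 0 < x ->
  Cmod (xi_kernel s x) <= (x + / x) ^ K.
Proof.
  destruct (nat_above (Rabs (Re s / 2 - 1))) as [K HK]. exists K. intros x Hx.
  unfold xi_kernel. rewrite Cmod_Rcpow, C_half_minus_one_Re.
  now apply Rpower_le_xinv.
Qed.

Lemma continuous_xi_kernel s x : 0 < x ->
  continuous (U := C_R_NormedModule) (xi_kernel s) x.
Proof. apply continuous_Rcpow. Qed.

Lemma is_C_RInt_ext (f g : R -> C) (l : C) :
  (forall x, 0 < x -> f x = g x) -> is_C_RInt f l -> is_C_RInt g l.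
Proof. exact (is_RInt_gen_ext_pos (V := C_R_CompleteNormedModule) f g l). Qed.

Lemma C_RInt_unique (f : R -> C) (l : C) : is_C_RInt f l -> C_RInt f = l.
Proof. exact (RInt_gen_pos_unique (V := C_R_CompleteNormedModule) f l). Qed.

Lemma xi_fun_is_C_RInt s :
  is_C_RInt (fun x => RtoC (omega x) * xi_kernel s x)%C (xi_fun s).
Proof.
  destruct (xi_kernel_bound s) as [K HK].
  destruct (omega_C_RInt K) as [A [HA H]].
  apply (H (xi_kernel s) 1).
  - intros x Hx; now apply continuous_xi_kernel.
  - intros x Hx. rewrite Rmult_1_l. auto.
Qed.

Lemma xi_kernel_shift (s h : C) (x : R) :
  xi_kernel (s + h) x = (xi_kernel s x * Cexp (h / RtoC 2 * RtoC (ln x)))%C.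
Proof.
  unfold xi_kernel. fold (Rcpow x (h / RtoC 2)). rewrite <- Rcpow_plus. f_equal.
  field; try exact C2_neq_0.
Qed.

(** The increment of the kernel is the kernel times [exp w - 1] with [w = h ln x / 2].
    By [Cexp_taylor1] the remainder after the linear term is of order [h^2], with a
    polynomial weight in [x + 1/x]. *)
Theorem xi_fun_entire : entire xi_fun.
Proof.
  intros z. destruct (xi_kernel_bound z) as [K HK].
  destruct (omega_C_RInt (K + 1)) as [A1 [HA1 HI1]].
  destruct (omega_C_RInt (K + 3)) as [A3 [HA3 HI3]].
  set (G1 := fun x => (xi_kernel z x * RtoC (ln x / 2))%C).
  assert (HG1c : forall x, 0 < x -> continuous (U := C_R_NormedModule) G1 x).
  { intros x Hx. apply continuous_Cmult; [now apply continuous_xi_kernel|].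
    apply continuous_RtoC, continuous_of_derivable. auto_derive; auto. }
  assert (HG1 : forall x, 0 < x -> Cmod (G1 x) <= 1 * (x + / x) ^ (K + 1)).
  { intros x Hx. unfold G1. rewrite Cmod_mult, Cmod_R, pow_add, pow_1, Rmult_1_l.
    apply Rmult_le_compat; auto using Cmod_ge_0, Rabs_pos.
    unfold Rdiv. rewrite Rabs_mult, (Rabs_right (/ 2)) by lra.
    assert (H := ln_abs_le_xinv x Hx). assert (H' := Rabs_pos (ln x)). lra. }
  destruct (HI1 G1 1 HG1c HG1) as [Hint1 _].
  set (l := C_RInt (fun x => RtoC (omega x) * G1 x)%C) in *.
  exists l. split; [apply (is_linear_scal_l (K := C_AbsRing) (V := C_NormedModule))|].
  intros w Hw. apply (is_filter_lim_locally_unique (V := AbsRing_NormedModule C_AbsRing)) in Hw.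
  subst w. intros eps.
  assert (Hmain : forall h : C, Cmod h <= 1 ->
    Cmod (xi_fun (z + h) - xi_fun z - h * l)%C <= A3 * (4 * Cmod h ^ 2)).
  { intros h Hh.
    set (G3 := fun x => (xi_kernel z x * (Cexp (h / RtoC 2 * RtoC (ln x)) - 1
                          - h / RtoC 2 * RtoC (ln x)))%C).
    destruct (HI3 G3 (4 * Cmod h ^ 2)) as [_ Hb].
    - intros x Hx. unfold G3.
      apply (continuous_ext_loc _ (fun x => xi_kernel (z + h) x
        + - xi_kernel z x + - h * G1 x)%C).
      + exists (mkposreal x Hx). intros y Hy. rewrite xi_kernel_shift. unfold G1.
        rewrite RtoC_div by lra. Ceq; field; try exact C2_neq_0.
      + assert (Hcn : forall f, continuous (U := C_R_NormedModule) f x ->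
          forall c, continuous (U := C_R_NormedModule) (fun y => c * f y)%C x)
          by (intros f Hf c; apply continuous_Cmult; auto; apply continuous_Cconst).
        repeat apply continuous_Cplus.
        * now apply continuous_xi_kernel.
        * apply (continuous_opp (V := C_R_NormedModule)). now apply continuous_xi_kernel.
        * apply Hcn. now apply HG1c.
    - intros x Hx. unfold G3. rewrite Cmod_mult.
      set (w := (h / RtoC 2 * RtoC (ln x))%C).
      assert (Hwm : Cmod w = Cmod h * (Rabs (ln x) / 2)).
      { unfold w. rewrite Cmod_mult, Cmod_R, Cmod_div.
        - rewrite Cmod_R, (Rabs_right 2) by lra. field; try exact C2_neq_0.
        - intros H0. apply (f_equal Re) in H0. simpl in H0. lra. }
      assert (HT := Cexp_taylor1 w).
      assert (L1 := ln_le_xinv x Hx). assert (L2 := ln_abs_le_xinv x Hx).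
      assert (L0 := Rabs_pos (ln x)). assert (Hh0 := Cmod_ge_0 h).
      destruct (xinv_bounds x Hx) as [X2 _].
      set (X := x + / x) in *.
      assert (E1 : exp (Cmod w) <= X).
      { rewrite <- (exp_ln X) by lra. apply exp_monotone. rewrite Hwm. nra. }
      assert (E2 : Cmod w ^ 2 <= Cmod h ^ 2 * X ^ 2).
      { rewrite Hwm, Rpow_mult_distr. apply Rmult_le_compat_l; [apply pow2_ge_0|].
        apply pow_incr. lra. }
      assert (E3 : Cmod (Cexp w - 1 - w)%C <= 4 * Cmod h ^ 2 * X ^ 3).
      { eapply Rle_trans; [exact HT|].
        apply Rle_trans with (4 * (Cmod h ^ 2 * X ^ 2) * X); [|right; ring].
        apply Rmult_le_compat; try lra; [|left; apply exp_pos].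
        assert (H := pow2_ge_0 (Cmod w)). lra. }
      rewrite pow_add.
      replace (4 * Cmod h ^ 2 * (X ^ K * X ^ 3)) with (X ^ K * (4 * Cmod h ^ 2 * X ^ 3)) by ring.
      apply Rmult_le_compat; auto using Cmod_ge_0.
    - assert (HI : is_C_RInt (fun x => RtoC (omega x) * G3 x)%C
        (xi_fun (z + h) + (- (1)) * xi_fun z + - h * l)%C).
      { apply (is_C_RInt_ext (fun x => RtoC (omega x) * xi_kernel (z + h) x
          + (- (1)) * (RtoC (omega x) * xi_kernel z x) + - h * (RtoC (omega x) * G1 x))%C).
        - intros x Hx. rewrite xi_kernel_shift. unfold G1, G3. rewrite RtoC_div by lra. field; try exact C2_neq_0.
        - apply is_C_RInt_plus; [apply is_C_RInt_plus|].
          + apply xi_fun_is_C_RInt.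
          + apply is_C_RInt_mult, xi_fun_is_C_RInt.
          + apply is_C_RInt_mult, Hint1. }
      rewrite (C_RInt_unique _ _ HI) in Hb.
      replace (xi_fun (z + h) - xi_fun z - h * l)%C
        with (xi_fun (z + h) + (- (1)) * xi_fun z + - h * l)%C by ring.
      exact Hb. }
  set (d := Rmin 1 (eps / (4 * A3))).
  assert (Hd : 0 < d).
  { apply Rmin_glb_lt; [lra|]. apply Rdiv_lt_0_compat; [apply eps | lra]. }
  exists (mkposreal d Hd). intros y Hy.
  change (Cmod (y - z)%C < d) in Hy.
  change (Cmod ((xi_fun y - xi_fun z) - (y - z) * l)%C <= eps * Cmod (y - z)%C).
  set (h := (y - z)%C) in *.
  replace y with (z + h)%C by (unfold h; ring).
  assert (Hh1 : Cmod h <= 1) by (apply Rlt_le, (Rlt_le_trans _ _ _ Hy), Rmin_l).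
  assert (Hh2 : Cmod h < eps / (4 * A3)) by (apply (Rlt_le_trans _ _ _ Hy), Rmin_r).
  eapply Rle_trans; [now apply Hmain|].
  assert (Hh0 := Cmod_ge_0 h).
  assert (A3 * 4 * Cmod h <= eps).
  { apply Rmult_le_reg_r with (/ (4 * A3)); [apply Rinv_0_lt_compat; lra|].
    replace (A3 * 4 * Cmod h * / (4 * A3)) with (Cmod h) by (field; lra). lra. }
  nra.
Qed.

(** * The Mellin integral of omega continues the completed zeta function *)

Notation is_Cseries a l := (is_series (K := R_AbsRing) (V := C_R_NormedModule) a l).
Definition Csum (a : nat -> C) (N : nat) : C := sum_n (G := C_R_NormedModule) a N.

Lemma Csum_S (a : nat -> C) (N : nat) : Csum a (S N) = (Csum a N + a (S N))%C.
Proof. exact (sum_Sn (G := C_R_NormedModule) a N). Qed.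

Lemma Csum_O (a : nat -> C) : Csum a 0%nat = a 0%nat.
Proof. exact (sum_O (G := C_R_NormedModule) a). Qed.

(** The form of convergence used for every complex series: it does not depend on
    which norm structure on the complex numbers is meant. *)
Lemma is_Cseries_norm (a : nat -> C) (l : C) :
  is_Cseries a l <-> is_lim_seq (fun N => Cmod (l - Csum a N)%C) 0.
Proof.
  split.
  - intros H. apply is_lim_seq_spec. intros [e He]; simpl.
    assert (He' : 0 < e / 2) by lra.
    assert (H' := proj1 (filterlim_locally _ _) H (mkposreal _ He')).
    destruct H' as [N0 HN]. exists N0. intros N Hle. specialize (HN N Hle).
    destruct HN as [B1 B2]. simpl in B1, B2.
    change (Rabs (Re (Csum a N) - Re l) < e / 2) in B1.
    change (Rabs (Im (Csum a N) - Im l) < e / 2) in B2.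
    rewrite Rminus_0_r, Rabs_right by (apply Rle_ge, Cmod_ge_0).
    eapply Rle_lt_trans; [apply Cmod_le_parts|].
    change (Rabs (Re l - Re (Csum a N)) + Rabs (Im l - Im (Csum a N)) < e).
    rewrite (Rabs_minus_sym (Re l)), (Rabs_minus_sym (Im l)). lra.
  - intros H. apply is_lim_seq_spec in H. apply filterlim_locally. intros e.
    destruct (H e) as [N0 HN]. exists N0. intros N Hle. specialize (HN N Hle).
    rewrite Rminus_0_r, Rabs_right in HN by (apply Rle_ge, Cmod_ge_0).
    apply ball_sym, (norm_compat1 (V := C_R_NormedModule)).
    rewrite norm_C_R. exact HN.
Qed.

Lemma Csum_mult (c : C) (a : nat -> C) (N : nat) :
  Csum (fun k => c * a k)%C N = (c * Csum a N)%C.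
Proof.
  induction N as [|N IH]; [now rewrite !Csum_O|]. rewrite !Csum_S, IH. Ceq; ring.
Qed.

Lemma Csum_RtoC (a : nat -> R) (N : nat) :
  Csum (fun k => RtoC (a k)) N = RtoC (sum_n a N).
Proof.
  induction N as [|N IH]; [now rewrite Csum_O, sum_O|].
  rewrite Csum_S, IH, sum_n_RS. now rewrite RtoC_plus.
Qed.

Lemma Csum_ext (a b : nat -> C) (N : nat) :
  (forall k, a k = b k) -> Csum a N = Csum b N.
Proof. exact (sum_n_ext (G := C_R_NormedModule) a b N). Qed.

Lemma is_Cseries_mult (c : C) (a : nat -> C) (l : C) :
  is_Cseries a l -> is_Cseries (fun k => c * a k)%C (c * l)%C.
Proof.
  intros H. apply is_Cseries_norm in H. apply is_Cseries_norm.
  apply is_lim_seq_ext with (fun N => Cmod c * Cmod (l - Csum a N)%C).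
  - intros N. rewrite <- Cmod_mult. f_equal. rewrite Csum_mult. Ceq; ring.
  - replace (Finite 0) with (Finite (Cmod c * 0)) by (f_equal; ring).
    apply is_lim_seq_mult'; [apply is_lim_seq_const | exact H].
Qed.

Lemma is_Cseries_ext (a b : nat -> C) (l : C) :
  (forall k, a k = b k) -> is_Cseries a l -> is_Cseries b l.
Proof. exact (is_series_ext (V := C_R_NormedModule) a b l). Qed.

Lemma is_Cseries_RtoC (a : nat -> R) (l : R) :
  is_series a l -> is_Cseries (fun k => RtoC (a k)) (RtoC l).
Proof.
  intros H. apply is_Cseries_norm.
  apply is_lim_seq_ext with (fun N => Rabs (l - sum_n a N)).
  - intros N. rewrite Csum_RtoC, <- RtoC_minus, Cmod_R. reflexivity.
  - replace (Finite 0) with (Rbar_abs (Finite (l - l))) by (simpl; f_equal; rewrite Rminus_diag; apply Rabs_R0).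
    apply is_lim_seq_abs. apply is_lim_seq_minus'; [apply is_lim_seq_const | exact H].
Qed.

Lemma Re_Csum (a : nat -> C) N : Re (Csum a N) = sum_n (fun k => Re (a k)) N.
Proof.
  induction N as [|N IH]; [now rewrite Csum_O, sum_O|].
  rewrite Csum_S, sum_n_RS, <- IH. reflexivity.
Qed.

Lemma Im_Csum (a : nat -> C) N : Im (Csum a N) = sum_n (fun k => Im (a k)) N.
Proof.
  induction N as [|N IH]; [now rewrite Csum_O, sum_O|].
  rewrite Csum_S, sum_n_RS, <- IH. reflexivity.
Qed.

Lemma is_Cseries_Re (a : nat -> C) (l : C) :
  is_Cseries a l -> is_series (fun k => Re (a k)) (Re l).
Proof.
  intros H. apply is_Cseries_norm in H. apply is_lim_seq_spec in H.
  assert (H' : is_lim_seq (sum_n (fun k => Re (a k))) (Finite (Re l))); [|exact H'].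
  apply is_lim_seq_spec. intros e. destruct (H e) as [N0 HN].
  exists N0. intros N Hle. specialize (HN N Hle).
  rewrite Rminus_0_r, Rabs_right in HN by (apply Rle_ge, Cmod_ge_0).
  rewrite <- Re_Csum, Rabs_minus_sym.
  eapply Rle_lt_trans; [apply (re_le_Cmod (l - Csum a N)%C) | exact HN].
Qed.

Lemma is_Cseries_Im (a : nat -> C) (l : C) :
  is_Cseries a l -> is_series (fun k => Im (a k)) (Im l).
Proof.
  intros H. apply is_Cseries_norm in H. apply is_lim_seq_spec in H.
  assert (H' : is_lim_seq (sum_n (fun k => Im (a k))) (Finite (Im l))); [|exact H'].
  apply is_lim_seq_spec. intros e. destruct (H e) as [N0 HN].
  exists N0. intros N Hle. specialize (HN N Hle).
  rewrite Rminus_0_r, Rabs_right in HN by (apply Rle_ge, Cmod_ge_0).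
  rewrite <- Im_Csum, Rabs_minus_sym.
  eapply Rle_lt_trans; [apply (Im_le_Cmod (l - Csum a N)%C) | exact HN].
Qed.

Lemma CSeries_unique (a : nat -> C) (l : C) : is_Cseries a l -> CSeries a = l.
Proof.
  intros H. apply C_ext; simpl; apply is_series_unique;
    [now apply is_Cseries_Re | now apply is_Cseries_Im].
Qed.

Lemma Rpower_le_1p (y r : R) (K : nat) : 0 < y -> 0 <= r <= INR K ->
  Rpower y r <= (1 + y) ^ K.
Proof.
  intros Hy Hr. rewrite <- exp_ln_pow by lra. unfold Rpower. apply exp_monotone.
  assert (H1 : ln y <= ln (1 + y)) by (apply ln_le; lra).
  assert (H2 : 0 <= ln (1 + y)) by (rewrite <- ln_1; apply ln_le; lra).
  nra.
Qed.

Lemma pow_1p_exp (N : nat) (c : R) : 0 < c ->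
  exists A, 0 < A /\ forall y, 0 < y -> (1 + y) ^ N * exp (- (c * y)) <= A.
Proof.
  intros Hc. destruct (pow_exp_bound N c Hc) as [A [HA H]].
  exists (A * exp c). split; [assert (Hp := exp_pos c); nra|].
  intros y Hy. specialize (H (1 + y) ltac:(lra)).
  replace (- (c * y)) with (- (c * (1 + y)) + c) by ring.
  rewrite exp_plus, <- Rmult_assoc. apply Rmult_le_compat_r; [left; apply exp_pos | exact H].
Qed.

(** Powers with real exponents are bounded by integer powers of [1 + y]. *)
Lemma exp_dominates (p q c : R) : 0 <= p -> 0 <= q -> 0 < c ->
  exists A, 0 < A /\ forall y, 0 < y ->
    (1 + y) ^ 2 * Rpower y p * (1 + Rpower y q) ^ 2 * exp (- (c * y)) <= A.
Proof.
  intros Hp Hq0 Hc.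
  destruct (nat_above p) as [P HP]. destruct (nat_above q) as [Q HQ].
  destruct (pow_1p_exp (2 + P + 2 * Q) c Hc) as [A [HA H]].
  exists (4 * A). split; [lra|]. intros y Hy. specialize (H y Hy).
  assert (H1 := Rpower_le_1p y p P Hy ltac:(lra)).
  assert (H2 := Rpower_le_1p y q Q Hy ltac:(lra)).
  assert (P1 := Rpower_pos y p).
  assert (P2 := Rpower_pos y q).
  assert (H3 : 1 <= (1 + y) ^ Q) by (apply pow_R1_Rle; lra).
  assert (H4 : (1 + Rpower y q) ^ 2 <= 4 * ((1 + y) ^ Q * (1 + y) ^ Q)) by nra.
  assert (He := exp_pos (- (c * y))).
  rewrite !pow_add, pow_mult in H.
  replace (((1 + y) ^ 2) ^ Q) with ((1 + y) ^ Q * (1 + y) ^ Q) in H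
    by (rewrite <- pow_add, <- pow_mult; f_equal; lia).
  set (E := exp (- (c * y))) in *. set (U := (1 + y) ^ Q) in *.
  assert (H0 : 0 <= (1 + y) ^ 2) by nra.
  assert (H5 : Rpower y p * (1 + Rpower y q) ^ 2 <= (1 + y) ^ P * (4 * (U * U))).
  { apply Rmult_le_compat; try lra. apply pow2_ge_0. }
  apply Rle_trans with ((1 + y) ^ 2 * ((1 + y) ^ P * (4 * (U * U))) * E).
  - rewrite Rmult_assoc with (r3 := (1 + Rpower y q) ^ 2).
    apply Rmult_le_compat_r; [lra|]. now apply Rmult_le_compat_l.
  - lra.
Qed.

Section GammaIntegral.

Variable w : C.
Hypothesis Hw : 0 < Re w.

Definition gamma_kernel (lam : R) (x : R) : C :=
  (Rcpow x (w - RtoC 1) * RtoC (exp (- (lam * x))))%C.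

Lemma continuous_gamma_kernel lam x : 0 < x ->
  continuous (U := C_R_NormedModule) (gamma_kernel lam) x.
Proof.
  intros Hx. apply continuous_Cmult; [now apply continuous_Rcpow|].
  apply continuous_RtoC, continuous_of_derivable. auto_derive; auto.
Qed.

Lemma is_C_RInt_Gamma : is_C_RInt (gamma_kernel 1) (Gamma w).
Proof.
  destruct (exp_dominates 0 (Re w) 1 ltac:(lra) ltac:(lra) ltac:(lra)) as [A [HA H]].
  assert (HI : is_C_RInt (gamma_kernel 1) (C_RInt (gamma_kernel 1))).
  { apply (is_RInt_gen_dominated (V := C_R_CompleteNormedModule) (gamma_kernel 1) (Re w) (A / Re w)).
    - intros x Hx. now apply continuous_gamma_kernel.
    - exact Hw.
    - intros x Hx.
      change (@norm R_AbsRing C_R_NormedModule (gamma_kernel 1 x) <= A / Re w * majorant (Re w) x).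
      rewrite norm_C_R. unfold gamma_kernel. rewrite Cmod_mult, Cmod_Rcpow, Cmod_R.
      rewrite (Rabs_right (exp _)) by (left; apply exp_pos).
      replace (Re (w - RtoC 1)%C) with (Re w - 1) by (destruct w; simpl; ring).
      unfold majorant. specialize (H x Hx). rewrite Rpower_O, Rmult_1_r in H by auto.
      assert (P1 := Rpower_pos x (Re w - 1)).
      assert (P2 := Rpower_pos x (Re w)).
      assert (He := exp_pos (- (1 * x))).
      set (D := (1 + Rpower x (Re w)) ^ 2) in *.
      assert (HD : 0 < D) by (apply pow_lt; lra).
      assert (HE : exp (- (1 * x)) <= A / D).
      { apply Rmult_le_reg_r with D; auto.
        replace (A / D * D) with A by (field; lra).
        eapply Rle_trans; [|exact H].
        assert (1 <= (1 + x) ^ 2) by nra.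
        assert (0 <= D * exp (- (1 * x))) by nra. nra. }
      replace (A / Re w * (Re w * Rpower x (Re w - 1) / D))
        with (Rpower x (Re w - 1) * (A / D)) by (field; lra).
      apply Rmult_le_compat_l; lra. }
  replace (Gamma w) with (C_RInt (gamma_kernel 1)); [exact HI|].
  symmetry. unfold Gamma. apply C_RInt_unique.
  revert HI. apply is_C_RInt_ext. intros x Hx. unfold gamma_kernel.
  now rewrite Rmult_1_l.
Qed.

Lemma is_C_RInt_Gamma_scaled (lam : R) : 0 < lam ->
  is_C_RInt (gamma_kernel lam) (Rcpow lam (- w) * Gamma w)%C.
Proof.
  intros Hl.
  assert (H := is_RInt_gen_scale (V := C_R_CompleteNormedModule) (gamma_kernel 1) lam (Gamma w) Hl
    (continuous_gamma_kernel 1) is_C_RInt_Gamma).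
  assert (H' := is_C_RInt_mult (Rcpow lam (- w)) _ _ H).
  revert H'. apply is_C_RInt_ext. intros x Hx.
  assert (E : forall (a : R) (z : C), @scal R_AbsRing C_R_NormedModule a z = (RtoC a * z)%C).
  { intros a [z1 z2]. apply C_ext; simpl; unfold scal; simpl; unfold mult; simpl; ring. }
  etransitivity; [apply (f_equal (fun z => (Rcpow lam (- w) * z)%C)), E|].
  unfold gamma_kernel. rewrite Rcpow_mult_base by auto. rewrite Rmult_1_l.
  assert (E1 : (Rcpow lam (- w) * (RtoC lam * Rcpow lam (w - RtoC 1)))%C = RtoC 1).
  { rewrite <- (Rcpow_exponent_1 lam Hl). rewrite <- !Rcpow_plus.
    replace (- w + (RtoC 1 + (w - RtoC 1)))%C with (RtoC 0) by ring.
    rewrite Rcpow_R. rewrite Rpower_O; auto. }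
  transitivity ((Rcpow lam (- w) * (RtoC lam * Rcpow lam (w - RtoC 1))) *
    (Rcpow x (w - RtoC 1) * RtoC (exp (- (lam * x)))))%C; [Ceq; ring|].
  rewrite E1. Ceq; ring.
Qed.

(** The integrand is the derivative of [x^w exp (- lam x)], which vanishes at both
    ends because it is at most a constant times the primitive of a majorant. *)
Lemma is_C_RInt_total_derivative (lam : R) : 0 < lam ->
  is_C_RInt (fun x => (w - RtoC lam * RtoC x) * gamma_kernel lam x)%C (RtoC 0).
Proof.
  intros Hl.
  destruct (exp_dominates 0 (Re w) lam ltac:(lra) ltac:(lra) Hl) as [A [HA H]].
  set (Q := fun x => (Rcpow x w * RtoC (exp (- (lam * x))))%C).
  assert (HQ : forall x, 0 < x -> Cmod (Q x) <= A * (majorant_primitive (Re w) x + 1) /\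
    Cmod (Q x) <= A * (- majorant_primitive (Re w) x)).
  { intros x Hx. unfold Q. rewrite Cmod_mult, Cmod_Rcpow, Cmod_R.
    rewrite (Rabs_right (exp _)) by (left; apply exp_pos).
    specialize (H x Hx). rewrite Rpower_O, Rmult_1_r in H by auto.
    assert (P2 := Rpower_pos x (Re w)).
    assert (He := exp_pos (- (lam * x))).
    unfold majorant_primitive. set (u := Rpower x (Re w)) in *.
    assert (HE : (1 + u) ^ 2 * exp (- (lam * x)) <= A).
    { eapply Rle_trans; [|exact H].
      assert (1 <= (1 + x) ^ 2) by nra.
      assert (0 <= (1 + u) ^ 2 * exp (- (lam * x))) by nra. nra. }
    assert (Hi : 0 < / (1 + u)) by (apply Rinv_0_lt_compat; lra).
    set (E := exp (- (lam * x))) in *.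
    split.
    - replace (- / (1 + u) + 1) with (u * / (1 + u)) by (field; lra).
      apply Rmult_le_reg_r with (1 + u); [lra|].
      replace (A * (u * / (1 + u)) * (1 + u)) with (u * A) by (field; lra).
      replace (u * E * (1 + u)) with (u * ((1 + u) * E)) by ring.
      apply Rmult_le_compat_l; [lra|].
      assert (0 <= u * ((1 + u) * E)) by (apply Rmult_le_pos; nra). nra.
    - replace (- - / (1 + u)) with (/ (1 + u)) by ring.
      apply Rmult_le_reg_r with (1 + u); [lra|].
      rewrite (Rmult_assoc A), Rinv_l, Rmult_1_r by lra.
      assert (0 <= (1 + u) * E) by nra. nra. }

  assert (F0 : filterlim (fun x => A * (majorant_primitive (Re w) x + 1)) at0 (locally 0)).
  { replace 0 with (A * (-1 + 1)) at 2 by ring.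
    apply (filterlim_comp _ _ _ (majorant_primitive (Re w)) (fun y => A * (y + 1)) at0 (locally (-1)));
      [now apply majorant_primitive_0|].
    apply (continuous_of_derivable (fun y => A * (y + 1)) (-1)). auto_derive; auto. }
  assert (Foo : filterlim (fun x => A * (- majorant_primitive (Re w) x)) atoo (locally 0)).
  { replace 0 with (A * (- 0)) by ring.
    apply (filterlim_comp _ _ _ (majorant_primitive (Re w)) (fun y => A * (- y)) atoo (locally 0));
      [now apply majorant_primitive_oo|].
    apply (continuous_of_derivable (fun y => A * (- y)) 0). auto_derive; auto. }
  assert (Hev0 : at0 (fun x => 0 < x)) by (exists (mkposreal 1 Rlt_0_1); auto).
  assert (Hevoo : atoo (fun x => 0 < x)) by (exists 0; auto).
  (* Squeeze, for the real and the imaginary part at once. *)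
  assert (Sq : forall (part : C -> R), (forall z, Rabs (part z) <= Cmod z) ->
    filterlim (fun x => part (Q x)) at0 (locally 0) /\
    filterlim (fun x => part (Q x)) atoo (locally 0)).
  { intros part Hpart. split.
    - apply filterlim_locally. intros e.
      assert (E := proj1 (filterlim_locally _ _) F0 e).
      refine (filter_imp _ _ _ (filter_and _ _ E Hev0)). intros x [B Hx].
      change (Rabs (A * (majorant_primitive (Re w) x + 1) - 0) < e) in B.
      change (Rabs (part (Q x) - 0) < e). rewrite Rminus_0_r in *.
      eapply Rle_lt_trans; [apply Hpart|].
      eapply Rle_lt_trans; [apply (proj1 (HQ x Hx))|]. eapply Rle_lt_trans; [apply Rle_abs | exact B].
    - apply filterlim_locally. intros e.
      assert (E := proj1 (filterlim_locally _ _) Foo e).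
      refine (filter_imp _ _ _ (filter_and _ _ E Hevoo)). intros x [B Hx].
      change (Rabs (A * (- majorant_primitive (Re w) x) - 0) < e) in B.
      change (Rabs (part (Q x) - 0) < e). rewrite Rminus_0_r in *.
      eapply Rle_lt_trans; [apply Hpart|].
      eapply Rle_lt_trans; [apply (proj2 (HQ x Hx))|]. eapply Rle_lt_trans; [apply Rle_abs | exact B]. }
  assert (Hcont : continuous_pos (V := C_R_NormedModule)
    (fun x => (w - RtoC lam * RtoC x) * gamma_kernel lam x)%C).
  { intros x Hx. apply continuous_Cmult; [|now apply continuous_gamma_kernel].
    apply continuous_Cplus; [apply continuous_Cconst|].
    apply (continuous_opp (V := C_R_NormedModule)).
    apply continuous_Cmult; [apply continuous_Cconst|].
    apply continuous_RtoC, continuous_id. }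
  assert (Hpow : forall x, 0 < x ->
    Rcpow x (w - RtoC 1) = (Rcpow x w * RtoC (/ x))%C).
  { intros x Hx. unfold Cminus. rewrite Rcpow_plus. f_equal.
    rewrite <- RtoC_opp, Rcpow_R. f_equal. rewrite Rpower_Ropp, Rpower_1; auto. }
  assert (D : forall x, 0 < x ->
    is_derive (fun x => Re (Q x)) x (Re ((w - RtoC lam * RtoC x) * gamma_kernel lam x)%C) /\
    is_derive (fun x => Im (Q x)) x (Im ((w - RtoC lam * RtoC x) * gamma_kernel lam x)%C)).
  { intros x Hx. unfold gamma_kernel. rewrite (Hpow x Hx).
    unfold Q, Rcpow, Cexp. destruct w as [a b]. simpl.
    split; (auto_derive; [auto|]; unfold Rminus; field; lra). }
  apply is_C_RInt_parts; simpl (Re (RtoC 0)); simpl (Im (RtoC 0)).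
  - assert (G := is_RInt_gen_FTC (V := R_CompleteNormedModule) (fun x => Re (Q x)) _ 0 0
      (fun x Hx => continuous_Re _ _ (Hcont x Hx)) (fun x Hx => proj1 (D x Hx))
      (proj1 (Sq Re re_le_Cmod)) (proj2 (Sq Re re_le_Cmod))).
    exact (eq_ind (0 - 0) (fun l => is_RInt_gen _ at0 atoo l) G 0 (Rminus_diag 0)).
  - assert (G := is_RInt_gen_FTC (V := R_CompleteNormedModule) (fun x => Im (Q x)) _ 0 0
      (fun x Hx => continuous_Im _ _ (Hcont x Hx)) (fun x Hx => proj2 (D x Hx))
      (proj1 (Sq Im Im_le_Cmod)) (proj2 (Sq Im Im_le_Cmod))).
    exact (eq_ind (0 - 0) (fun l => is_RInt_gen _ at0 atoo l) G 0 (Rminus_diag 0)).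
Qed.

End GammaIntegral.

(** The term of index [k] of [omega x] is the value at [pi k^2 x]. *)
Definition omega_profile (y : R) : R := (2 * y ^ 2 - 3 * y) * exp (- y).

(** Write [w = s/2]. The polynomial [2 y^2 - 3 y] with [y = lam x] times
    [x^(w-1) exp (- lam x)] equals [s (s-1)/2 x^(w-1) exp (- lam x)] plus the
    derivative of [((1-s) x^w - 2 lam x^(w+1)) exp (- lam x)]. *)
Lemma mellin_term (s : C) (lam : R) : 0 < Re s -> 0 < lam ->
  is_C_RInt (fun x => RtoC (omega_profile (lam * x)) * xi_kernel s x)%C
    (s * (s - RtoC 1) / RtoC 2 * (Rcpow lam (- (s / RtoC 2)) * Gamma (s / RtoC 2)))%C.
Proof.
  intros Hs Hl.
  set (w := (s / RtoC 2)%C).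
  assert (Es : s = (RtoC 2 * w)%C) by (unfold w; field; exact C2_neq_0).
  assert (Hw : 0 < Re w).
  { replace (Re w) with (Re s / 2) by (unfold w; destruct s; simpl; field). lra. }
  assert (Hw1 : 0 < Re (w + RtoC 1)%C) by (destruct w; simpl in *; lra).
  assert (I0 := is_C_RInt_mult (s * (s - RtoC 1) / RtoC 2)%C _ _ (is_C_RInt_Gamma_scaled w Hw lam Hl)).
  assert (I1 := is_C_RInt_mult (RtoC 1 - s)%C _ _ (is_C_RInt_total_derivative w Hw lam Hl)).
  assert (I2 := is_C_RInt_mult (- (RtoC 2 * RtoC lam))%C _ _
    (is_C_RInt_total_derivative (w + RtoC 1)%C Hw1 lam Hl)).
  assert (I := is_C_RInt_plus _ _ _ _ I0 (is_C_RInt_plus _ _ _ _ I1 I2)).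
  replace (s * (s - RtoC 1) / RtoC 2 * (Rcpow lam (- w) * Gamma w))%C with
    (s * (s - RtoC 1) / RtoC 2 * (Rcpow lam (- w) * Gamma w)
      + ((RtoC 1 - s) * RtoC 0 + - (RtoC 2 * RtoC lam) * RtoC 0))%C by ring.
  revert I. apply is_C_RInt_ext. intros x Hx.
  unfold gamma_kernel, xi_kernel. fold w.
  replace (w + RtoC 1 - RtoC 1)%C with ((w - RtoC 1) + RtoC 1)%C by ring.
  rewrite Rcpow_plus, (Rcpow_exponent_1 x Hx).
  unfold omega_profile.
  rewrite RtoC_mult, RtoC_minus, !RtoC_mult, RtoC_pow, RtoC_mult.
  set (P := Rcpow x (w - RtoC 1)). set (E := RtoC (exp (- (lam * x)))).
  rewrite Es. Ceq. field.
Qed.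

Lemma omega_is_series (x : R) : 0 < x ->
  is_series (fun k => omega_profile (PI * INR (S k) ^ 2 * x)) (omega x).
Proof.
  intros Hx.
  assert (E1 := ex_theta_sum 1 x Hx). assert (E2 := ex_theta_sum 2 x Hx).
  apply (ex_series_incr_1 (fun k => _)) in E1. apply (ex_series_incr_1 (fun k => _)) in E2.
  assert (E := ex_series_Rminus _ _ (ex_series_Rscal (2 * x ^ 2) _ E2) (ex_series_Rscal (3 * x) _ E1)).
  assert (E' : ex_series (fun k => omega_profile (PI * INR (S k) ^ 2 * x))).
  { revert E. apply ex_series_ext. intros k. unfold omega_profile. Rring. }
  assert (Eo : omega x = Series (fun k => omega_profile (PI * INR (S k) ^ 2 * x))).
  { unfold omega. apply Series_ext. intros k. unfold omega_profile. ring. }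
  rewrite Eo. now apply Series_correct.
Qed.

Lemma omega_profile_bound (p q : R) : 0 <= p -> 0 < q ->
  exists A, 0 < A /\ forall y, 0 < y ->
    Rabs (omega_profile y) <= A * Rpower y (- p) / (1 + Rpower y q) ^ 2.
Proof.
  intros Hp Hq0.
  destruct (exp_dominates p q 1 Hp ltac:(lra) Rlt_0_1) as [A [HA H]].
  exists (5 * A). split; [lra|]. intros y Hy. specialize (H y Hy).
  unfold omega_profile. rewrite Rabs_mult, (Rabs_right (exp _)) by (left; apply exp_pos).
  rewrite Rmult_1_l in H. assert (He := exp_pos (- y)).
  rewrite Rpower_Ropp.
  assert (P1 := Rpower_pos y p).
  assert (P2 := Rpower_pos y q).
  set (u := Rpower y p) in *. set (v := (1 + Rpower y q) ^ 2) in *.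
  assert (Hv : 0 < v) by (apply pow_lt; lra).
  apply Rmult_le_reg_r with (u * v); [nra|].
  replace (5 * A * / u / v * (u * v)) with (5 * A) by (field; lra).
  assert (Hab : Rabs (2 * y ^ 2 - 3 * y) <= 5 * (1 + y) ^ 2) by (apply Rabs_le_between; nra).
  apply Rle_trans with (5 * ((1 + y) ^ 2 * u * v * exp (- y))); [|lra].
  replace (5 * ((1 + y) ^ 2 * u * v * exp (- y)))
    with (5 * (1 + y) ^ 2 * (exp (- y) * (u * v))) by ring.
  rewrite Rmult_assoc. apply Rmult_le_compat_r; [|exact Hab].
  apply Rmult_le_pos; nra.
Qed.

(** Termwise integration. The exponent [p] lies strictly between [1/2] and [Re s / 2]:
    the bound [y^(-p)] on a term makes the integrals summable in [k], and what is
    left of the power of [x] is still integrable at zero. When the factor in front of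
    zeta vanishes the identity holds trivially; otherwise dividing by it shows that
    the Dirichlet series converges. *)
Theorem xi_fun_mellin (s : C) : 1 < Re s ->
  xi_fun s = (RtoC (1 / 2) * s * (s - RtoC 1) * Rcpow PI (- s / RtoC 2)
              * Gamma (s / RtoC 2) * zeta s)%C.
Proof.
  intros Hs. assert (HP := PI_RGT_0). assert (HP3 := PI2_3_2).
  (* The midpoint of [1/2] and [Re s / 2]. *)
  set (p := (Re s / 2 + 1 / 2) / 2). set (q := Re s / 2 - p).
  assert (Hp : 1 / 2 < p) by (unfold p; lra).
  assert (Hq0 : 0 < q) by (unfold q, p; lra).
  destruct (omega_profile_bound p q ltac:(lra) Hq0) as [A [HA HB]].
  set (lam := fun k => PI * INR (S k) ^ 2).
  assert (Hn : forall k, 1 <= INR (S k))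
    by (intros k; change 1 with (INR 1); apply le_INR; lia).
  assert (Hlam : forall k, INR (S k) ^ 2 <= lam k /\ 1 <= lam k).
  { intros k. unfold lam. specialize (Hn k). assert (1 <= INR (S k) ^ 2) by nra. split; nra. }
  set (f := fun k x => (RtoC (omega_profile (lam k * x)) * xi_kernel s x)%C).
  set (m := fun k => A / q * Rpower (INR (S k)) (- (2 * p))).
  destruct (series_RInt_gen (V := C_R_CompleteNormedModule) f
    (fun x => RtoC (omega x) * xi_kernel s x)%C m q) as [_ HS].
  - exact Hq0.
  - apply ex_series_Rscal, ex_series_Rpower. lra.
  - intros x Hx. apply continuous_Cmult; [|now apply continuous_xi_kernel].
    apply continuous_RtoC. now apply continuous_omega.
  - intros k x Hx. apply continuous_Cmult; [|now apply continuous_xi_kernel].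
    apply continuous_RtoC, continuous_of_derivable. unfold omega_profile. auto_derive; auto.
  - intros k x Hx.
    change (@norm R_AbsRing C_R_NormedModule (f k x) <= m k * majorant q x).
    rewrite norm_C_R. unfold f. rewrite Cmod_mult, Cmod_R.
    unfold xi_kernel. rewrite Cmod_Rcpow, C_half_minus_one_Re.
    destruct (Hlam k) as [L1 L2]. specialize (Hn k).
    set (y := lam k * x). assert (Hy : 0 < y) by (unfold y; nra).
    assert (Hxy : x <= y) by (unfold y; nra).
    specialize (HB y Hy).
    assert (E1 : Rpower y (- p) <= Rpower (INR (S k)) (- (2 * p)) * Rpower x (- p)).
    { replace (Rpower (INR (S k)) (- (2 * p))) with (Rpower (INR (S k) ^ 2) (- p)).
      2:{ rewrite <- Rpower_pow by lra. rewrite Rpower_mult. f_equal. simpl. ring. }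
      rewrite Rpower_mult_distr by nra.
      unfold Rpower. apply exp_monotone.
      assert (ln (INR (S k) ^ 2 * x) <= ln y) by (apply ln_le; [apply Rmult_lt_0_compat; nra | apply Rmult_le_compat_r; lra]).
      apply Rmult_le_compat_neg_l; lra. }
    assert (E2 : Rpower x q <= Rpower y q).
    { unfold Rpower. apply exp_monotone. assert (ln x <= ln y) by (apply ln_le; lra).
      apply Rmult_le_compat_l; lra. }
    assert (E3 : Rpower x (Re s / 2 - 1) = Rpower x p * Rpower x (q - 1)).
    { rewrite <- Rpower_plus. f_equal. unfold q. ring. }
    assert (E4 : Rpower x (- p) * Rpower x p = 1).
    { rewrite <- Rpower_plus, Rplus_opp_l. now apply Rpower_O. }
    rewrite E3. unfold m, majorant.
    assert (P1 := Rpower_pos x q).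
    assert (P2 := Rpower_pos x (q - 1)).
    assert (P3 := Rpower_pos x p).
    assert (P4 := Rpower_pos y (- p)).
    assert (P5 := Rpower_pos x (- p)).
    set (N := Rpower (INR (S k)) (- (2 * p))) in *.
    assert (PN : 0 < N) by apply exp_pos.
    assert (E5 : / (1 + Rpower y q) ^ 2 <= / (1 + Rpower x q) ^ 2).
    { apply Rinv_le_contravar; [apply pow_lt; lra|]. apply pow_incr. lra. }
    assert (E6 : 0 < / (1 + Rpower y q) ^ 2) by (apply Rinv_0_lt_compat, pow_lt; lra).
    apply Rle_trans with (A * (N * Rpower x (- p)) * / (1 + Rpower x q) ^ 2
      * (Rpower x p * Rpower x (q - 1))).
    + apply Rmult_le_compat_r; [nra|]. eapply Rle_trans; [exact HB|].
      unfold Rdiv. apply Rmult_le_compat; [nra | lra | | exact E5].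
      apply Rmult_le_compat_l; [lra | exact E1].
    + right.
      transitivity (A * N * (Rpower x (- p) * Rpower x p) * Rpower x (q - 1)
        * / (1 + Rpower x q) ^ 2); [ring|].
      rewrite E4. field. split; [lra|]. lra.
  - intros x Hx. unfold f.
    apply (is_Cseries_ext (fun k => xi_kernel s x * RtoC (omega_profile (lam k * x)))%C);
      [intros k; Ceq; ring|].
    replace (RtoC (omega x) * xi_kernel s x)%C with (xi_kernel s x * RtoC (omega x))%C by ring.
    apply is_Cseries_mult, is_Cseries_RtoC. now apply omega_is_series.
  - change (is_Cseries (fun k => C_RInt (f k)) (xi_fun s)) in HS.
    set (K := (RtoC (1 / 2) * s * (s - RtoC 1) * Rcpow PI (- s / RtoC 2) * Gamma (s / RtoC 2))%C).
    assert (HS' : is_Cseries (fun k => K * Rcpow (INR (S k)) (- s))%C (xi_fun s)).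
    { revert HS. apply is_Cseries_ext. intros k. specialize (Hn k).
      destruct (Hlam k) as [L1 L2].
      etransitivity; [apply C_RInt_unique, mellin_term; lra|].
      unfold lam. rewrite Rcpow_mult_base by nra.
      replace (Rcpow (INR (S k) ^ 2) (- (s / RtoC 2))) with (Rcpow (INR (S k)) (- s)).
      2:{ replace (INR (S k) ^ 2) with (INR (S k) * INR (S k)) by ring.
          rewrite Rcpow_mult_base by lra. rewrite <- Rcpow_plus. f_equal. field. }
      replace (- (s / RtoC 2))%C with (- s / RtoC 2)%C by field.
      unfold K. rewrite RtoC_div by lra. Ceq. field. }
    destruct (Ceq_dec K (RtoC 0)) as [EK|EK].
    + rewrite EK. rewrite Cmult_0_l. rewrite <- (CSeries_unique _ _ HS').
      apply CSeries_unique. rewrite EK.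
      apply (is_Cseries_ext (fun k => RtoC 0 * RtoC 0)%C).
      * intros k. Ceq; ring.
      * apply is_Cseries_norm. apply (is_lim_seq_ext (fun _ => 0)); [|apply is_lim_seq_const].
        intros N. rewrite (Csum_mult (RtoC 0) (fun _ => RtoC 0)).
        replace (RtoC 0 - RtoC 0 * Csum (fun _ => RtoC 0) N)%C with (RtoC 0) by ring.
        symmetry; apply Cmod_0.
    + assert (HZ := is_Cseries_mult (/ K)%C _ _ HS').
      assert (HZ' : is_Cseries (fun k => Rcpow (INR (S k)) (- s)) (/ K * xi_fun s)%C).
      { revert HZ. apply is_Cseries_ext. intros k. Ceq. field. exact EK. }
      unfold zeta. rewrite (CSeries_unique _ _ HZ'). field. exact EK.
Qed.

Theorem xi_fun_is_riemann_xi : is_riemann_xi xi_fun.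
Proof. split; [apply xi_fun_entire | apply xi_fun_mellin]. Qed.

(** * Ballot numbers *)

(** [ballot m n], for [n >= 0], is the coefficient of the Chebyshev polynomial [U_n]
    in [y^m]: since [2 y U_n = U_(n+1) + U_(n-1)] it is a simple random walk killed at
    -1. The killing is implemented by reflection, starting from a unit mass at 0
    and a negative one at -2. *)
Fixpoint ballot (m : nat) (j : Z) : R :=
  match m with
  | O => if Z.eqb j 0 then 1 else if Z.eqb j (-2) then -1 else 0
  | S m => (ballot m (j - 1) + ballot m (j + 1)) / 2
  end.

Lemma ballot_antisym m j : ballot m (-2 - j) = - ballot m j.
Proof.
  revert j; induction m as [|m IH]; intros j; cbn [ballot].
  - destruct (Z.eqb_spec (-2 - j) 0), (Z.eqb_spec (-2 - j) (-2)), (Z.eqb_spec j 0),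
      (Z.eqb_spec j (-2)); try lia; lra.
  - replace (-2 - j - 1)%Z with (-2 - (j + 1))%Z by lia.
    replace (-2 - j + 1)%Z with (-2 - (j - 1))%Z by lia.
    rewrite !IH. lra.
Qed.

Lemma ballot_m1 m : ballot m (-1) = 0.
Proof.
  assert (H := ballot_antisym m (-1)). change (-2 - -1)%Z with (-1)%Z in H. lra.
Qed.

Lemma ballot_support m j : (Z.of_nat m < j)%Z -> ballot m j = 0.
Proof.
  revert j; induction m as [|m IH]; intros j Hj; simpl.
  - destruct (Z.eqb_spec j 0), (Z.eqb_spec j (-2)); auto; lia.
  - rewrite !IH by lia. lra.
Qed.

Lemma ballot_parity m j : Z.odd (Z.of_nat m + j) = true -> ballot m j = 0.
Proof.
  revert j; induction m as [|m IH]; intros j Hj.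
  - simpl in *. destruct (Z.eqb_spec j 0), (Z.eqb_spec j (-2)); subst; auto; discriminate.
  - simpl. rewrite !IH; [lra| |]; rewrite <- Hj, Nat2Z.inj_succ.
    + now replace (Z.succ (Z.of_nat m) + j)%Z with (Z.of_nat m + (j + 1))%Z by lia.
    + replace (Z.succ (Z.of_nat m) + j)%Z with (Z.of_nat m + (j - 1) + 2 * 1)%Z by lia.
      now rewrite Z.odd_add_mul_2.
Qed.

Lemma ballot_nonneg m j : (-1 <= j)%Z -> 0 <= ballot m j.
Proof.
  revert j; induction m as [|m IH]; intros j Hj.
  - simpl. destruct (Z.eqb_spec j 0), (Z.eqb_spec j (-2)); first [lra | lia].
  - destruct (Z.eq_dec j (-1)) as [->|Hne]; [rewrite ballot_m1; lra|].
    simpl. assert (H1 := IH (j - 1)%Z ltac:(lia)). assert (H2 := IH (j + 1)%Z ltac:(lia)). lra.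
Qed.

(** The exponential [exp (- lam j)] is multiplied by [cosh lam] at each step, and
    [cosh lam <= exp (2 lam^2)] on the unit interval. Killing at -1 only helps. *)
Lemma ballot_chernoff (lam : R) m j : 0 <= lam <= 1 -> (-1 <= j)%Z ->
  ballot m j <= exp (INR m * (2 * lam ^ 2) - lam * IZR j).
Proof.
  intros Hl. revert j; induction m as [|m IH]; intros j Hj.
  - simpl. destruct (Z.eqb_spec j 0) as [->|].
    + replace (0 * (2 * (lam * (lam * 1))) - lam * 0) with 0 by ring. rewrite exp_0; lra.
    + destruct (Z.eqb_spec j (-2)); [lia|]. left; apply exp_pos.
  - destruct (Z.eq_dec j (-1)) as [->|Hne]; [rewrite ballot_m1; left; apply exp_pos|].
    cbn [ballot].
    assert (H1 := IH (j - 1)%Z ltac:(lia)). assert (H2 := IH (j + 1)%Z ltac:(lia)).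
    rewrite minus_IZR in H1. rewrite plus_IZR in H2. rewrite S_INR.
    replace (INR m * (2 * lam ^ 2) - lam * (IZR j - 1)) with ((INR m * (2 * lam ^ 2) - lam * IZR j) + lam)
      in H1 by ring.
    replace (INR m * (2 * lam ^ 2) - lam * (IZR j + 1)) with ((INR m * (2 * lam ^ 2) - lam * IZR j) + - lam)
      in H2 by ring.
    replace ((INR m + 1) * (2 * lam ^ 2) - lam * IZR j) with ((INR m * (2 * lam ^ 2) - lam * IZR j) + 2 * lam ^ 2)
      by ring.
    rewrite exp_plus in *.
    set (E := exp (INR m * (2 * lam ^ 2) - lam * IZR j)) in *.
    assert (HE : 0 < E) by apply exp_pos.
    (* The constant 2 leaves room for the crude bound [exp lam <= (1 - lam/2)^(-2)]. *)
    assert (Hc : exp lam + exp (- lam) <= 2 * exp (2 * lam ^ 2)).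
    { assert (E0 := exp_ineq1_le (2 * lam ^ 2)).
      assert (Em : exp (- lam) <= 1 - lam + lam ^ 2).
      { assert (H := exp_ineq1_le lam). rewrite exp_Ropp.
        apply Rmult_le_reg_r with (exp lam); [apply exp_pos|].
        rewrite Rinv_l by (apply Rgt_not_eq, exp_pos).
        assert (0 < 1 - lam + lam ^ 2) by nra.
        apply Rle_trans with ((1 - lam + lam ^ 2) * (1 + lam)); [nra|].
        apply Rmult_le_compat_l; lra. }
      assert (Ep : exp lam <= 1 + lam + 2 * lam ^ 2).
      { assert (H := exp_ineq1_le (- (lam / 2))).
        assert (Hsq : exp lam = / (exp (- (lam / 2)) * exp (- (lam / 2)))).
        { rewrite <- exp_plus, <- exp_Ropp. f_equal. field. }
        rewrite Hsq.
        assert (Hy : (1 - lam / 2) * (1 - lam / 2) <= exp (- (lam / 2)) * exp (- (lam / 2)))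
          by (apply Rmult_le_compat; lra).
        assert (Hy0 : 0 < (1 - lam / 2) * (1 - lam / 2)) by nra.
        apply Rle_trans with (/ ((1 - lam / 2) * (1 - lam / 2))).
        - apply Rinv_le_contravar; auto.
        - apply Rmult_le_reg_r with ((1 - lam / 2) * (1 - lam / 2)); auto.
          rewrite Rinv_l by lra.
          assert (0 <= lam ^ 2 * ((1 - lam) * (5 / 4 - lam / 2))).
          { apply Rmult_le_pos; [apply pow2_ge_0 | apply Rmult_le_pos; lra]. }
          lra. }
      assert (0 <= lam ^ 2) by apply pow2_ge_0. lra. }
    nra.
Qed.

(** The Chebyshev coefficients of [(1 - y^2) d/dy y^m], computed in two ways. The
    extension to negative [j] by reflection is what makes the induction close. *)
Lemma ballot_absorption m j :
  (INR m + 1 - IZR j) * ballot m (j - 1) + (INR m + IZR j + 3) * ballot m (j + 1)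
  = 2 * INR m * ballot (pred m) j.
Proof.
  revert j; induction m as [|m IH]; intros j.
  - cbn [ballot pred INR].
    destruct (Z.eqb_spec (j - 1) 0), (Z.eqb_spec (j - 1) (-2)), (Z.eqb_spec (j + 1) 0),
      (Z.eqb_spec (j + 1) (-2)); try lia; try lra.
    + replace j with 1%Z by lia. lra.
    + replace j with (-1)%Z by lia. lra.
    + replace j with (-3)%Z by lia. lra.
  - assert (H1 := IH (j - 1)%Z). assert (H2 := IH (j + 1)%Z).
    rewrite S_INR. rewrite minus_IZR in H1. rewrite plus_IZR in H2.
    replace (j - 1 + 1)%Z with j in H1 by lia.
    replace (j + 1 - 1)%Z with j in H2 by lia.
    cbn [pred].
    assert (H3 : 2 * INR m * (ballot (pred m) (j - 1) + ballot (pred m) (j + 1))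
      = 4 * INR m * ballot m j).
    { destruct m as [|m]; [simpl (INR 0); ring|]. cbn [pred ballot]. field. }
    cbn [ballot].
    replace (j - 1 + 1)%Z with j by lia. replace (j + 1 - 1)%Z with j by lia.
    lra.
Qed.

Definition ballot_formula (n k : nat) : R :=
  (1 / 2) ^ (n + 2 * k) * INR (fact (n + 2 * k)) * (INR n + 1)
  / (INR (fact (n + k + 1)) * INR (fact k)).

Lemma INR_fact_S n : INR (fact (S n)) = (INR n + 1) * INR (fact n).
Proof. rewrite fact_simpl, mult_INR, S_INR. reflexivity. Qed.

Lemma INR_fact_pos n : 0 < INR (fact n).
Proof. apply lt_0_INR, lt_O_fact. Qed.

(** Ballot theorem, by checking the recurrence of the walk. *)
Lemma ballot_closed n k : ballot (n + 2 * k) (Z.of_nat n) = ballot_formula n k.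
Proof.
  assert (H : forall m n k, (n + 2 * k = m)%nat -> ballot m (Z.of_nat n) = ballot_formula n k);
    [|now apply H].
  clear n k. induction m as [|m IH]; intros n k Hm.
  - assert (n = 0)%nat by lia. assert (k = 0)%nat by lia. subst.
    unfold ballot_formula. simpl. field.
  - cbn [ballot].
    assert (HA : ballot m (Z.of_nat n - 1) =
      (1 / 2) ^ m * INR (fact m) * INR n / (INR (fact (n + k)) * INR (fact k))).
    { destruct n as [|n].
      - rewrite ballot_m1. simpl (INR 0). field. split; apply Rgt_not_eq, INR_fact_pos.
      - replace (Z.of_nat (S n) - 1)%Z with (Z.of_nat n) by lia.
        rewrite (IH n k) by lia. unfold ballot_formula. rewrite S_INR.
        replace (n + 2 * k)%nat with m by lia. now replace (n + k + 1)%nat with (S n + k)%nat by lia. }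
    assert (HB : ballot m (Z.of_nat n + 1) =
      (1 / 2) ^ m * INR (fact m) * (INR n + 2) * INR k / (INR (fact (n + k + 1)) * INR (fact k))).
    { destruct k as [|k].
      - rewrite ballot_support by lia. simpl (INR 0). field.
        split; apply Rgt_not_eq, INR_fact_pos.
      - replace (Z.of_nat n + 1)%Z with (Z.of_nat (S n)) by lia.
        rewrite (IH (S n) k) by lia. unfold ballot_formula. rewrite S_INR.
        replace (S n + 2 * k)%nat with m by lia.
        replace (S n + k + 1)%nat with (n + S k + 1)%nat by lia.
        rewrite (INR_fact_S k), S_INR.
        assert (H0 := pos_INR k).
        field. repeat split; try (apply Rgt_not_eq, INR_fact_pos); lra. }
    rewrite HA, HB. unfold ballot_formula. rewrite Hm, INR_fact_S.
    replace (n + k + 1)%nat with (S (n + k)) by lia. rewrite (INR_fact_S (n + k)), plus_INR.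
    assert (E : INR m = INR n + 2 * INR k - 1).
    { apply (f_equal INR) in Hm. rewrite plus_INR, mult_INR, (S_INR m) in Hm. simpl (INR 2) in Hm. lra. }
    rewrite E. simpl ((1 / 2) ^ S m).
    assert (H0 := pos_INR k). assert (H1 := pos_INR n).
    field. repeat split; try (apply Rgt_not_eq, INR_fact_pos); lra.
Qed.

(** * Two three-term recurrences *)

Lemma RtoC_neq_0 (x : R) : x <> 0 -> RtoC x <> RtoC 0.
Proof. intros H E. apply H. exact (f_equal Re E). Qed.

(** The pair of consecutive values makes the recurrence structural; its second
    component at the start encodes the value 0 at index -1. *)
Fixpoint three_term_pair (al : C) (be : nat -> R) (n : nat) : C * C :=
  match n with
  | O => (RtoC 1, RtoC 0)
  | S n => let (a, b) := three_term_pair al be n in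
     (((al * a + RtoC (be n) * b) / RtoC (2 * INR n + 3))%C, a)
  end.

Definition three_term (al : C) (be : nat -> R) (n : nat) : C :=
  fst (three_term_pair al be n).

Definition before (v : nat -> C) (n : nat) : C :=
  match n with O => RtoC 0 | S n => v n end.

Lemma three_term_rec al be n :
  (RtoC (2 * INR n + 3) * three_term al be (S n))%C
  = (al * three_term al be n + RtoC (be n) * before (three_term al be) n)%C.
Proof.
  assert (E : snd (three_term_pair al be n) = before (three_term al be) n).
  { destruct n; auto. unfold before, three_term. simpl.
    now destruct (three_term_pair al be n). }
  rewrite <- E. unfold three_term. simpl (three_term_pair al be (S n)).
  destruct (three_term_pair al be n) as [a b]. simpl. field.
  apply RtoC_neq_0. assert (H := pos_INR n). lra.
Qed.

(** With [z = 4 a - 3], the value at [U_n (2t-1)] of the functional [t^k -> (a)_k / (3/2)_k].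
    The recurrence follows from the fact that the functional annihilates
    [t (1-t) p' + (a - 3t/2) p] for every polynomial [p]. *)
Definition hahn (z : C) : nat -> C := three_term (RtoC 2 * z) (fun n => 2 * INR n + 1).

(** The value of the same functional at [(2t-1)^m]. *)
Definition moment (z : C) : nat -> C := three_term z (fun m => 2 * INR m).

Lemma hahn_rec z n :
  (RtoC (2 * INR n + 3) * hahn z (S n))%C
  = (RtoC 2 * z * hahn z n + RtoC (2 * INR n + 1) * before (hahn z) n)%C.
Proof. exact (three_term_rec _ _ n). Qed.

Lemma moment_rec z m :
  (RtoC (2 * INR m + 3) * moment z (S m))%C
  = (z * moment z m + RtoC (2 * INR m) * before (moment z) m)%C.
Proof. exact (three_term_rec _ _ m). Qed.

(** At each step the larger of two consecutive absolute values is multiplied by at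
    most [1 + K/(n+1)], which by Bernoulli's inequality is below the growth of
    [(n+1)^K]. *)
Lemma three_term_growth (al : C) (be : nat -> R) (K : nat) :
  Cmod al <= 2 * INR K -> (forall n, 0 <= be n <= 2 * INR n + 3) ->
  forall n, Cmod (three_term al be n) <= (INR n + 1) ^ K.
Proof.
  intros Hal Hbe. set (v := three_term al be). assert (HK := pos_INR K).
  assert (Hrec : forall n,
    Cmod (v (S n)) <= INR K / (INR n + 1) * Cmod (v n) + Cmod (before v n)).
  { intros n. assert (Hn := pos_INR n). specialize (Hbe n).
    assert (E := f_equal Cmod (three_term_rec al be n)). fold v in E.
    rewrite Cmod_mult, Cmod_R, Rabs_right in E by lra.
    assert (T := Cmod_triangle (al * v n) (RtoC (be n) * before v n)).
    rewrite !Cmod_mult, Cmod_R, (Rabs_right (be n)) in T by lra.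
    assert (P1 := Cmod_ge_0 (v n)). assert (P2 := Cmod_ge_0 (before v n)).
    apply Rmult_le_reg_l with (2 * INR n + 3); [lra|]. rewrite E.
    eapply Rle_trans; [exact T|].
    rewrite Rmult_plus_distr_l. apply Rplus_le_compat; [|apply Rmult_le_compat_r; lra].
    rewrite <- Rmult_assoc. apply Rmult_le_compat_r; auto.
    eapply Rle_trans; [exact Hal|].
    replace ((2 * INR n + 3) * (INR K / (INR n + 1)))
      with (INR K * (2 + / (INR n + 1))) by (field; lra).
    assert (0 < / (INR n + 1)) by (apply Rinv_0_lt_compat; lra). nra. }
  assert (Hstep : forall x, 1 <= x -> x ^ K * (1 + INR K / x) <= (x + 1) ^ K).
  { intros x Hx. replace (x + 1) with (x * (1 + / x)) by (field; lra).
    rewrite Rpow_mult_distr. apply Rmult_le_compat_l; [apply pow_le; lra|].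
    apply poly, Rinv_0_lt_compat; lra. }
  assert (H : forall n, Cmod (v n) <= (INR n + 1) ^ K /\ Cmod (before v n) <= (INR n + 1) ^ K).
  { induction n as [|n [IH1 IH2]].
    - simpl (INR 0). rewrite Rplus_0_l, pow1. unfold v, three_term; simpl.
      rewrite Cmod_1, Cmod_0. lra.
    - assert (Hn := pos_INR n). rewrite S_INR.
      specialize (Hstep (INR n + 1) ltac:(lra)). simpl (before v (S n)).
      set (x := INR n + 1) in *.
      assert (Hk : 0 <= INR K / x)
        by (apply Rmult_le_pos; [lra | left; apply Rinv_0_lt_compat; unfold x; lra]).
      assert (Hm : x ^ K <= (x + 1) ^ K) by (apply pow_incr; unfold x; lra).
      split; [|lra].
      eapply Rle_trans; [apply Hrec|]. fold x.
      assert (INR K / x * Cmod (v n) <= INR K / x * x ^ K) by (apply Rmult_le_compat_l; auto).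
      lra. }
  apply H.
Qed.

Lemma hahn_growth (z : C) (K : nat) : Cmod z <= INR K ->
  forall n, Cmod (hahn z n) <= (INR n + 1) ^ K.
Proof.
  intros Hz. apply three_term_growth.
  - rewrite Cmod_mult, Cmod_R, Rabs_right by lra. lra.
  - intros n. assert (H := pos_INR n). lra.
Qed.

Lemma moment_growth (z : C) (K : nat) : Cmod z <= INR K ->
  forall n, Cmod (moment z n) <= (INR n + 1) ^ K.
Proof.
  intros Hz. apply three_term_growth.
  - assert (H := pos_INR K). lra.
  - intros n. assert (H := pos_INR n). lra.
Qed.

Lemma Csum_plus (a b : nat -> C) N : Csum (fun k => a k + b k)%C N = (Csum a N + Csum b N)%C.
Proof. exact (sum_n_plus (G := C_R_NormedModule) a b N). Qed.

(** Summation by parts: the recurrence of [hahn] replaces multiplication by [z] with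
    shifts of the index, which are moved to the coefficients. *)
Lemma shift_sums (z : C) (a : Z -> R) (N : nat) : a (-1)%Z = 0 ->
  Csum (fun n => RtoC (a (Z.of_nat n)) * (RtoC 2 * z * hahn z n))%C N =
  (Csum (fun n => RtoC ((2 * INR n + 1) * a (Z.of_nat n - 1)%Z
       - (2 * INR n + 3) * a (Z.of_nat n + 1)%Z) * hahn z n) N
   + RtoC (a (Z.of_nat N) * (2 * INR N + 3)) * hahn z (S N)
   + RtoC (a (Z.of_nat N + 1)%Z * (2 * INR N + 3)) * hahn z N)%C.
Proof.
  intros Ha. induction N as [|N IH].
  - rewrite !Csum_O. assert (H := hahn_rec z 0). simpl before in H.
    replace (RtoC 2 * z * hahn z 0)%C with (RtoC (2 * INR 0 + 3) * hahn z 1)%C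
      by (rewrite H; ring).
    change (Z.of_nat 0 - 1)%Z with (-1)%Z. rewrite Ha.
    rewrite ?RtoC_minus, ?RtoC_mult, ?RtoC_plus, ?RtoC_mult. Ceq; ring.
  - rewrite !Csum_S, IH. assert (H := hahn_rec z (S N)). simpl before in H.
    replace (RtoC 2 * z * hahn z (S N))%C with
      (RtoC (2 * INR (S N) + 3) * hahn z (S (S N)) - RtoC (2 * INR (S N) + 1) * hahn z N)%C
      by (rewrite H; ring).
    replace (Z.of_nat (S N) - 1)%Z with (Z.of_nat N) by lia.
    replace (Z.of_nat N + 1)%Z with (Z.of_nat (S N)) by lia.
    rewrite !S_INR.
    rewrite ?RtoC_minus, ?RtoC_mult, ?RtoC_plus, ?RtoC_mult, ?RtoC_plus. Ceq; ring.
Qed.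

(** This is [y^m] expanded in Chebyshev polynomials, under the functional. The proof
    shows that the right side satisfies the recurrence of [moment]; the required
    identity between coefficients is [ballot_absorption]. *)
Lemma moment_expansion (z : C) (N m : nat) : (m <= N)%nat ->
  moment z m = Csum (fun n => RtoC (ballot m (Z.of_nat n)) * hahn z n)%C N.
Proof.
  revert m.
  set (S_ m := Csum (fun n => RtoC (ballot m (Z.of_nat n)) * hahn z n)%C N).
  assert (H0 : S_ 0%nat = RtoC 1).
  { unfold S_. clear. induction N as [|N IH].
    - rewrite Csum_O. unfold hahn, three_term; simpl. Ceq; ring.
    - rewrite Csum_S, IH. rewrite ballot_support by lia. Ceq; ring. }
  assert (Hrec : forall m, (m < N)%nat ->
    (RtoC (2 * INR m + 3) * S_ (S m))%C = (z * S_ m + RtoC (2 * INR m) * S_ (pred m))%C).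
  { intros m Hm. unfold S_. rewrite <- !Csum_mult, <- Csum_plus.
    assert (H := shift_sums z (ballot m) N (ballot_m1 m)).
    rewrite !ballot_support in H by lia.
    assert (Hz : (RtoC 2 * Csum (fun k => z * (RtoC (ballot m (Z.of_nat k)) * hahn z k)) N)%C =
      Csum (fun n => RtoC ((2 * INR n + 1) * ballot m (Z.of_nat n - 1)%Z
       - (2 * INR n + 3) * ballot m (Z.of_nat n + 1)%Z) * hahn z n)%C N).
    { rewrite <- Csum_mult.
      etransitivity; [|etransitivity; [exact H|]].
      - apply Csum_ext. intros k. Ceq; ring.
      - rewrite !Rmult_0_l. Ceq; ring. }
    rewrite Csum_plus.
    assert (Hz' : Csum (fun k => z * (RtoC (ballot m (Z.of_nat k)) * hahn z k))%C N =
      Csum (fun n => RtoC (/ 2 * ((2 * INR n + 1) * ballot m (Z.of_nat n - 1)%Z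
       - (2 * INR n + 3) * ballot m (Z.of_nat n + 1)%Z)) * hahn z n)%C N).
    { transitivity (RtoC (/ 2) * (RtoC 2 * Csum (fun k => z * (RtoC (ballot m (Z.of_nat k)) * hahn z k)) N))%C.
      - rewrite RtoC_inv by lra. Ceq. field.
      - rewrite Hz, <- Csum_mult. apply Csum_ext. intros k. rewrite (RtoC_mult (/ 2)). Ceq; ring. }
    rewrite Hz', <- Csum_plus. apply Csum_ext. intros n.
    assert (HA := ballot_absorption m (Z.of_nat n)). rewrite <- INR_IZR_INZ in HA.
    transitivity (RtoC ((2 * INR m + 3) * ballot (S m) (Z.of_nat n)) * hahn z n)%C.
    { rewrite RtoC_mult. Ceq; ring. }
    transitivity (RtoC (/ 2 * ((2 * INR n + 1) * ballot m (Z.of_nat n - 1) -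
          (2 * INR n + 3) * ballot m (Z.of_nat n + 1)) + 2 * INR m * ballot (pred m) (Z.of_nat n))
       * hahn z n)%C.
    2:{ rewrite RtoC_plus, (RtoC_mult (2 * INR m)). Ceq; ring. }
    apply (f_equal (fun x => (RtoC x * hahn z n)%C)).
    rewrite <- HA. cbn [ballot]. field. }
  assert (Hind : forall m, (m <= N)%nat -> moment z m = S_ m /\
     ((0 < m)%nat -> before (moment z) m = S_ (pred m))).
  { induction m as [|m IH]; intros Hm.
    - split; [now rewrite H0 | lia].
    - destruct (IH ltac:(lia)) as [I1 I2]. split; [|intros _; exact I1].
      assert (Hne : RtoC (2 * INR m + 3) <> RtoC 0)
        by (apply RtoC_neq_0; assert (H := pos_INR m); lra).
      assert (E : (RtoC (2 * INR m + 3) * moment z (S m))%C = (RtoC (2 * INR m + 3) * S_ (S m))%C).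
      { rewrite moment_rec, Hrec, I1 by lia. destruct m as [|m].
        - simpl (INR 0). rewrite Rmult_0_r. Ceq; ring.
        - rewrite I2 by lia. reflexivity. }
      transitivity (/ RtoC (2 * INR m + 3) * (RtoC (2 * INR m + 3) * moment z (S m)))%C;
        [Ceq; field; exact Hne|].
      rewrite E. Ceq; field; exact Hne. }
  intros m Hm. now apply Hind.
Qed.

(** * The continuous Hahn polynomials *)

Ltac rtoc :=
  repeat (rewrite RtoC_plus || rewrite RtoC_minus || rewrite RtoC_mult || rewrite RtoC_opp).

(** With [w = n+1], up to sign and factorials the coefficient of [t^k] in [U_n (2t-1)].
    As a polynomial in [w] it makes sense beyond the degree, where it vanishes. *)
Fixpoint central_product (w : R) (k : nat) : R :=
  match k with
  | O => w
  | S k => central_product w k * ((INR k + 1) ^ 2 - w ^ 2)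
  end.

Lemma central_product_succ w k : central_product (w + 1) (S k) = - central_product w k * (w + INR k + 1) * (w + INR k + 2).
Proof.
  induction k as [|k IH]; [simpl; ring|].
  change (central_product (w + 1) (S (S k)))
    with (central_product (w + 1) (S k) * ((INR (S k) + 1) ^ 2 - (w + 1) ^ 2)).
  rewrite IH, S_INR. simpl central_product. ring.
Qed.

Lemma central_product_pred w k : central_product (w - 1) (S k) = - central_product w k * (w - INR k - 1) * (w - INR k - 2).
Proof.
  induction k as [|k IH]; [simpl; ring|].
  change (central_product (w - 1) (S (S k)))
    with (central_product (w - 1) (S k) * ((INR (S k) + 1) ^ 2 - (w - 1) ^ 2)).
  rewrite IH, S_INR. simpl central_product. ring.
Qed.

Lemma poch_pos a k : 0 < a -> 0 < poch a k.
Proof.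
  intros Ha. induction k as [|k IH]; simpl; [lra|].
  apply Rmult_lt_0_compat; auto. assert (H := pos_INR k). lra.
Qed.

Definition hahn_coef (w : R) (k : nat) : R := central_product w k / (poch (3 / 2) k * INR (fact k)).

(** The relation that the annihilation property of the functional imposes on the
    coefficients of three consecutive Chebyshev polynomials. *)
Lemma hahn_coef_relation w k :
  (2 * w + 1) * hahn_coef (w + 1) (S k) - (2 * w - 1) * hahn_coef (w - 1) (S k)
  - 6 * hahn_coef w (S k) - 8 * (INR k + 1) * hahn_coef w (S k) + 8 * (INR k + 3 / 2) * hahn_coef w k = 0.
Proof.
  unfold hahn_coef. rewrite central_product_succ, central_product_pred, INR_fact_S. simpl (central_product w (S k)).
  simpl (poch (3 / 2) (S k)).
  assert (H1 := poch_pos (3 / 2) k ltac:(lra)). assert (H2 := INR_fact_pos k).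
  assert (H3 := pos_INR k). field. lra.
Qed.

Lemma hahn_coef_relation_0 w :
  (2 * w + 1) * hahn_coef (w + 1) 0 - (2 * w - 1) * hahn_coef (w - 1) 0 - 6 * hahn_coef w 0 = 0.
Proof. unfold hahn_coef; simpl. field. Qed.

Definition poch_quotient (a : C) (k : nat) : C := (Cpoch a k / RtoC (poch (3 / 2) k))%C.

(** The only property of the parameter [a] that enters: it converts a factor [a] into
    a shift of [k]. *)
Lemma poch_quotient_rec a k :
  (a * poch_quotient a k)%C = (RtoC (INR k + 3 / 2) * poch_quotient a (S k) - RtoC (INR k) * poch_quotient a k)%C.
Proof.
  unfold poch_quotient. simpl Cpoch. simpl poch.
  assert (H1 := poch_pos (3 / 2) k ltac:(lra)). assert (H3 := pos_INR k).
  replace (INR k + 3 / 2) with (3 / 2 + INR k) by ring.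
  rewrite RtoC_mult. field. split; apply RtoC_neq_0; lra.
Qed.

Definition hahn_sum (a : C) (K : nat) (w : R) : C :=
  Csum (fun k => RtoC (hahn_coef w k) * poch_quotient a k)%C K.

(** The partial sums telescope; at a [K] beyond the degree the right side vanishes and
    the three-term recurrence remains. *)
Lemma hahn_sum_rec (a : C) (w : R) (K : nat) :
  (RtoC (2 * w + 1) * hahn_sum a K (w + 1) - RtoC (2 * w - 1) * hahn_sum a K (w - 1)
   + (RtoC 8 * a - RtoC 6) * hahn_sum a K w)%C
  = (RtoC (8 * (INR K + 3 / 2) * hahn_coef w K) * poch_quotient a (S K))%C.
Proof.
  induction K as [|K IH].
  - unfold hahn_sum. rewrite !Csum_O.
    transitivity (RtoC ((2 * w + 1) * hahn_coef (w + 1) 0 - (2 * w - 1) * hahn_coef (w - 1) 0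
       - 6 * hahn_coef w 0) * poch_quotient a 0 + RtoC (8 * hahn_coef w 0) * (a * poch_quotient a 0))%C.
    { rtoc; ring. }
    rewrite hahn_coef_relation_0, poch_quotient_rec. simpl (INR 0).
    rtoc; ring.
  - unfold hahn_sum in *. rewrite !Csum_S.
    transitivity ((RtoC (2 * w + 1) * Csum (fun k => RtoC (hahn_coef (w + 1) k) * poch_quotient a k) K -
       RtoC (2 * w - 1) * Csum (fun k => RtoC (hahn_coef (w - 1) k) * poch_quotient a k) K +
       (RtoC 8 * a - RtoC 6) * Csum (fun k => RtoC (hahn_coef w k) * poch_quotient a k) K)
      + RtoC ((2 * w + 1) * hahn_coef (w + 1) (S K) - (2 * w - 1) * hahn_coef (w - 1) (S K)
       - 6 * hahn_coef w (S K)) * poch_quotient a (S K) + RtoC (8 * hahn_coef w (S K)) * (a * poch_quotient a (S K)))%C.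
    { rtoc; ring. }
    rewrite IH, poch_quotient_rec.
    transitivity (RtoC ((2 * w + 1) * hahn_coef (w + 1) (S K) - (2 * w - 1) * hahn_coef (w - 1) (S K)
        - 6 * hahn_coef w (S K) - 8 * (INR K + 1) * hahn_coef w (S K) + 8 * (INR K + 3 / 2) * hahn_coef w K)
        * poch_quotient a (S K) + RtoC (8 * (INR (S K) + 3 / 2) * hahn_coef w (S K)) * poch_quotient a (S (S K)))%C.
    { rewrite (S_INR K).
      rtoc; ring. }
    rewrite hahn_coef_relation. ring.
Qed.

Lemma central_product_zero (n k : nat) : (n < k)%nat -> central_product (INR n + 1) k = 0.
Proof.
  intros H. induction H as [|k Hk IH]; simpl.
  - ring.
  - rewrite IH. ring.
Qed.

Lemma central_product_0 k : central_product 0 k = 0.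
Proof. induction k as [|k IH]; simpl; auto. rewrite IH; ring. Qed.

Lemma hahn_hahn_sum (a : C) (K n : nat) : (n <= K)%nat ->
  hahn (RtoC 4 * a - RtoC 3)%C n = (RtoC ((-1) ^ n) * hahn_sum a K (INR n + 1))%C.
Proof.
  set (z := (RtoC 4 * a - RtoC 3)%C).
  assert (H0 : hahn_sum a K 0 = RtoC 0).
  { unfold hahn_sum. clear. induction K as [|K IH].
    - rewrite Csum_O. unfold hahn_coef; simpl.
      replace (0 / (1 * 1)) with 0 by field. ring.
    - rewrite Csum_S, IH. unfold hahn_coef. rewrite central_product_0. unfold Rdiv. rewrite Rmult_0_l. ring. }
  assert (H1 : hahn_sum a K 1 = RtoC 1).
  { unfold hahn_sum. clear. induction K as [|K IH].
    - rewrite Csum_O. unfold hahn_coef, poch_quotient; simpl.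
      replace (1 / (1 * 1)) with 1 by field. field.
    - rewrite Csum_S, IH. unfold hahn_coef.
      replace 1 with (INR 0 + 1) at 2 by (simpl; ring). rewrite central_product_zero by lia.
      unfold Rdiv. rewrite Rmult_0_l. ring. }
  assert (H : forall n, (n <= K)%nat ->
    hahn z n = (RtoC ((-1) ^ n) * hahn_sum a K (INR n + 1))%C /\
    before (hahn z) n = (- RtoC ((-1) ^ n) * hahn_sum a K (INR n))%C).
  { clear n. induction n as [|n IH]; intros Hn.
    - simpl (INR 0). rewrite Rplus_0_l, H0, H1. unfold hahn, three_term; simpl. split; ring.
    - destruct (IH ltac:(lia)) as [I1 I2]. split.
      2:{ simpl before. rewrite I1, S_INR. simpl ((-1) ^ S n). rewrite RtoC_mult.
          replace (RtoC (-1)) with (- RtoC 1)%C by (rewrite <- RtoC_opp; f_equal; lra). ring. }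
      assert (R := hahn_sum_rec a (INR n + 1) K).
      replace (hahn_coef (INR n + 1) K) with 0 in R
        by (unfold hahn_coef; rewrite central_product_zero by lia; unfold Rdiv; ring).
      replace (INR n + 1 - 1) with (INR n) in R by ring.
      replace (2 * (INR n + 1) + 1) with (2 * INR n + 3) in R by ring.
      replace (2 * (INR n + 1) - 1) with (2 * INR n + 1) in R by ring.
      rewrite Rmult_0_r in R.
      assert (Hr := hahn_rec z n). rewrite I1, I2 in Hr.
      rewrite S_INR. simpl ((-1) ^ S n). rewrite RtoC_mult.
      replace (RtoC (-1)) with (- RtoC 1)%C by (rewrite <- RtoC_opp; f_equal; lra).
      assert (Hne : RtoC (2 * INR n + 3) <> RtoC 0)
        by (apply RtoC_neq_0; assert (Hp := pos_INR n); lra).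
      transitivity (/ RtoC (2 * INR n + 3) * (RtoC (2 * INR n + 3) * hahn z (S n)))%C;
        [field; exact Hne|].
      rewrite Hr.
      transitivity (/ RtoC (2 * INR n + 3) * (RtoC ((-1) ^ n) *
        ((RtoC 8 * a - RtoC 6) * hahn_sum a K (INR n + 1) - RtoC (2 * INR n + 1) * hahn_sum a K (INR n))))%C.
      { unfold z. replace (RtoC 8) with (RtoC 2 * RtoC 4)%C by (rewrite <- RtoC_mult; f_equal; lra).
        replace (RtoC 6) with (RtoC 2 * RtoC 3)%C by (rewrite <- RtoC_mult; f_equal; lra). ring. }
      replace ((RtoC 8 * a - RtoC 6) * hahn_sum a K (INR n + 1) - RtoC (2 * INR n + 1) * hahn_sum a K (INR n))%C
        with (- RtoC (2 * INR n + 3) * hahn_sum a K (INR n + 1 + 1))%C.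
      2:{ transitivity ((RtoC (2 * INR n + 3) * hahn_sum a K (INR n + 1 + 1) -
            RtoC (2 * INR n + 1) * hahn_sum a K (INR n) + (RtoC 8 * a - RtoC 6) * hahn_sum a K (INR n + 1))
            - RtoC (2 * INR n + 3) * hahn_sum a K (INR n + 1 + 1)
            - RtoC (2 * INR n + 3) * hahn_sum a K (INR n + 1 + 1)
            + RtoC (2 * INR n + 3) * hahn_sum a K (INR n + 1 + 1))%C.
          - rewrite R. ring.
          - ring. }
      field. exact Hne. }
  intros Hn. now apply H.
Qed.

Lemma Cpoch_RtoC (a : R) k : Cpoch (RtoC a) k = RtoC (poch a k).
Proof.
  induction k as [|k IH]; simpl; auto. rewrite IH, RtoC_mult, RtoC_plus. reflexivity.
Qed.

Lemma central_product_poch (n k : nat) :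
  (INR n + 1) * (poch (- INR n) k * poch (INR n + 2) k) = central_product (INR n + 1) k.
Proof.
  induction k as [|k IH]; simpl; [ring|]. rewrite <- IH. ring.
Qed.

Lemma is_Cseries_finite (a : nat -> C) (N : nat) :
  (forall k, (N < k)%nat -> a k = RtoC 0) -> is_Cseries a (Csum a N).
Proof.
  intros H. apply is_Cseries_norm.
  apply (is_lim_seq_ext_loc (fun _ => 0)); [|apply is_lim_seq_const].
  exists N. intros n Hn.
  assert (E : Csum a n = Csum a N).
  { induction Hn as [|n Hn IH]; auto. rewrite Csum_S, IH, H by lia. ring. }
  rewrite E. replace (Csum a N - Csum a N)%C with (RtoC 0) by ring. symmetry; apply Cmod_0.
Qed.

(** The terms of index above [n] vanish with [(-n)_k], so the series is the finite sum
    [hahn_sum]. *)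
Lemma hyp3F2_hahn (a : C) (n : nat) :
  (RtoC (INR n + 1) * hyp3F2 (RtoC (- INR n)) (RtoC (INR n + 2)) a
     (RtoC (3 / 2)) (RtoC (3 / 2)) (RtoC 1))%C
  = (RtoC ((-1) ^ n) * hahn (RtoC 4 * a - RtoC 3) n)%C.
Proof.
  rewrite (hahn_hahn_sum a n n (le_n _)).
  assert (Hsq : (RtoC ((-1) ^ n) * RtoC ((-1) ^ n))%C = RtoC 1).
  { rewrite <- RtoC_mult, <- Rpow_mult_distr. f_equal.
    replace (-1 * -1) with 1 by ring. apply pow1. }
  rewrite Cmult_assoc, Hsq, Cmult_1_l.
  unfold hyp3F2.
  set (term := fun k => (RtoC (poch (- INR n) k * poch (INR n + 2) k /
     (poch (3 / 2) k * INR (fact k))) * poch_quotient a k)%C).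
  assert (E : forall k, (Cpoch (RtoC (- INR n)) k * Cpoch (RtoC (INR n + 2)) k * Cpoch a k /
      (Cpoch (RtoC (3 / 2)) k * Cpoch (RtoC (3 / 2)) k * RtoC (INR (fact k))) * RtoC 1 ^ k)%C = term k).
  { intros k. unfold term, poch_quotient. rewrite !Cpoch_RtoC.
    assert (H1 := poch_pos (3 / 2) k ltac:(lra)). assert (H2 := INR_fact_pos k).
    rewrite <- RtoC_pow, pow1, RtoC_div, !RtoC_mult by nra.
    field. split; apply RtoC_neq_0; lra. }
  assert (Hz : forall k, (n < k)%nat -> term k = RtoC 0).
  { intros k Hk. unfold term. assert (H := central_product_poch n k). rewrite central_product_zero in H by auto.
    assert (Hn := pos_INR n).
    replace (poch (- INR n) k * poch (INR n + 2) k) with 0.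
    - unfold Rdiv; rewrite Rmult_0_l; ring.
    - symmetry. apply Rmult_eq_reg_l with (INR n + 1); lra. }
  rewrite (CSeries_unique _ (Csum term n)).
  - unfold hahn_sum. rewrite <- Csum_mult. apply Csum_ext. intros k. unfold term, hahn_coef.
    rewrite <- central_product_poch. rewrite Cmult_assoc, <- RtoC_mult. do 2 f_equal.
    unfold Rdiv. ring.
  - apply (is_Cseries_ext term); [intros k; now rewrite E|]. now apply is_Cseries_finite.
Qed.

Lemma Ci_pow_even (n : nat) : (Ci ^ (2 * n))%C = RtoC ((-1) ^ n).
Proof.
  induction n as [|n IH]; [reflexivity|].
  replace (2 * S n)%nat with (S (S (2 * n))) by lia. simpl (Ci ^ S (S (2 * n)))%C.
  change (2 * n)%nat with (n + (n + 0))%nat in *. simpl in *. rewrite IH.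
  rewrite RtoC_mult. rewrite Cmult_assoc. f_equal.
  apply C_ext; simpl; ring.
Qed.

(** All signs cancel: [i^(2n)] is [(-1)^n], and the sign in [hyp3F2_hahn] is that of an
    even index. *)
Lemma g_even_hahn (t : C) (n : nat) :
  (RtoC ((-1) ^ n) * g (2 * n) (t / RtoC 2))%C = hahn (RtoC 2 * Ci * t) (2 * n).
Proof.
  unfold g. rewrite Ci_pow_even, <- Cmult_assoc, hyp3F2_hahn.
  rewrite (pow_mult (-1) 2 n). replace ((-1) ^ 2) with 1 by ring. rewrite pow1.
  rewrite !Cmult_assoc, <- RtoC_mult, <- Rpow_mult_distr.
  replace (-1 * -1) with 1 by ring. rewrite pow1, !Cmult_1_l.
  f_equal. unfold Cdiv. rewrite RtoC_div by lra.
  replace (RtoC 3) with (RtoC 4 * (RtoC 3 / RtoC 4))%C by (field; apply RtoC_neq_0; lra).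
  replace (RtoC 4) with (RtoC 2 * RtoC 2)%C by (rewrite <- RtoC_mult; f_equal; lra).
  field.
Qed.

(** * The Mellin kernel as a power series *)

Definition poch_ratio (m : nat) : R := poch (3 / 2) m / INR (fact m).

Lemma poch_ratio_S m : (INR m + 1) * poch_ratio (S m) = (INR m + 3 / 2) * poch_ratio m.
Proof.
  unfold poch_ratio. rewrite INR_fact_S. simpl poch.
  assert (H := INR_fact_pos m). assert (H0 := pos_INR m). field. lra.
Qed.

Lemma poch_ratio_bounds m : 0 < poch_ratio m <= INR m + 1.
Proof.
  induction m as [|m IH].
  - unfold poch_ratio; simpl. lra.
  - assert (E := poch_ratio_S m). assert (H0 := pos_INR m). rewrite S_INR.
    assert (E' : poch_ratio (S m) = (INR m + 3 / 2) * poch_ratio m / (INR m + 1)) by (rewrite <- E; field; lra).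
    rewrite E'. split.
    + apply Rdiv_lt_0_compat; nra.
    + apply Rmult_le_reg_r with (INR m + 1); [lra|].
      replace ((INR m + 3 / 2) * poch_ratio m / (INR m + 1) * (INR m + 1))
        with ((INR m + 3 / 2) * poch_ratio m) by (field; lra). nra.
Qed.

(** Coefficients of polynomial growth give radius of convergence at least one. *)
Lemma CV_radius_poly_growth (a : nat -> R) (N : nat) (x : R) :
  (forall m, Rabs (a m) <= (INR m + 1) ^ N) -> Rabs x < 1 ->
  Rbar_lt (Rabs x) (CV_radius a).
Proof.
  intros Ha Hx. assert (H0 := Rabs_pos x).
  set (r := (1 + Rabs x) / 2). assert (Hr : Rabs x < r < 1) by (unfold r; lra).
  apply Rbar_lt_le_trans with (Finite r); [simpl; lra|].
  apply CV_radius_bounded.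
  assert (Hc : 0 < - ln r) by (assert (H := ln_increasing r 1 ltac:(lra) ltac:(lra)); rewrite ln_1 in H; lra).
  destruct (pow_exp_bound N (- ln r) Hc) as [A [HA H]].
  exists (A * / r). intros n. rewrite Rabs_mult, (Rabs_right (r ^ n)) by (apply Rle_ge, pow_le; lra).
  specialize (H (INR n + 1) ltac:(assert (Hn := pos_INR n); lra)).
  replace (- (- ln r * (INR n + 1))) with (INR (S n) * ln r) in H by (rewrite S_INR; ring).
  rewrite exp_ln_pow in H by lra. simpl pow in H.
  apply Rle_trans with ((INR n + 1) ^ N * r ^ n).
  - apply Rmult_le_compat_r; [apply pow_le; lra | apply Ha].
  - apply Rmult_le_reg_r with r; [lra|].
    replace (A * / r * r) with A by (field; lra). lra.
Qed.

Section Kernel.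

Variable a : C.
Let z : C := (RtoC 4 * a - RtoC 3)%C.

Definition kernel_coef (m : nat) : C := (RtoC (poch_ratio m) * moment z m)%C.
(** The coefficient form of the differential equation
    [(1 - u^2) F' = (z/2 + 3u/2) F]. *)
Lemma kernel_coef_rec m :
  (RtoC (INR m + 1) * kernel_coef (S m))%C
  = (RtoC (/ 2) * z * kernel_coef m + RtoC (INR m + 1 / 2) * before kernel_coef m)%C.
Proof.
  unfold kernel_coef at 1.
  transitivity (RtoC ((INR m + 1) * poch_ratio (S m)) * moment z (S m))%C; [rtoc; ring|].
  rewrite poch_ratio_S.
  transitivity (RtoC (/ 2 * poch_ratio m) * (RtoC (2 * INR m + 3) * moment z (S m)))%C.
  { replace ((INR m + 3 / 2) * poch_ratio m) with (/ 2 * poch_ratio m * (2 * INR m + 3)) by field.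
    rewrite (RtoC_mult (/ 2 * poch_ratio m)). ring. }
  rewrite moment_rec. destruct m as [|m].
  - simpl before. unfold kernel_coef. rtoc. ring.
  - simpl before. unfold kernel_coef.
    assert (E := poch_ratio_S m).
    transitivity (RtoC (/ 2) * z * (RtoC (poch_ratio (S m)) * moment z (S m)) +
      RtoC ((INR m + 1) * poch_ratio (S m)) * moment z m)%C.
    { rewrite S_INR. replace ((INR m + 1) * poch_ratio (S m))
        with (/ 2 * poch_ratio (S m) * (2 * (INR m + 1))) by field. rtoc. ring. }
    rewrite E, S_INR. replace (INR m + 1 + 1 / 2) with (INR m + 3 / 2) by field. rtoc; ring.
Qed.

Lemma kernel_coef_growth : exists N, forall m, Cmod (kernel_coef m) <= (INR m + 1) ^ N.
Proof.
  destruct (nat_above (Cmod z)) as [K HK]. exists (S K). intros m.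
  unfold kernel_coef. rewrite Cmod_mult, Cmod_R. destruct (poch_ratio_bounds m) as [B1 B2].
  rewrite Rabs_right by lra. simpl pow.
  apply Rmult_le_compat; [lra | apply Cmod_ge_0 | lra | now apply moment_growth].
Qed.

(** Stated with an arbitrary source [b] because the real and imaginary parts of the
    equation are coupled through it. *)
Lemma pseries_ode (p b : nat -> R) (u : R) :
  (forall m, (INR m + 1) * p (S m) =
     b m + (INR m + 1 / 2) * match m with O => 0 | S m => p m end) ->
  ex_pseries p u -> ex_pseries b u -> ex_pseries (PS_derive p) u ->
  (1 - u ^ 2) * PSeries (PS_derive p) u = PSeries b u + 3 / 2 * u * PSeries p u.
Proof.
  intros Hrec Hp Hb Hd.
  assert (E : forall m, PS_derive p m =
    PS_plus (PS_plus b (PS_scal (3 / 2) (PS_incr_1 p))) (PS_incr_1 (PS_incr_1 (PS_derive p))) m).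
  { intros m.
    assert (Hm : PS_derive p m = b m + (INR m + 1 / 2) * match m with O => 0 | S m => p m end)
      by (unfold PS_derive; rewrite S_INR; apply Hrec).
    rewrite Hm. destruct m as [|[|m]].
    - change (b 0%nat + (INR 0 + 1 / 2) * 0 = b 0%nat + 3 / 2 * 0 + 0). ring.
    - change (b 1%nat + (INR 1 + 1 / 2) * p 0%nat = b 1%nat + 3 / 2 * p 0%nat + 0).
      simpl (INR 1). field.
    - change (b (S (S m)) + (INR (S (S m)) + 1 / 2) * p (S m)
        = b (S (S m)) + 3 / 2 * p (S m) + INR (S m) * p (S m)).
      rewrite (S_INR (S m)). field. }
  assert (I1 : ex_pseries (PS_incr_1 p) u) by now apply (ex_pseries_incr_1 (V := R_NormedModule)).
  assert (I2 : ex_pseries (PS_incr_1 (PS_incr_1 (PS_derive p))) u)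
    by (now do 2 apply (ex_pseries_incr_1 (V := R_NormedModule))).
  assert (I3 : ex_pseries (PS_scal (3 / 2) (PS_incr_1 p)) u)
    by (apply (ex_pseries_scal (V := R_NormedModule)); auto; apply Rmult_comm).
  assert (ED : PSeries (PS_derive p) u =
    PSeries b u + 3 / 2 * (u * PSeries p u) + u * (u * PSeries (PS_derive p) u)).
  { rewrite (PSeries_ext _ _ u E) at 1.
    rewrite !PSeries_plus, PSeries_scal, !PSeries_incr_1; auto.
    now apply (ex_pseries_plus (V := R_NormedModule)). }
  lra.
Qed.

Let P (u : R) : R := PSeries (fun m => Re (kernel_coef m)) u.
Let Q (u : R) : R := PSeries (fun m => Im (kernel_coef m)) u.

Lemma kernel_coef_radius u : Rabs u < 1 ->
  Rbar_lt (Rabs u) (CV_radius (fun m => Re (kernel_coef m))) /\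
  Rbar_lt (Rabs u) (CV_radius (fun m => Im (kernel_coef m))).
Proof.
  intros Hu. destruct kernel_coef_growth as [N HN].
  split; apply (CV_radius_poly_growth _ N); auto; intros m; (eapply Rle_trans; [|apply HN]).
  - apply re_le_Cmod.
  - apply Im_le_Cmod.
Qed.

Lemma ex_pseries_lin (p q : nat -> R) (c e u : R) :
  ex_pseries p u -> ex_pseries q u ->
  ex_pseries (fun m => c * p m + e * q m) u /\
  PSeries (fun m => c * p m + e * q m) u = c * PSeries p u + e * PSeries q u.
Proof.
  intros Hp Hq0.
  assert (S1 : ex_pseries (PS_scal c p) u)
    by (apply (ex_pseries_scal (V := R_NormedModule)); auto; apply Rmult_comm).
  assert (S2 : ex_pseries (PS_scal e q) u)
    by (apply (ex_pseries_scal (V := R_NormedModule)); auto; apply Rmult_comm).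
  split.
  - exact (ex_pseries_plus (V := R_NormedModule) _ _ _ S1 S2).
  - etransitivity; [exact (PSeries_plus _ _ _ S1 S2)|]. now rewrite !PSeries_scal.
Qed.

Lemma kernel_ode u : Rabs u < 1 ->
  exists P' Q' : R, is_derive P u P' /\ is_derive Q u Q' /\
  (1 - u ^ 2) * P' = (Re z / 2 + 3 / 2 * u) * P u - Im z / 2 * Q u /\
  (1 - u ^ 2) * Q' = (Re z / 2 + 3 / 2 * u) * Q u + Im z / 2 * P u.
Proof.
  intros Hu. destruct (kernel_coef_radius u Hu) as [R1 R2].
  assert (D1 := is_derive_PSeries _ _ R1). assert (D2 := is_derive_PSeries _ _ R2).
  assert (X1 : ex_pseries (fun m => Re (kernel_coef m)) u) by (now apply CV_radius_inside).
  assert (X2 : ex_pseries (fun m => Im (kernel_coef m)) u) by (now apply CV_radius_inside).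
  assert (X3 : ex_pseries (PS_derive (fun m => Re (kernel_coef m))) u)
    by (apply CV_radius_inside; now rewrite CV_radius_derive).
  assert (X4 : ex_pseries (PS_derive (fun m => Im (kernel_coef m))) u)
    by (apply CV_radius_inside; now rewrite CV_radius_derive).
  exists (PSeries (PS_derive (fun m => Re (kernel_coef m))) u),
    (PSeries (PS_derive (fun m => Im (kernel_coef m))) u).
  split; [exact D1|]. split; [exact D2|].
  destruct (ex_pseries_lin _ _ (Re z / 2) (- Im z / 2) u X1 X2) as [L1 L2].
  destruct (ex_pseries_lin _ _ (Re z / 2) (Im z / 2) u X2 X1) as [L3 L4].
  split.
  - rewrite (pseries_ode _ _ u) with (2 := X1) (3 := L1) (4 := X3).
    + rewrite L2. unfold P, Q. field.
    + intros m. assert (H := f_equal Re (kernel_coef_rec m)).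
      destruct m as [|m]; simpl before in H; simpl in H; simpl; lra.
  - rewrite (pseries_ode _ _ u) with (2 := X2) (3 := L3) (4 := X4).
    + rewrite L4. unfold P, Q. field.
    + intros m. assert (H := f_equal Im (kernel_coef_rec m)).
      destruct m as [|m]; simpl before in H; simpl in H; simpl; lra.
Qed.

Definition kexponent (u : R) : C :=
  (a * RtoC (ln (1 - u)) + (RtoC (3 / 2) - a) * RtoC (ln (1 + u)))%C.

(** The product of the power series and of [(1-u)^a (1+u)^(3/2-a)] has derivative
    zero, because the two logarithmic derivatives are opposite; it is 1 at [u = 0]. *)
Lemma kernel_closed u : Rabs u < 1 -> ((P u, Q u) * Cexp (kexponent u))%C = RtoC 1.
Proof.
  intros Hu.
  set (al := fun u => Re a * ln (1 - u) + (3 / 2 - Re a) * ln (1 + u)).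
  set (be := fun u => Im a * ln (1 - u) - Im a * ln (1 + u)).
  set (H1 := fun u => exp (al u) * (P u * cos (be u) - Q u * sin (be u))).
  set (H2 := fun u => exp (al u) * (P u * sin (be u) + Q u * cos (be u))).
  assert (HE : forall u, ((P u, Q u) * Cexp (kexponent u))%C = (H1 u, H2 u)).
  { intros v. unfold Cexp.
    replace (Re (kexponent v)) with (al v) by (unfold al, kexponent, Re, Im; simpl; ring).
    replace (Im (kexponent v)) with (be v) by (unfold be, kexponent, Re, Im; simpl; ring).
    apply C_ext; unfold H1, H2; simpl; ring. }
  assert (HD : forall v, Rabs v < 1 -> is_derive H1 v 0 /\ is_derive H2 v 0).
  { intros v Hv. destruct (kernel_ode v Hv) as [P' [Q' [DP [DQ [OP OQ]]]]].
    apply Rabs_def2 in Hv.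
    assert (Hz1 : Re z = 4 * Re a - 3) by (unfold z, Re, Im; simpl; ring).
    assert (Hz2 : Im z = 4 * Im a) by (unfold z, Re, Im; simpl; ring).
    rewrite Hz1, Hz2 in OP, OQ.
    assert (Hne : 1 - v ^ 2 <> 0) by nra.
    assert (EP : P' = ((((4 * Re a - 3) / 2 + 3 / 2 * v) * P v - 4 * Im a / 2 * Q v)) / (1 - v ^ 2))
      by (rewrite <- OP; field; auto).
    assert (EQ : Q' = ((((4 * Re a - 3) / 2 + 3 / 2 * v) * Q v + 4 * Im a / 2 * P v)) / (1 - v ^ 2))
      by (rewrite <- OQ; field; auto).
    assert (DP' : Derive (fun x : R => P x) v = P') by (apply is_derive_unique, DP).
    assert (DQ' : Derive (fun x : R => Q x) v = Q') by (apply is_derive_unique, DQ).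
    unfold H1, H2, al, be.
    split; (auto_derive; [repeat split; try lra; try (eexists; eassumption)|];
      rewrite DP', DQ', EP, EQ;
      match goal with |- @eq _ ?x ?y => change (@eq R x y) end;
      field; repeat split; lra). }
  assert (HC : forall H : R -> R, (forall v, Rabs v < 1 -> is_derive H v 0) -> H u = H 0).
  { intros H Hd. destruct (Rtotal_order u 0) as [Hlt|[->|Hgt]]; auto.
    - apply (eq_is_derive (V := R_NormedModule) H u 0); auto. intros v Hv. apply Hd.
      apply Rabs_def2 in Hu. apply Rabs_def1; lra.
    - symmetry. apply (eq_is_derive (V := R_NormedModule) H 0 u); auto. intros v Hv. apply Hd.
      apply Rabs_def2 in Hu. apply Rabs_def1; lra. }
  rewrite HE, (HC H1), (HC H2) by (intros v Hv; now apply HD).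
  unfold H1, H2, al, be, P, Q. rewrite !PSeries_0.
  rewrite Rminus_0_r, Rplus_0_r, ln_1.
  replace (Re a * 0 + (3 / 2 - Re a) * 0) with 0 by ring.
  replace (Im a * 0 - Im a * 0) with 0 by ring.
  rewrite exp_0, cos_0, sin_0.
  unfold kernel_coef, poch_ratio, moment, three_term; simpl. apply C_ext; simpl; field.
Qed.

Lemma kernel_is_Cseries u : Rabs u < 1 ->
  is_Cseries (fun m => RtoC (u ^ m) * kernel_coef m)%C (P u, Q u).
Proof.
  intros Hu. destruct (kernel_coef_radius u Hu) as [R1 R2].
  assert (X1 := PSeries_correct _ _ (CV_radius_inside _ _ R1)).
  assert (X2 := PSeries_correct _ _ (CV_radius_inside _ _ R2)).
  apply is_Cseries_norm.
  assert (L : is_lim_seq (fun N =>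
     Rabs (P u - sum_n (fun m => u ^ m * Re (kernel_coef m)) N) +
     Rabs (Q u - sum_n (fun m => u ^ m * Im (kernel_coef m)) N)) 0).
  { assert (Z : forall (f : nat -> R) (l : R), is_lim_seq f l -> is_lim_seq (fun N => Rabs (l - f N)) 0).
    { intros f l Hf.
      replace (Finite 0) with (Rbar_abs (Finite (l - l)))
        by (simpl; f_equal; rewrite Rminus_diag; apply Rabs_R0).
      apply is_lim_seq_abs. apply is_lim_seq_minus'; [apply is_lim_seq_const | exact Hf]. }
    replace (Finite 0) with (Finite (0 + 0)) by (f_equal; ring).
    apply is_lim_seq_plus'; apply Z.
    - revert X1. unfold is_pseries. apply (is_series_ext (V := R_NormedModule)).
      intros n. rewrite pow_n_pow. reflexivity.
    - revert X2. unfold is_pseries. apply (is_series_ext (V := R_NormedModule)).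
      intros n. rewrite pow_n_pow. reflexivity. }
  refine (is_lim_seq_le_le _ _ _ (Finite 0) _ (is_lim_seq_const 0) L).
  intros N. split; [apply Cmod_ge_0|].
  eapply Rle_trans; [apply Cmod_le_parts|].
  change (Re ((P u, Q u) - Csum (fun m => RtoC (u ^ m) * kernel_coef m) N)%C)
    with (P u - Re (Csum (fun m => RtoC (u ^ m) * kernel_coef m)%C N)).
  change (Im ((P u, Q u) - Csum (fun m => RtoC (u ^ m) * kernel_coef m) N)%C)
    with (Q u - Im (Csum (fun m => RtoC (u ^ m) * kernel_coef m)%C N)).
  rewrite Re_Csum, Im_Csum.
  rewrite (sum_n_Rext (fun k => Re (RtoC (u ^ k) * kernel_coef k)%C) (fun m => u ^ m * Re (kernel_coef m)))
    by (intros k; simpl; ring).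
  rewrite (sum_n_Rext (fun k => Im (RtoC (u ^ k) * kernel_coef k)%C) (fun m => u ^ m * Im (kernel_coef m)))
    by (intros k; simpl; ring).
  lra.
Qed.

End Kernel.

Definition cayley (x : R) : R := (x - 1) / (x + 1).

Lemma cayley_lt_1 x : 0 < x -> Rabs (cayley x) < 1.
Proof.
  intros Hx. unfold cayley. apply Rabs_def1.
  - apply Rmult_lt_reg_r with (x + 1); [lra|].
    replace ((x - 1) / (x + 1) * (x + 1)) with (x - 1) by (field; lra). lra.
  - apply Rmult_lt_reg_r with (x + 1); [lra|].
    replace ((x - 1) / (x + 1) * (x + 1)) with (x - 1) by (field; lra). lra.
Qed.

Definition weight (x : R) : R := Rpower 2 (3 / 2) * / Rpower (x + 1) (3 / 2).

(** With [u = (x-1)/(x+1)] one has [1 - u = 2/(x+1)] and [1 + u = 2x/(x+1)], so that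
    [(1-u)^(-a) (1+u)^(a-3/2)] is [x^(a-3/2)] up to the weight. *)
Lemma xi_kernel_series (t : C) (x : R) : 0 < x ->
  is_Cseries (fun m => RtoC (weight x * cayley x ^ m * poch_ratio m) * moment (RtoC 2 * Ci * t) m)%C
    (xi_kernel (RtoC (1 / 2) + Ci * t) x).
Proof.
  intros Hx. set (a := (RtoC (3 / 4) + Ci * t / RtoC 2)%C).
  assert (Ea : (RtoC 4 * a - RtoC 3)%C = (RtoC 2 * Ci * t)%C).
  { unfold a. rewrite RtoC_div by lra.
    replace (RtoC 4) with (RtoC 2 * RtoC 2)%C by (rewrite <- RtoC_mult; f_equal; lra).
    field. }
  assert (Hu := cayley_lt_1 x Hx).
  assert (HS := kernel_is_Cseries a (cayley x) Hu).
  assert (HK := kernel_closed a (cayley x) Hu).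
  set (F := (PSeries (fun m : nat => Re (kernel_coef a m)) (cayley x),
         PSeries (fun m : nat => Im (kernel_coef a m)) (cayley x)) : C) in *.
  apply (is_Cseries_mult (RtoC (weight x))) in HS.
  replace (xi_kernel (RtoC (1 / 2) + Ci * t) x) with (RtoC (weight x) * F)%C.
  - revert HS. apply is_Cseries_ext. intros m. unfold kernel_coef. rewrite Ea. rtoc. Ceq; ring.
  - assert (HW : (RtoC (weight x) = Rcpow 2 (RtoC (3 / 2)) * Rcpow (x + 1) (- RtoC (3 / 2)))%C).
    { unfold weight. rewrite <- RtoC_opp, !Rcpow_R, <- RtoC_mult, Rpower_Ropp. reflexivity. }
    assert (HX : (RtoC (weight x) = xi_kernel (RtoC (1 / 2) + Ci * t) x * Cexp (kexponent a (cayley x)))%C).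
    { rewrite HW. unfold xi_kernel, Rcpow. rewrite <- !Cexp_plus. f_equal.
      unfold kexponent.
      replace (1 - cayley x) with (2 * / (x + 1)) by (unfold cayley; field; lra).
      replace (1 + cayley x) with (2 * x * / (x + 1)) by (unfold cayley; field; lra).
      assert (Hi : 0 < / (x + 1)) by (apply Rinv_0_lt_compat; lra).
      rewrite !ln_mult, ln_Rinv by lra.
      unfold a. rtoc.
      replace (RtoC (3 / 2)) with (RtoC (3 / 4) + RtoC (3 / 4))%C by (rewrite <- RtoC_plus; f_equal; lra).
      replace (RtoC (3 / 4)) with (RtoC 1 - RtoC (1 / 4))%C by (rewrite <- RtoC_minus; f_equal; lra).
      replace (RtoC (1 / 2)) with (RtoC 2 * RtoC (1 / 4))%C by (rewrite <- RtoC_mult; f_equal; lra).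
      field. }
    rewrite HX, <- Cmult_assoc, (Cmult_comm (Cexp _)), HK. ring.
Qed.

(** The duplication [(n/2+3/4)_k (n/2+5/4)_k = (n+3/2)_(2k) / 4^k] merges the numerator
    with [(3/2)_n] into [(3/2)_(n+2k)]; the remaining factors are a ballot number. *)
Lemma poch_ratio_hyp2F1 (n k : nat) :
  poch (3 / 2) n / (2 ^ n * INR (fact n)) *
  (poch (INR n / 2 + 3 / 4) k * poch (INR n / 2 + 5 / 4) k /
    (poch (INR n + 2) k * INR (fact k)))
  = poch_ratio (n + 2 * k) * ballot (n + 2 * k) (Z.of_nat n).
Proof.
  rewrite ballot_closed. unfold poch_ratio, ballot_formula.
  assert (Hn := pos_INR n).
  assert (F : forall j, INR (fact j) <> 0) by (intros j; apply Rgt_not_eq, INR_fact_pos).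
  induction k as [|k IH].
  - replace (n + 2 * 0)%nat with n by lia. replace (n + 0 + 1)%nat with (S n) by lia.
    rewrite INR_fact_S. simpl poch. simpl (fact 0).
    replace ((1 / 2) ^ n) with (/ 2 ^ n) by (rewrite <- pow_inv; f_equal; field).
    simpl (INR 1). field. repeat split; auto; try lra. apply pow_nonzero; lra.
  - replace (n + 2 * S k)%nat with (S (S (n + 2 * k))) by lia.
    replace (n + S k + 1)%nat with (S (n + k + 1)) by lia.
    assert (Em : INR (n + 2 * k) = INR n + 2 * INR k)
      by (rewrite plus_INR, mult_INR; reflexivity).
    assert (Ej : INR (n + k + 1) = INR n + INR k + 1)
      by (rewrite !plus_INR; reflexivity).
    set (m := (n + 2 * k)%nat) in *. set (j := (n + k + 1)%nat) in *.
    cbn [poch]. rewrite !INR_fact_S, (S_INR m), Em, Ej.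
    rewrite <- (tech_pow_Rmult (1 / 2) (S m)), <- (tech_pow_Rmult (1 / 2) m).
    assert (Hk := pos_INR k).
    assert (Pk := poch_pos (INR n + 2) k ltac:(lra)).
    transitivity ((poch (3 / 2) n / (2 ^ n * INR (fact n)) *
     (poch (INR n / 2 + 3 / 4) k * poch (INR n / 2 + 5 / 4) k /
      (poch (INR n + 2) k * INR (fact k)))) *
      ((INR n / 2 + 3 / 4 + INR k) * (INR n / 2 + 5 / 4 + INR k) / ((INR n + 2 + INR k) * (INR k + 1)))).
    { field. repeat split; auto; try lra. apply pow_nonzero; lra. }
    rewrite IH. field. repeat split; auto; lra.
Qed.

Lemma Rpower_2_shift (n : nat) : / Rpower 2 (INR n - 3 / 2) = Rpower 2 (3 / 2) / 2 ^ n.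
Proof.
  unfold Rminus. rewrite Rpower_plus, Rpower_Ropp, Rpower_pow by lra.
  assert (H := Rpower_pos 2 (3 / 2)).
  field. split; [apply pow_nonzero; lra | lra].
Qed.

(** * Moments of omega *)

(** Compare with [1/(m+1)^2], bounding a power of [sqrt (m+1)] by the exponential. *)
Lemma ex_series_stretched (N : nat) (c : R) : 0 < c ->
  ex_series (fun m => (INR m + 1) ^ N * exp (- (c * sqrt (INR m)))).
Proof.
  intros Hc. destruct (pow_exp_bound (2 * (N + 2)) c Hc) as [A [HA H]].
  apply (ex_series_Rle _ (fun m => A * exp c * / INR (S m) ^ 2)).
  2: apply ex_series_Rscal, ex_series_inv_sq.
  intros m. assert (Hm := pos_INR m). rewrite S_INR.
  set (y := sqrt (INR m + 1)).
  assert (Hy2 : y * y = INR m + 1) by (apply sqrt_sqrt; lra).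
  assert (Hy : 0 <= y) by apply sqrt_pos.
  assert (Hs : y - 1 <= sqrt (INR m)).
  { assert (H0 := sqrt_pos (INR m)). assert (H1 := sqrt_sqrt (INR m) Hm). nra. }
  specialize (H y Hy). rewrite pow_mult in H. replace (y ^ 2) with (INR m + 1) in H by (rewrite <- Hy2; ring).
  rewrite pow_add in H.
  rewrite Rabs_right by (apply Rle_ge, Rmult_le_pos; [apply pow_le; lra | left; apply exp_pos]).
  assert (He : exp (- (c * sqrt (INR m))) <= exp (- (c * y)) * exp c).
  { rewrite <- exp_plus. apply exp_monotone. nra. }
  assert (HP : 0 < (INR m + 1) ^ N) by (apply pow_lt; lra).
  apply Rmult_le_reg_r with ((INR m + 1) ^ 2); [apply pow_lt; lra|].
  replace (A * exp c * / (INR m + 1) ^ 2 * (INR m + 1) ^ 2) with (A * exp c) by (field; lra).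
  apply Rle_trans with ((INR m + 1) ^ N * (exp (- (c * y)) * exp c) * (INR m + 1) ^ 2).
  - apply Rmult_le_compat_r; [apply pow_le; lra|]. apply Rmult_le_compat_l; lra.
  - replace ((INR m + 1) ^ N * (exp (- (c * y)) * exp c) * (INR m + 1) ^ 2)
      with ((INR m + 1) ^ N * (INR m + 1) ^ 2 * exp (- (c * y)) * exp c) by ring.
    apply Rmult_le_compat_r; [left; apply exp_pos | exact H].
Qed.

(** The integral of the [m]-th term of the expansion of the Mellin kernel, without the
    factor that depends on the argument of xi. *)
Definition moment_integrand (m : nat) (x : R) : R := omega x * (weight x * cayley x ^ m * poch_ratio m).
Definition omega_moment (m : nat) : R := RInt_gen (V := R_CompleteNormedModule) (moment_integrand m) at0 atoo.

Lemma cayley_bound x : 0 < x -> Rabs (cayley x) <= exp (- / (x + / x)).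
Proof.
  intros Hx. destruct (xinv_bounds x Hx) as [H2 _].
  eapply Rle_trans; [|apply exp_ineq1_le].
  replace (/ (x + / x)) with (x / (x ^ 2 + 1)) by (field; nra).
  unfold cayley.
  assert (E : 1 + - (x / (x ^ 2 + 1)) = (x ^ 2 + 1 - x) / (x ^ 2 + 1)) by (field; nra).
  rewrite E. apply Rabs_le_between.
  assert (HD : 0 < (x + 1) * (x ^ 2 + 1)) by nra.
  split; apply Rmult_le_reg_r with ((x + 1) * (x ^ 2 + 1)); auto.
  - replace (- ((x ^ 2 + 1 - x) / (x ^ 2 + 1)) * ((x + 1) * (x ^ 2 + 1)))
      with (- ((x ^ 2 + 1 - x) * (x + 1))) by (field; nra).
    replace ((x - 1) / (x + 1) * ((x + 1) * (x ^ 2 + 1))) with ((x - 1) * (x ^ 2 + 1)) by (field; nra).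
    nra.
  - replace ((x ^ 2 + 1 - x) / (x ^ 2 + 1) * ((x + 1) * (x ^ 2 + 1)))
      with ((x ^ 2 + 1 - x) * (x + 1)) by (field; nra).
    replace ((x - 1) / (x + 1) * ((x + 1) * (x ^ 2 + 1))) with ((x - 1) * (x ^ 2 + 1)) by (field; nra).
    nra.
Qed.

Lemma weight_bound x : 0 < x -> 0 < weight x <= 4.
Proof.
  intros Hx. unfold weight.
  assert (H1 : 0 < Rpower 2 (3 / 2)) by apply exp_pos.
  assert (H1' : Rpower 2 (3 / 2) <= 4).
  { replace 4 with (Rpower 2 (INR 2)) by (rewrite Rpower_pow by lra; ring).
    apply Rle_Rpower; simpl; lra. }
  assert (H2 : 1 <= Rpower (x + 1) (3 / 2)).
  { assert (H : Rpower (x + 1) 0 <= Rpower (x + 1) (3 / 2)) by (apply Rle_Rpower; lra).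
    rewrite Rpower_O in H; lra. }
  assert (H3 : 0 < / Rpower (x + 1) (3 / 2) <= 1).
  { split; [apply Rinv_0_lt_compat; lra|].
    apply Rle_trans with (/ 1); [apply Rinv_le_contravar; lra | rewrite Rinv_1; lra]. }
  split; [apply Rmult_lt_0_compat; lra|].
  replace 4 with (4 * 1) by ring. apply Rmult_le_compat; lra.
Qed.

(** The loss [exp (- m/X)] from the power of [(x-1)/(x+1)] and the decay [exp (- X/8)]
    of [omega], where [X = x + 1/x], balance at [X] of order [sqrt m]. *)
Lemma moment_integrand_bound : exists D, 0 < D /\ forall m x, 0 < x ->
  Rabs (moment_integrand m x) <= D * (INR m + 1) * exp (- (sqrt (INR m) / 2)) * majorant 1 x.
Proof.
  destruct (omega_weighted 0) as [A [HA H]].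
  exists (4 * A). split; [lra|]. intros m x Hx.
  specialize (H x Hx). rewrite pow_O, Rmult_1_r in H.
  destruct (xinv_bounds x Hx) as [H2 _]. assert (Hc := cayley_bound x Hx).
  set (X := x + / x) in *.
  assert (HXi : 0 < / X) by (apply Rinv_0_lt_compat; lra).
  assert (Hcm : Rabs (cayley x) ^ m <= exp (- (INR m * / X))).
  { eapply Rle_trans; [apply pow_incr; split; [apply Rabs_pos | exact Hc]|].
    rewrite exp_pow. right; f_equal; ring. }
  destruct (weight_bound x Hx) as [W1 W2]. destruct (poch_ratio_bounds m) as [B1 B2].
  assert (Hh := majorant_pos 1 x Rlt_0_1).
  assert (Hm := pos_INR m).
  (* Equivalent to [(X - 2 s)^2 + 4 s^2 >= 0] for [s = sqrt m]. *)
  assert (Hexp : exp (- (X / 8)) * exp (- (INR m * / X)) <= exp (- (sqrt (INR m) / 2))).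
  { rewrite <- exp_plus. apply exp_monotone.
    assert (Hs := sqrt_sqrt (INR m) Hm). set (s := sqrt (INR m)) in *. rewrite <- Hs.
    apply Rmult_le_reg_r with (8 * X); [lra|].
    replace ((- (X / 8) + - (s * s * / X)) * (8 * X)) with (- (X * X) - 8 * (s * s)) by (field; lra).
    assert (0 <= (X - 2 * s) ^ 2) by apply pow2_ge_0. nra. }
  unfold moment_integrand. rewrite !Rabs_mult, (Rabs_right (weight x)), (Rabs_right (poch_ratio m)), <- RPow_abs by lra.
  assert (P1 := exp_pos (- (X / 8))). assert (P2 := exp_pos (- (INR m * / X))).
  assert (Pc : 0 <= Rabs (cayley x) ^ m) by (apply pow_le, Rabs_pos).
  apply Rle_trans with ((A * exp (- (X / 8)) * majorant 1 x) * (4 * exp (- (INR m * / X)) * (INR m + 1))).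
  - apply Rmult_le_compat; auto using Rabs_pos.
    + apply Rmult_le_pos; [apply Rmult_le_pos|]; lra.
    + apply Rmult_le_compat; try lra; [apply Rmult_le_pos; lra|].
      apply Rmult_le_compat; lra.
  - replace ((A * exp (- (X / 8)) * majorant 1 x) * (4 * exp (- (INR m * / X)) * (INR m + 1)))
      with (4 * A * (INR m + 1) * majorant 1 x * (exp (- (X / 8)) * exp (- (INR m * / X)))) by ring.
    replace (4 * A * (INR m + 1) * exp (- (sqrt (INR m) / 2)) * majorant 1 x)
      with (4 * A * (INR m + 1) * majorant 1 x * exp (- (sqrt (INR m) / 2))) by ring.
    apply Rmult_le_compat_l; [|exact Hexp].
    apply Rmult_le_pos; [apply Rmult_le_pos|]; lra.
Qed.

Lemma continuous_weight x : 0 < x -> continuous weight x.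
Proof.
  intros Hx. apply continuous_of_derivable. unfold weight, Rpower.
  auto_derive. split; [lra|]. split; [apply Rgt_not_eq, exp_pos | auto].
Qed.

Lemma continuous_cayley x : 0 < x -> continuous cayley x.
Proof. intros Hx. apply continuous_of_derivable. unfold cayley. auto_derive. lra. Qed.

Lemma continuous_pow (f : R -> R) (n : nat) (x : R) :
  continuous f x -> continuous (fun y => f y ^ n) x.
Proof.
  intros Hf. induction n as [|n IH]; simpl; [apply continuous_const|].
  now apply continuous_Rscal.
Qed.

Lemma continuous_moment_integrand m : continuous_pos (V := R_UniformSpace) (moment_integrand m).
Proof.
  intros x Hx. unfold moment_integrand. apply continuous_Rscal; [now apply continuous_omega|].
  apply continuous_Rscal; [|apply continuous_const].
  apply continuous_Rscal; [now apply continuous_weight|].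
  apply continuous_pow. now apply continuous_cayley.
Qed.

Lemma is_RInt_omega_moment m : is_RInt_gen (moment_integrand m) at0 atoo (omega_moment m).
Proof.
  destruct moment_integrand_bound as [D [HD H]].
  exact (is_RInt_gen_dominated (V := R_CompleteNormedModule) (moment_integrand m) 1 _ (continuous_moment_integrand m)
    Rlt_0_1 (H m)).
Qed.

Lemma omega_moment_bound : exists D, 0 < D /\ forall m,
  Rabs (omega_moment m) <= D * (INR m + 1) * exp (- (sqrt (INR m) / 2)).
Proof.
  destruct moment_integrand_bound as [D [HD H]]. exists D; split; auto. intros m.
  exact (norm_RInt_gen_dominated (V := R_CompleteNormedModule) (moment_integrand m) 1 _ (continuous_moment_integrand m)
    Rlt_0_1 (H m)).
Qed.

Lemma moment_integrand_inv m x : 0 < x -> / x ^ 2 * moment_integrand m (/ x) = (-1) ^ m * moment_integrand m x.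
Proof.
  intros Hx. unfold moment_integrand. rewrite omega_inv by auto.
  assert (Hi := Rinv_0_lt_compat _ Hx).
  replace (cayley (/ x)) with (-1 * cayley x) by (unfold cayley; field; lra).
  rewrite Rpow_mult_distr.
  assert (EW : weight (/ x) = weight x * Rpower x (3 / 2)).
  { unfold weight. replace (/ x + 1) with ((x + 1) * / x) by (field; lra).
    rewrite <- Rpower_mult_distr by lra.
    replace (Rpower (/ x) (3 / 2)) with (/ Rpower x (3 / 2)).
    2:{ unfold Rpower. rewrite ln_Rinv by auto. rewrite <- exp_Ropp. f_equal; ring. }
    assert (P1 : 0 < Rpower x (3 / 2)) by apply exp_pos.
    assert (P2 : 0 < Rpower (x + 1) (3 / 2)) by apply exp_pos.
    field. lra. }
  rewrite EW, <- Rpower_sqrt by auto.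
  assert (E2 : Rpower x (/ 2) * Rpower x (3 / 2) = x ^ 2).
  { rewrite <- Rpower_plus, <- Rpower_pow by auto. f_equal. simpl. field. }
  transitivity (/ x ^ 2 * (Rpower x (/ 2) * Rpower x (3 / 2)) *
    ((-1) ^ m * (omega x * (weight x * cayley x ^ m * poch_ratio m)))); [ring|].
  rewrite E2. field. lra.
Qed.

(** Under [x -> 1/x] the integrand of index [m] is multiplied by [(-1)^m]. *)
Lemma omega_moment_odd k : omega_moment (2 * k + 1) = 0.
Proof.
  set (m := (2 * k + 1)%nat).
  assert (H := is_RInt_gen_inversion (V := R_CompleteNormedModule) (moment_integrand m) (omega_moment m)
    (continuous_moment_integrand m) (is_RInt_omega_moment m)).
  assert (H' : is_RInt_gen (fun x => -1 * moment_integrand m x) at0 atoo (omega_moment m)).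
  { revert H. apply (is_RInt_gen_ext_pos (V := R_CompleteNormedModule)). intros x Hx.
    etransitivity; [exact (moment_integrand_inv m x Hx)|].
    unfold m. rewrite pow_add, pow_mult. replace ((-1) ^ 2) with 1 by ring.
    rewrite pow1. simpl. Rring. }
  assert (H2 : is_RInt_gen (fun x => -1 * moment_integrand m x) at0 atoo (-1 * omega_moment m))
    by exact (is_RInt_gen_scal (V := R_NormedModule) (moment_integrand m) (-1) (omega_moment m) (is_RInt_omega_moment m)).
  assert (E1 := RInt_gen_pos_unique (V := R_CompleteNormedModule) _ _ H').
  assert (E2 := RInt_gen_pos_unique (V := R_CompleteNormedModule) _ _ H2).
  rewrite E1 in E2. lra.
Qed.

Lemma sqrt_le_rpow n : sqrt (INR n) <= rpow (INR n) (2 / 3).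
Proof.
  unfold rpow. destruct (Req_EM_T (INR n) 0) as [E|E].
  - rewrite E, sqrt_0. lra.
  - assert (Hn : 1 <= INR n).
    { destruct n; [simpl in E; lra|]. rewrite S_INR. assert (H := pos_INR n). lra. }
    rewrite <- Rpower_sqrt by lra. apply Rle_Rpower; lra.
Qed.

Lemma rpow_mono n k : (n <= k)%nat -> rpow (INR n) (2 / 3) <= rpow (INR k) (2 / 3).
Proof.
  intros H. unfold rpow. destruct (Req_EM_T (INR n) 0) as [E|E].
  - destruct (Req_EM_T (INR k) 0); [lra | left; apply exp_pos].
  - apply le_INR in H. assert (Hn := pos_INR n).
    destruct (Req_EM_T (INR k) 0); [lra|]. apply Rle_Rpower_l; lra.
Qed.

Lemma ballot_le_1 m j : (-1 <= j)%Z -> ballot m j <= 1.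
Proof.
  intros Hj. assert (H := ballot_chernoff 0 m j ltac:(lra) Hj).
  replace (INR m * (2 * 0 ^ 2) - 0 * IZR j) with 0 in H by ring. now rewrite exp_0 in H.
Qed.

Definition decay (c : R) (n : nat) : R := exp (- (c * rpow (INR n) (2 / 3))).

(** Put [r = n^(2/3)]. If [r <= 8 sqrt m] the exponential in [sqrt m] alone suffices.
    Otherwise the Chernoff bound with [lam = n^(-1/3)] gives [2 m lam^2 - lam n],
    which is [2 m / r - r], and [2 m / r] is at most [sqrt m / 4]. *)
Lemma ballot_joint_decay m n :
  ballot m (Z.of_nat n) * exp (- (sqrt (INR m) / 2))
  <= exp (- (sqrt (INR m) / 4)) * decay (1 / 32) n.
Proof.
  unfold decay. rewrite <- exp_plus.
  assert (Hs0 := sqrt_pos (INR m)). assert (Hss := sqrt_sqrt (INR m) (pos_INR m)).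
  assert (HE := exp_pos (- (sqrt (INR m) / 2))).
  set (r := rpow (INR n) (2 / 3)).
  destruct (Rle_lt_dec r (8 * sqrt (INR m))) as [Hle|Hlt].
  - assert (H := ballot_le_1 m (Z.of_nat n) ltac:(lia)).
    apply Rle_trans with (1 * exp (- (sqrt (INR m) / 2))); [apply Rmult_le_compat_r; lra|].
    rewrite Rmult_1_l. apply exp_monotone. lra.
  - assert (Hn : 1 <= INR n).
    { destruct n as [|n]; [|rewrite S_INR; assert (H := pos_INR n); lra].
      unfold r, rpow in Hlt. simpl (INR 0) in Hlt.
      destruct (Req_EM_T 0 0); [lra | congruence]. }
    assert (Er : r = Rpower (INR n) (2 / 3)).
    { unfold r, rpow. destruct (Req_EM_T (INR n) 0); [lra | reflexivity]. }
    set (lam := Rpower (INR n) (- (1 / 3))).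
    assert (L1 : lam * INR n = r).
    { rewrite Er. unfold lam. rewrite <- (Rpower_1 (INR n)) at 2 by lra.
      rewrite <- Rpower_plus. f_equal. field. }
    assert (L2 : lam ^ 2 * r = 1).
    { rewrite Er. unfold lam. rewrite <- Rpower_pow by apply exp_pos.
      rewrite Rpower_mult, <- Rpower_plus.
      replace (- (1 / 3) * INR 2 + 2 / 3) with 0 by (simpl; field). apply Rpower_O; lra. }
    assert (L3 : 0 <= lam <= 1).
    { split; [left; apply exp_pos|]. unfold lam.
      assert (H : Rpower (INR n) (- (1 / 3)) <= Rpower (INR n) 0) by (apply Rle_Rpower; lra).
      rewrite Rpower_O in H; lra. }
    assert (H := ballot_chernoff lam m (Z.of_nat n) L3 ltac:(lia)).
    rewrite <- INR_IZR_INZ, L1 in H.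
    apply Rle_trans with (exp (INR m * (2 * lam ^ 2) - r) * exp (- (sqrt (INR m) / 2)));
      [apply Rmult_le_compat_r; lra|].
    rewrite <- exp_plus. apply exp_monotone.
    assert (Hr : 0 < r) by (rewrite Er; apply exp_pos).
    (* Here [lam ^ 2 = 1 / r] and [sqrt m < r / 8]. *)
    assert (Hk : INR m * (2 * lam ^ 2) <= sqrt (INR m) / 4).
    { set (s := sqrt (INR m)) in *. rewrite <- Hss.
      assert (Hl : s * lam ^ 2 <= / 8).
      { apply Rmult_le_reg_r with r; auto. rewrite Rmult_assoc, L2. lra. }
      replace (s * s * (2 * lam ^ 2)) with (2 * s * (s * lam ^ 2)) by ring.
      apply Rle_trans with (2 * s * / 8); [apply Rmult_le_compat_l; lra | lra]. }
    lra.
Qed.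

Lemma ballot_moment_bound : exists W : nat -> R,
  (forall m, 0 <= W m) /\ ex_series W /\
  forall m n, Rabs (ballot m (Z.of_nat n) * omega_moment m) <= W m * decay (1 / 32) n.
Proof.
  destruct omega_moment_bound as [D [HD H]].
  exists (fun m => D * ((INR m + 1) ^ 1 * exp (- (1 / 4 * sqrt (INR m))))).
  split; [|split].
  - intros m. assert (Hm := pos_INR m). assert (He := exp_pos (- (1 / 4 * sqrt (INR m)))).
    apply Rmult_le_pos; [lra|]. apply Rmult_le_pos; lra.
  - apply ex_series_Rscal, ex_series_stretched. lra.
  - intros m n. rewrite Rabs_mult, (Rabs_right (ballot _ _)) by (apply Rle_ge, ballot_nonneg; lia).
    assert (HB := ballot_joint_decay m n). assert (Hm := pos_INR m).
    assert (Hb := ballot_nonneg m (Z.of_nat n) ltac:(lia)).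
    replace (1 / 4 * sqrt (INR m)) with (sqrt (INR m) / 4) by field.
    eapply Rle_trans; [apply Rmult_le_compat_l; [exact Hb | apply H]|].
    replace (ballot m (Z.of_nat n) * (D * (INR m + 1) * exp (- (sqrt (INR m) / 2))))
      with (D * (INR m + 1) * (ballot m (Z.of_nat n) * exp (- (sqrt (INR m) / 2)))) by ring.
    eapply Rle_trans; [apply Rmult_le_compat_l; [nra | exact HB]|]. right; ring.
Qed.

(** * The expansion of the xi function *)

(** A walk started at 0 is at [n] only at times [n + 2k]; this removes the other
    terms of a series indexed by time. *)
Lemma is_series_reindex (a : nat -> R) (n : nat) (l : R) :
  (forall m, (m < n)%nat -> a m = 0) -> (forall k, a (n + 2 * k + 1)%nat = 0) ->
  is_series a l -> is_series (fun k => a (n + 2 * k)%nat) l.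
Proof.
  intros H0 H1 Hs.
  assert (E : forall k, sum_n a (n + 2 * k) = sum_n (fun k => a (n + 2 * k)%nat) k).
  { induction k as [|k IH].
    - rewrite sum_O. replace (n + 2 * 0)%nat with n by lia.
      assert (Hz : forall j, (j < n)%nat -> sum_n a j = 0).
      { induction j as [|j IHj]; intros Hj; [rewrite sum_O; now apply H0|].
        rewrite sum_n_RS, IHj, H0 by lia. Rring. }
      destruct n as [|n]; [now rewrite sum_O|]. rewrite sum_n_RS, Hz by lia. Rring.
    - rewrite sum_n_RS, <- IH. replace (n + 2 * S k)%nat with (S (S (n + 2 * k))) by lia.
      rewrite !sum_n_RS. replace (S (n + 2 * k)) with (n + 2 * k + 1)%nat by lia.
      rewrite H1. replace (S (n + 2 * k + 1)) with (n + 2 * S k)%nat by lia.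
      replace (S (S (n + 2 * k))) with (n + 2 * S k)%nat by lia. Rring. }
  assert (H : is_lim_seq (fun k => sum_n a (n + 2 * k)) l).
  { apply (is_lim_seq_subseq (sum_n a) l (fun k => (n + 2 * k)%nat)); [|exact Hs].
    intros P [N HP]. exists N. intros k Hk. apply HP. lia. }
  assert (H' : is_lim_seq (sum_n (fun k => a (n + 2 * k)%nat)) l); [|exact H'].
  revert H. apply is_lim_seq_ext. exact E.
Qed.

Lemma ex_series_ballot_moment n : ex_series (fun m => ballot m (Z.of_nat n) * omega_moment m).
Proof.
  destruct ballot_moment_bound as [W [W0 [W1 W2]]].
  apply (ex_series_Rle _ (fun m => decay (1 / 32) n * W m)).
  - intros m. rewrite (Rmult_comm (decay _ _)). apply W2.
  - now apply ex_series_Rscal.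
Qed.

Definition d_prefactor (n : nat) : R := poch (3 / 2) n / (2 ^ n * INR (fact n)).

Lemma d_prefactor_pos n : 0 < d_prefactor n.
Proof.
  apply Rdiv_lt_0_compat; [apply poch_pos; lra|].
  apply Rmult_lt_0_compat; [apply pow_lt; lra | apply INR_fact_pos].
Qed.

Definition hypcoef (n k : nat) : R :=
  poch (INR n / 2 + 3 / 4) k * poch (INR n / 2 + 5 / 4) k / (poch (INR n + 2) k * INR (fact k)).

(** The hypergeometric series, divided by a constant that depends on [n], has
    coefficients at most [k+1] and hence is continuous inside the unit disc. *)
Lemma continuous_hyp2F1 (n : nat) (y : R) : Rabs y < 1 ->
  continuous (fun y => hyp2F1 (INR n / 2 + 3 / 4) (INR n / 2 + 5 / 4) (INR n + 2) y) y.
Proof.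
  intros Hy. assert (Hn := pos_INR n).
  set (ka := d_prefactor n). assert (Hka : 0 < ka) by apply d_prefactor_pos.
  set (b := fun k => ka / (2 * (INR n + 1)) * hypcoef n k).
  assert (Hb : forall k, Rabs (b k) <= (INR k + 1) ^ 1).
  { intros k. unfold b. assert (Hk := pos_INR k).
    assert (E : ka / (2 * (INR n + 1)) * hypcoef n k =
      poch_ratio (n + 2 * k) * ballot (n + 2 * k) (Z.of_nat n) / (2 * (INR n + 1))).
    { rewrite <- poch_ratio_hyp2F1. unfold ka, d_prefactor, hypcoef, Rdiv. ring. }
    rewrite E. destruct (poch_ratio_bounds (n + 2 * k)) as [B1 B2].
    assert (B3 := ballot_nonneg (n + 2 * k) (Z.of_nat n) ltac:(lia)).
    assert (B4 := ballot_le_1 (n + 2 * k) (Z.of_nat n) ltac:(lia)).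
    rewrite Rabs_right.
    2:{ apply Rle_ge, Rmult_le_pos; [nra | left; apply Rinv_0_lt_compat; lra]. }
    apply Rmult_le_reg_r with (2 * (INR n + 1)); [lra|].
    replace (poch_ratio (n + 2 * k) * ballot (n + 2 * k) (Z.of_nat n) / (2 * (INR n + 1)) * (2 * (INR n + 1)))
      with (poch_ratio (n + 2 * k) * ballot (n + 2 * k) (Z.of_nat n)) by (field; lra).
    rewrite plus_INR, mult_INR in B2. simpl (INR 2) in B2. rewrite pow_1.
    apply Rle_trans with (poch_ratio (n + 2 * k) * 1); [apply Rmult_le_compat_l; lra|]. nra. }
  apply continuous_ext with (fun y => 2 * (INR n + 1) / ka * PSeries b y).
  { intros v. unfold PSeries, hyp2F1. rewrite <- Series_scal_l. apply Series_ext. intros k.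
    unfold b, hypcoef. assert (P := poch_pos (INR n + 2) k ltac:(lra)).
    assert (F := INR_fact_pos k). field. lra. }
  apply continuous_Rscal; [apply continuous_const|].
  apply continuity_pt_filterlim. apply PSeries_continuity. apply (CV_radius_poly_growth b 1); auto.
Qed.

(** The hypergeometric series in the definition of [d] is integrated term by term and
    reindexed by [m = n + 2k]. *)
Theorem d_is_series (n : nat) : is_series (fun m => ballot m (Z.of_nat n) * omega_moment m) (d n).
Proof.
  set (ka := d_prefactor n). assert (Hka : 0 < ka) by apply d_prefactor_pos.
  assert (H2 : 0 < Rpower 2 (3 / 2)) by apply exp_pos.
  set (f := fun k x => ballot (n + 2 * k) (Z.of_nat n) * moment_integrand (n + 2 * k) x).
  set (In := fun x : R =>
       omega x / Rpower (x + 1) (3 / 2) * ((x - 1) / (x + 1)) ^ n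
       * hyp2F1 (INR n / 2 + 3 / 4) (INR n / 2 + 5 / 4) (INR n + 2)
           (((x - 1) / (x + 1)) ^ 2)).
  set (F := fun x => ka * Rpower 2 (3 / 2) * In x).
  destruct moment_integrand_bound as [D [HD HB]].
  set (maj := fun k => D * (INR n + 2) * ((INR k + 1) ^ 1 * exp (- (1 / 2 * sqrt (INR k))))).
  assert (Hmaj : ex_series maj) by (apply ex_series_Rscal, ex_series_stretched; lra).
  assert (Hfb : forall k x, 0 < x -> Rabs (f k x) <= maj k * majorant 1 x).
  { intros k x Hx. unfold f, maj. rewrite Rabs_mult.
    assert (B3 := ballot_nonneg (n + 2 * k) (Z.of_nat n) ltac:(lia)).
    assert (B4 := ballot_le_1 (n + 2 * k) (Z.of_nat n) ltac:(lia)).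
    rewrite (Rabs_right (ballot _ _)) by lra.
    specialize (HB (n + 2 * k)%nat x Hx). assert (Hh := majorant_pos 1 x Rlt_0_1).
    assert (Hn := pos_INR n). assert (Hk := pos_INR k).
    apply Rle_trans with (1 * Rabs (moment_integrand (n + 2 * k) x));
      [apply Rmult_le_compat_r; auto using Rabs_pos|].
    rewrite Rmult_1_l. eapply Rle_trans; [exact HB|].
    apply Rmult_le_compat_r; [lra|].
    assert (E1 : exp (- (sqrt (INR (n + 2 * k)) / 2)) <= exp (- (1 / 2 * sqrt (INR k)))).
    { apply exp_monotone.
      assert (H := sqrt_le_1_alt _ _ (le_INR k (n + 2 * k) ltac:(lia))). lra. }
    assert (He := exp_pos (- (1 / 2 * sqrt (INR k)))).
    rewrite (Rmult_assoc D (INR n + 2)), (Rmult_assoc D). apply Rmult_le_compat_l; [lra|].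
    rewrite <- (Rmult_assoc (INR n + 2)), pow_1.
    apply Rmult_le_compat; [assert (H := pos_INR (n + 2 * k)); lra | left; apply exp_pos | | exact E1].
    rewrite plus_INR, mult_INR. simpl (INR 2). nra. }
  assert (HF : forall x, 0 < x -> is_series (fun k => f k x) (F x)).
  { intros x Hx.
    assert (Hex : ex_series (fun k => f k x)).
    { apply (ex_series_Rle _ (fun k => majorant 1 x * maj k)).
      - intros k. rewrite Rmult_comm. now apply Hfb.
      - now apply ex_series_Rscal. }
    replace (F x) with (Series (fun k => f k x)); [now apply Series_correct|].
    unfold F, In, hyp2F1. fold (cayley x). rewrite <- !Series_scal_l.
    apply Series_ext. intros k. unfold f, moment_integrand.
    transitivity (omega x * weight x * cayley x ^ (n + 2 * k) *
      (poch_ratio (n + 2 * k) * ballot (n + 2 * k) (Z.of_nat n))); [ring|].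
    rewrite <- poch_ratio_hyp2F1. unfold weight. rewrite pow_add, pow_mult. unfold ka, d_prefactor, Rdiv. ring. }
  assert (HFc : continuous_pos (V := R_UniformSpace) F).
  { intros x Hx. unfold F, In. apply continuous_Rscal; [apply continuous_const|].
    apply continuous_Rscal.
    - apply continuous_Rscal; [|apply (continuous_pow cayley); now apply continuous_cayley].
      apply continuous_Rscal; [now apply continuous_omega|].
      apply continuous_of_derivable. unfold Rpower.
      auto_derive. split; [lra|]. split; [apply Rgt_not_eq, exp_pos | auto].
    - apply (continuous_comp (fun x => cayley x ^ 2) (fun y =>
        hyp2F1 (INR n / 2 + 3 / 4) (INR n / 2 + 5 / 4) (INR n + 2) y)).
      + apply continuous_pow. now apply continuous_cayley.
      + apply continuous_hyp2F1. rewrite <- RPow_abs.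
        assert (H := cayley_lt_1 x Hx). assert (H' := Rabs_pos (cayley x)). nra. }
  destruct (series_RInt_gen (V := R_CompleteNormedModule) f F maj 1
    Rlt_0_1 Hmaj HFc) as [HI HS].
  - intros k x Hx. unfold f. apply continuous_Rscal; [apply continuous_const | now apply continuous_moment_integrand].
  - exact Hfb.
  - exact HF.
  - assert (Ed : RInt_gen (V := R_CompleteNormedModule) F at0 atoo = d n).
    { assert (HIn : is_RInt_gen In at0 atoo
        (/ (ka * Rpower 2 (3 / 2)) * RInt_gen (V := R_CompleteNormedModule) F at0 atoo)).
      { assert (G := is_RInt_gen_scal (V := R_NormedModule) F (/ (ka * Rpower 2 (3 / 2))) _ HI).
        revert G. apply (is_RInt_gen_ext_pos (V := R_CompleteNormedModule)).
        intros x Hx. unfold F, scal; simpl. unfold mult; simpl.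
        match goal with |- @eq _ ?x ?y => change (@eq R x y) end. field. lra. }
      unfold d. fold In.
      rewrite (RInt_gen_pos_unique (V := R_CompleteNormedModule) _ _ HIn).
      assert (EC : poch (3 / 2) n / (Rpower 2 (INR n - 3 / 2) * INR (fact n)) = ka * Rpower 2 (3 / 2)).
      { unfold ka, d_prefactor. unfold Rdiv at 1. rewrite Rinv_mult, Rpower_2_shift.
        assert (F1 := INR_fact_pos n). field. split; [lra | apply pow_nonzero; lra]. }
      rewrite EC. rewrite <- Rmult_assoc, Rinv_r by nra. symmetry. apply Rmult_1_l. }
    rewrite Ed in HS.
    assert (HS' : is_series (fun k => ballot (n + 2 * k) (Z.of_nat n) * omega_moment (n + 2 * k)) (d n)).
    { revert HS. apply (is_series_ext (V := R_NormedModule)). intros k.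
      apply (RInt_gen_pos_unique (V := R_CompleteNormedModule)).
      exact (is_RInt_gen_scal (V := R_NormedModule) _ (ballot (n + 2 * k) (Z.of_nat n)) _ (is_RInt_omega_moment _)). }
    assert (HR := is_series_reindex (fun m => ballot m (Z.of_nat n) * omega_moment m) n _
      (fun m Hm => eq_trans (f_equal (fun b => b * omega_moment m)
         (ballot_support m (Z.of_nat n) ltac:(lia))) (Rmult_0_l _))
      (fun k => eq_trans (f_equal (fun b => b * omega_moment (n + 2 * k + 1))
         (ballot_parity (n + 2 * k + 1) (Z.of_nat n)
           ltac:(replace (Z.of_nat (n + 2 * k + 1) + Z.of_nat n)%Z
                   with (1 + 2 * (Z.of_nat n + Z.of_nat k))%Z by lia;
                 rewrite Z.odd_add_mul_2; reflexivity))) (Rmult_0_l _))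
      (Series_correct _ (ex_series_ballot_moment n))).
    assert (E : d n = Series (fun m => ballot m (Z.of_nat n) * omega_moment m))
      by (rewrite <- (is_series_unique _ _ HS'); exact (is_series_unique _ _ HR)).
    rewrite E. apply Series_correct, ex_series_ballot_moment.
Qed.

(** For odd [n] the ballot number vanishes at even [m] and the moment at odd [m]. *)
Lemma d_odd k : d (2 * k + 1) = 0.
Proof.
  rewrite <- (is_series_unique _ _ (d_is_series (2 * k + 1))).
  rewrite (Series_ext _ (fun _ => 0 * 0)).
  - rewrite Series_scal_l. ring.
  - intros m. destruct (Nat.Even_or_Odd m) as [[j ->]|[j ->]].
    + rewrite ballot_parity; [ring|].
      replace (Z.of_nat (2 * j) + Z.of_nat (2 * k + 1))%Z
        with (1 + 2 * (Z.of_nat j + Z.of_nat k))%Z by lia.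
      now rewrite Z.odd_add_mul_2.
    + rewrite omega_moment_odd. ring.
Qed.

(** Termwise integration of the expansion of the Mellin kernel. *)
Lemma xi_moment_series (t : C) :
  is_Cseries (fun m => RtoC (omega_moment m) * moment (RtoC 2 * Ci * t) m)%C
    (xi_fun (RtoC (1 / 2) + Ci * t)).
Proof.
  set (z := (RtoC 2 * Ci * t)%C).
  destruct (nat_above (Cmod z)) as [K HK].
  destruct moment_integrand_bound as [D [HD HB]].
  set (f := fun m x => (RtoC (moment_integrand m x) * moment z m)%C).
  destruct (series_RInt_gen (V := C_R_CompleteNormedModule) f
    (fun x => RtoC (omega x) * xi_kernel (RtoC (1 / 2) + Ci * t) x)%C
    (fun m => D * ((INR m + 1) ^ (S K) * exp (- (1 / 2 * sqrt (INR m))))) 1) as [_ HS].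
  - lra.
  - apply ex_series_Rscal, ex_series_stretched; lra.
  - intros x Hx. apply continuous_Cmult; [|now apply continuous_xi_kernel].
    apply continuous_RtoC. now apply continuous_omega.
  - intros m x Hx. apply continuous_Cmult; [|apply continuous_Cconst].
    apply continuous_RtoC. now apply continuous_moment_integrand.
  - intros m x Hx.
    change (@norm R_AbsRing C_R_NormedModule (f m x) <=
      D * ((INR m + 1) ^ (S K) * exp (- (1 / 2 * sqrt (INR m)))) * majorant 1 x).
    rewrite norm_C_R. unfold f. rewrite Cmod_mult, Cmod_R.
    specialize (HB m x Hx). assert (HM := moment_growth z K HK m).
    replace (1 / 2 * sqrt (INR m)) with (sqrt (INR m) / 2) by field.
    eapply Rle_trans; [apply Rmult_le_compat; [apply Rabs_pos | apply Cmod_ge_0 | exact HB | exact HM]|].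
    right. simpl. ring.
  - intros x Hx.
    assert (H := is_Cseries_mult (RtoC (omega x)) _ _ (xi_kernel_series t x Hx)).
    revert H. apply is_Cseries_ext. intros m. unfold f, moment_integrand. fold z. rtoc. Ceq; ring.
  - revert HS. apply is_Cseries_ext. intros m. apply C_RInt_unique. unfold f.
    apply (is_C_RInt_ext (fun x => moment z m * RtoC (moment_integrand m x))%C); [intros; Ceq; ring|].
    replace (RtoC (omega_moment m) * moment z m)%C with (moment z m * RtoC (omega_moment m))%C by ring.
    apply is_C_RInt_mult, is_C_RInt_RtoC, is_RInt_omega_moment.
Qed.

Lemma Csum_switch (u : nat -> nat -> C) (m n : nat) :
  Csum (fun i => Csum (u i) n) m = Csum (fun j => Csum (fun i => u i j) m) n.
Proof. exact (sum_n_switch (G := C_R_NormedModule) u m n). Qed.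

Lemma Csum_ext_loc (a b : nat -> C) (N : nat) :
  (forall k, (k <= N)%nat -> a k = b k) -> Csum a N = Csum b N.
Proof. exact (sum_n_ext_loc (G := C_R_NormedModule) a b N). Qed.

Lemma Cmod_Csum_le (a : nat -> C) (M : nat -> R) (N : nat) :
  (forall k, Cmod (a k) <= M k) -> Cmod (Csum a N) <= sum_n M N.
Proof.
  intros H. induction N as [|N IH]; [rewrite Csum_O, sum_O; auto|].
  rewrite Csum_S, sum_n_RS. eapply Rle_trans; [apply Cmod_triangle|].
  specialize (H (S N)). lra.
Qed.

Lemma Cseries_rest_le (a : nat -> C) (l : C) (M : nat -> R) (N : nat) :
  is_Cseries a l -> (forall k, Cmod (a k) <= M k) -> ex_series M ->
  Cmod (l - Csum a N)%C <= Series (fun k => M (S N + k)%nat).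
Proof.
  intros Hl Hb Hex. assert (HexN : ex_series (fun k => M (S N + k)%nat)) by (now apply (ex_series_incr_n M)).
  assert (H0 : forall k, 0 <= M k)
    by (intros k; eapply Rle_trans; [apply Cmod_ge_0 | apply Hb]).
  assert (Hpart : forall K, Cmod (Csum a (S N + K) - Csum a N)%C <= Series (fun k => M (S N + k)%nat)).
  { intros K. apply Rle_trans with (sum_n (fun k => M (S N + k)%nat) K); [|now apply sum_n_le_Series].
    replace (Csum a (S N + K) - Csum a N)%C with (Csum (fun k => a (S N + k)%nat) K).
    - apply Cmod_Csum_le. intros k; apply Hb.
    - induction K as [|K IH].
      + rewrite Csum_O, Nat.add_0_r, Csum_S. ring.
      + rewrite Nat.add_succ_r, !Csum_S, IH, Nat.add_succ_r. ring. }
  apply le_epsilon. intros e He.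
  apply is_Cseries_norm, is_lim_seq_spec in Hl. destruct (Hl (mkposreal e He)) as [N0 HN].
  cbn [pos] in HN. specialize (HN (S N + N0)%nat ltac:(lia)).
  rewrite Rminus_0_r, Rabs_right in HN by (apply Rle_ge, Cmod_ge_0).
  replace (l - Csum a N)%C with ((Csum a (S N + N0) - Csum a N) + (l - Csum a (S N + N0)))%C by ring.
  eapply Rle_trans; [apply Cmod_triangle|]. specialize (Hpart N0). lra.
Qed.

Lemma ex_series_decay (K : nat) (c : R) : 0 < c ->
  ex_series (fun n => (INR n + 1) ^ K * decay c n).
Proof.
  intros Hc. apply (ex_series_Rle _ (fun n => (INR n + 1) ^ K * exp (- (c * sqrt (INR n))))).
  2: now apply ex_series_stretched.
  intros n. assert (Hn := pos_INR n). assert (Hd : 0 < decay c n) by apply exp_pos.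
  assert (Hp : 0 < (INR n + 1) ^ K) by (apply pow_lt; lra).
  rewrite Rabs_right by (apply Rle_ge; nra).
  apply Rmult_le_compat_l; [lra|]. apply exp_monotone.
  assert (H := sqrt_le_rpow n). nra.
Qed.

Lemma d_bound : exists W, 0 < W /\ forall n, Rabs (d n) <= W * decay (1 / 32) n.
Proof.
  destruct ballot_moment_bound as [W [W0 [W1 W2]]].
  assert (HS : 0 <= Series W).
  { eapply Rle_trans; [|apply (sum_n_le_Series W 0 W0 W1)]. rewrite sum_O. apply W0. }
  exists (Series W + 1). split; [lra|]. intros n.
  rewrite <- (is_series_unique _ _ (d_is_series n)).
  assert (He : 0 < decay (1 / 32) n) by apply exp_pos.
  assert (Hb : forall m, Rabs (ballot m (Z.of_nat n) * omega_moment m) <= decay (1 / 32) n * W m).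
  { intros m. rewrite (Rmult_comm (decay _ _)). apply W2. }
  assert (Hex : ex_series (fun m => decay (1 / 32) n * W m)) by (now apply ex_series_Rscal).
  eapply Rle_trans; [apply Series_Rabs|].
  - apply (ex_series_Rle _ (fun m => decay (1 / 32) n * W m)); auto.
    intros m; rewrite Rabs_Rabsolu; auto.
  - apply Rle_trans with (Series (fun m => decay (1 / 32) n * W m)).
    + apply Series_le; auto. intros m; split; auto using Rabs_pos.
    + rewrite Series_scal_l. nra.
Qed.

(** The two sums are exchanged in the finite triangle [m, n <= N]. What the triangle
    misses of each [d n] is, by the joint decay, at most a tail in [m] times a
    summable factor in [n], even after multiplication by the Hahn values. *)
Theorem xi_hahn_series (t : C) :
  is_Cseries (fun n => RtoC (d n) * hahn (RtoC 2 * Ci * t) n)%C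
    (xi_fun (RtoC (1 / 2) + Ci * t)).
Proof.
  set (z := (RtoC 2 * Ci * t)%C). set (l := xi_fun (RtoC (1 / 2) + Ci * t)).
  destruct (nat_above (Cmod z)) as [K HK].
  assert (HM := xi_moment_series t). fold z l in HM.
  destruct ballot_moment_bound as [W [W0 [W1 W2]]].
  set (T := fun N => Series (fun k => W (S N + k)%nat)).
  assert (HT : is_lim_seq T 0) by (now apply series_tail_lim).
  set (S_ := Series (fun n => (INR n + 1) ^ K * decay (1 / 32) n)).
  assert (Hex := ex_series_decay K (1 / 32) ltac:(lra)).
  assert (Hdiff : forall N n, Rabs (d n - sum_n (fun m => ballot m (Z.of_nat n) * omega_moment m) N)
    <= decay (1 / 32) n * T N).
  { intros N n. rewrite <- (is_series_unique _ _ (d_is_series n)).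
    assert (Hb : forall m, Rabs (ballot m (Z.of_nat n) * omega_moment m) <= decay (1 / 32) n * W m).
    { intros m. rewrite (Rmult_comm (decay _ _)). apply W2. }
    eapply Rle_trans; [apply (series_rest_le _ _ N Hb)|].
    - now apply ex_series_Rscal.
    - rewrite Series_scal_l. unfold T. right; reflexivity. }
  assert (HT0 : forall N, 0 <= T N).
  { intros N. assert (H := Hdiff N 0%nat). assert (H' := Rabs_pos (d 0 - sum_n (fun m => ballot m (Z.of_nat 0) * omega_moment m) N)).
    assert (He : 0 < decay (1 / 32) 0) by apply exp_pos. nra. }
  (* Exchange of the two sums in the triangle. *)
  assert (Hexch : forall N, Csum (fun m => RtoC (omega_moment m) * moment z m)%C N =
    Csum (fun n => RtoC (sum_n (fun m => ballot m (Z.of_nat n) * omega_moment m) N)%R * hahn z n)%C N).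
  { intros N.
    transitivity (Csum (fun m => Csum (fun n => RtoC (ballot m (Z.of_nat n) * omega_moment m)%R * hahn z n) N)%C N).
    - apply Csum_ext_loc. intros m Hm. rewrite (moment_expansion z N m Hm), <- Csum_mult.
      apply Csum_ext. intros n. rtoc. ring.
    - rewrite Csum_switch. apply Csum_ext. intros n.
      rewrite <- Csum_RtoC, Cmult_comm, <- Csum_mult. apply Csum_ext. intros m. ring. }
  apply is_Cseries_norm. apply is_Cseries_norm in HM.
  assert (HL : is_lim_seq (fun N => Cmod (l - Csum (fun m => RtoC (omega_moment m) * moment z m) N)%C + T N * S_) 0).
  { replace (Finite 0) with (Finite (0 + 0 * S_)) by (f_equal; ring).
    apply is_lim_seq_plus'; auto. apply is_lim_seq_mult'; auto. apply is_lim_seq_const. }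
  refine (is_lim_seq_le_le _ _ _ (Finite 0) _ (is_lim_seq_const 0) HL).
  intros N. split; [apply Cmod_ge_0|].
  replace (l - Csum (fun n => RtoC (d n) * hahn z n) N)%C with
    ((l - Csum (fun m => RtoC (omega_moment m) * moment z m) N) + - (Csum (fun n =>
       RtoC (d n - sum_n (fun m => ballot m (Z.of_nat n) * omega_moment m) N)%R * hahn z n) N))%C.
  2:{ rewrite Hexch.
      assert (E : Csum (fun n => RtoC (d n - sum_n (fun m => ballot m (Z.of_nat n) * omega_moment m) N)%R * hahn z n)%C N
        = (Csum (fun n => RtoC (d n) * hahn z n) N + RtoC (-1) *
           Csum (fun n => RtoC (sum_n (fun m => ballot m (Z.of_nat n) * omega_moment m) N)%R * hahn z n) N)%C).
      { rewrite <- Csum_mult, <- Csum_plus. apply Csum_ext. intros n. rewrite RtoC_minus.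
        replace (RtoC (-1)) with (- RtoC 1)%C by (rewrite <- RtoC_opp; f_equal; lra). ring. }
      rewrite E. replace (RtoC (-1)) with (- RtoC 1)%C by (rewrite <- RtoC_opp; f_equal; lra). ring. }
  eapply Rle_trans; [apply Cmod_triangle|]. apply Rplus_le_compat_l. rewrite Cmod_opp.
  eapply Rle_trans; [apply (Cmod_Csum_le _ (fun n => T N * ((INR n + 1) ^ K * decay (1 / 32) n)))|].
  - intros n. rewrite Cmod_mult, Cmod_R.
    apply Rle_trans with (decay (1 / 32) n * T N * (INR n + 1) ^ K); [|right; ring].
    apply Rmult_le_compat; auto using Rabs_pos, Cmod_ge_0. now apply hahn_growth.
  - rewrite sum_n_Rmult. apply Rmult_le_compat_l; auto. apply sum_n_le_Series; auto.
    intros n. apply Rmult_le_pos; [apply pow_le; assert (H := pos_INR n); lra | left; apply exp_pos].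
Qed.

Lemma xi_term_hahn (t : C) (n : nat) :
  xi_term t n = (RtoC (d (2 * n)) * hahn (RtoC 2 * Ci * t) (2 * n))%C.
Proof. unfold xi_term. rewrite <- g_even_hahn. ring. Qed.

(** The terms of odd index vanish by [d_odd]. *)
Lemma xi_partial_sum (t : C) (N : nat) :
  Csum (xi_term t) N = Csum (fun n => RtoC (d n) * hahn (RtoC 2 * Ci * t) n)%C (2 * N).
Proof.
  induction N as [|N IH].
  - simpl (2 * 0)%nat. rewrite !Csum_O. now rewrite xi_term_hahn.
  - replace (2 * S N)%nat with (S (S (2 * N))) by lia. rewrite !Csum_S, IH, xi_term_hahn.
    replace (2 * S N)%nat with (S (S (2 * N))) by lia.
    assert (H := d_odd N). replace (2 * N + 1)%nat with (S (2 * N)) in H by lia.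
    rewrite H. ring.
Qed.

(** Half of the exponent of each term beyond [N] is spent on uniform decay, the other
    half on summability against the polynomial growth of the Hahn values. *)
Theorem xi_partial_sum_error (B : R) : exists C1 C2, 0 < C1 /\ 0 < C2 /\
  forall (N : nat) (t : C), Cmod t <= B ->
  Cmod (Xi_of xi_fun t - Csum (xi_term t) N)%C <= C1 * exp (- C2 * rpow (INR N) (2 / 3)).
Proof.
  destruct (nat_above (2 * B)) as [K HK].
  destruct d_bound as [W [HW Hd]].
  set (S_ := Series (fun n => (INR n + 1) ^ K * decay (1 / 64) n)).
  assert (Hex := ex_series_decay K (1 / 64) ltac:(lra)).
  assert (Hpos : forall n, 0 <= (INR n + 1) ^ K * decay (1 / 64) n).
  { intros n. apply Rmult_le_pos; [apply pow_le; assert (H := pos_INR n); lra | left; apply exp_pos]. }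
  assert (HS : 0 <= S_).
  { eapply Rle_trans; [|apply (sum_n_le_Series _ 0 Hpos Hex)]. rewrite sum_O. apply Hpos. }
  exists (W * S_ + 1), (1 / 64). split; [nra|]. split; [lra|].
  intros N t Ht. set (z := (RtoC 2 * Ci * t)%C).
  assert (Hz : Cmod z <= INR K).
  { unfold z. rewrite !Cmod_mult, Cmod_Ci, Cmod_R, Rabs_right by lra. lra. }
  rewrite xi_partial_sum. unfold Xi_of. fold z.
  set (Mx := fun n => W * ((INR n + 1) ^ K * decay (1 / 32) n)).
  assert (HexM : ex_series Mx) by (apply ex_series_Rscal, ex_series_decay; lra).
  eapply Rle_trans; [apply (Cseries_rest_le _ _ Mx (2 * N) (xi_hahn_series t))|].
  - intros n. fold z. rewrite Cmod_mult, Cmod_R. unfold Mx.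
    apply Rle_trans with (W * decay (1 / 32) n * (INR n + 1) ^ K); [|right; ring].
    apply Rmult_le_compat; auto using Rabs_pos, Cmod_ge_0. now apply hahn_growth.
  - exact HexM.
  - set (E := exp (- (1 / 64) * rpow (INR N) (2 / 3))).
    assert (HE : 0 < E) by apply exp_pos.
    assert (Hsh : ex_series (fun k => (INR (S (2 * N) + k) + 1) ^ K * decay (1 / 64) (S (2 * N) + k)))
      by (now apply (ex_series_incr_n (fun n => (INR n + 1) ^ K * decay (1 / 64) n))).
    apply Rle_trans with (Series (fun k => E * W * ((INR (S (2 * N) + k) + 1) ^ K * decay (1 / 64) (S (2 * N) + k)))).
    + apply Series_le; [|now apply ex_series_Rscal].
      intros k. set (n := (S (2 * N) + k)%nat). unfold Mx.
      assert (Hn := pos_INR n). assert (Hp : 0 < (INR n + 1) ^ K) by (apply pow_lt; lra).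
      assert (He : decay (1 / 32) n <= E * decay (1 / 64) n).
      { unfold decay, E. rewrite <- exp_plus. apply exp_monotone.
        assert (H := rpow_mono N n ltac:(unfold n; lia)). lra. }
      assert (He0 : 0 < decay (1 / 32) n) by apply exp_pos.
      split; [apply Rmult_le_pos; nra|].
      replace (E * W * ((INR n + 1) ^ K * decay (1 / 64) n))
        with (W * ((INR n + 1) ^ K * (E * decay (1 / 64) n))) by ring.
      apply Rmult_le_compat_l; [lra|]. apply Rmult_le_compat_l; lra.
    + rewrite Series_scal_l.
      assert (HR : Series (fun k => (INR (S (2 * N) + k) + 1) ^ K * decay (1 / 64) (S (2 * N) + k)) <= S_).
      { assert (Hs : 0 <= sum_n (fun n => (INR n + 1) ^ K * decay (1 / 64) n) (2 * N)).
        { generalize (2 * N)%nat. intros j. induction j as [|j IH]; [rewrite sum_O; apply Hpos|].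
          rewrite sum_n_RS. specialize (Hpos (S j)). lra. }
        assert (Eq := Series_incr_n (fun n => (INR n + 1) ^ K * decay (1 / 64) n) (S (2 * N))
          ltac:(lia) Hex).
        rewrite <- sum_n_Reals in Eq. cbn [pred] in Eq. unfold S_. rewrite Eq.
        eapply Rle_trans; [|apply Rplus_le_compat_r, Hs]. rewrite Rplus_0_l. apply Rle_refl. }
      apply Rle_trans with (E * W * S_); [apply Rmult_le_compat_l; nra | nra].
Qed.

(** Cover by the discs of integer radius about the origin. *)
Lemma Ccompact_bounded (K : C -> Prop) : Ccompact K -> exists B, forall z, K z -> Cmod z <= B.
Proof.
  intros HK.
  destruct (HK nat (fun i z => Cmod z < INR i)) as [l Hl].
  - intros i z Hz.
    assert (He : 0 < (INR i - Cmod z) / 2) by lra.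
    exists (mkposreal _ He). intros y [B1 B2]. simpl in B1, B2.
    change (Rabs (Re y - Re z) < (INR i - Cmod z) / 2) in B1.
    change (Rabs (Im y - Im z) < (INR i - Cmod z) / 2) in B2.
    replace y with (z + (y - z))%C by ring.
    eapply Rle_lt_trans; [apply Cmod_triangle|].
    assert (H := Cmod_le_parts (y - z)%C).
    change (Re (y - z)%C) with (Re y - Re z) in H. change (Im (y - z)%C) with (Im y - Im z) in H.
    lra.
  - intros z _. destruct (nat_above (Cmod z)) as [n Hn]. exists (S n). rewrite S_INR. lra.
  - exists (INR (list_max l)). intros z Hz. destruct (Hl z Hz) as [i [Hi Hlt]].
    assert (Him : (i <= list_max l)%nat).
    { assert (H := proj1 (list_max_le l (list_max l)) (le_n _)). rewrite Forall_forall in H. auto. }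
    apply le_INR in Him. lra.
Qed.

(** The complex numbers as a module over themselves and over the reals carry the same
    addition. *)
Lemma Csum_C_NormedModule (a : nat -> C) (N : nat) :
  sum_n (G := C_NormedModule) a N = Csum a N.
Proof.
  induction N as [|N IH]; [now rewrite sum_O, Csum_O|].
  rewrite sum_Sn, Csum_S, IH. reflexivity.
Qed.

Lemma exp_rpow_small (C1 C2 eps : R) : 0 < C1 -> 0 < C2 -> 0 < eps ->
  exists N0, forall N, (N0 <= N)%nat -> C1 * exp (- C2 * rpow (INR N) (2 / 3)) < eps.
Proof.
  intros H1 H2 He.
  assert (Hd := ex_series_decay 0 C2 H2). apply ex_series_lim_0, is_lim_seq_spec in Hd.
  assert (He' : 0 < eps / C1) by (apply Rdiv_lt_0_compat; lra).
  destruct (Hd (mkposreal _ He')) as [N0 HN]. exists N0. intros N HNN.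
  specialize (HN N HNN). cbn [pos] in HN. unfold decay in HN.
  rewrite pow_O, Rmult_1_l, Rminus_0_r, Rabs_right in HN by (left; apply exp_pos).
  replace (- C2 * rpow (INR N) (2 / 3)) with (- (C2 * rpow (INR N) (2 / 3))) by ring.
  apply (Rmult_lt_compat_l C1) in HN; auto.
  replace (C1 * (eps / C1)) with eps in HN by (field; lra). exact HN.
Qed.

Theorem theorem5p2 :
  exists xi : C -> C,
    is_riemann_xi xi /\
    (forall t : C,
       @is_series C_AbsRing C_NormedModule (xi_term t) (Xi_of xi t)) /\
    (forall K : C -> Prop, Ccompact K ->
       forall eps : R, 0 < eps ->
       exists N0 : nat, forall (N : nat) (t : C), (N0 <= N)%nat -> K t ->
         Cmod (Xi_of xi t - sum_n (xi_term t) N)%C < eps) /\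
    (forall K : C -> Prop, Ccompact K ->
       exists C1 C2 : R, 0 < C1 /\ 0 < C2 /\
       forall (N : nat) (t : C), K t ->
         Cmod (Xi_of xi t - sum_n (xi_term t) N)%C
           <= C1 * exp (- C2 * rpow (INR N) (2 / 3))).
Proof.
  exists xi_fun. split; [apply xi_fun_is_riemann_xi|].
  assert (HB : forall K : C -> Prop, Ccompact K ->
       exists C1 C2 : R, 0 < C1 /\ 0 < C2 /\
       forall (N : nat) (t : C), K t ->
         Cmod (Xi_of xi_fun t - sum_n (xi_term t) N)%C
           <= C1 * exp (- C2 * rpow (INR N) (2 / 3))).
  { intros K HK. destruct (Ccompact_bounded K HK) as [B HBd].
    destruct (xi_partial_sum_error B) as [C1 [C2 [H1 [H2 H]]]].
    exists C1, C2. split; [exact H1|]. split; [exact H2|]. intros N t Ht.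
    apply H. now apply HBd. }
  split; [|split; [|exact HB]].
  - intros t. destruct (xi_partial_sum_error (Cmod t)) as [C1 [C2 [H1 [H2 H]]]].
    apply filterlim_locally. intros eps.
    destruct (exp_rpow_small C1 C2 eps H1 H2 (cond_pos eps)) as [N0 HN]. exists N0.
    intros N HNN. apply ball_sym, (norm_compat1 (K := C_AbsRing) (V := C_NormedModule)).
    change (Cmod (Xi_of xi_fun t - sum_n (G := C_NormedModule) (xi_term t) N)%C < eps).
    rewrite Csum_C_NormedModule.
    eapply Rle_lt_trans; [apply H; lra | now apply HN].
  - intros K HK eps Heps. destruct (HB K HK) as [C1 [C2 [H1 [H2 H]]]].
    destruct (exp_rpow_small C1 C2 eps H1 H2 Heps) as [N0 HN]. exists N0.
    intros N t HNN Ht. eapply Rle_lt_trans; [now apply H | now apply HN].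
Qed.
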